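(* Let $\alpha,\beta>-1$ and $q>1$, and consider positive functions $u\in C^{2,\gamma}[-1,1]$ and $\lambda>0$ solving $$(1-t^2)u''+(\beta-\alpha-(\alpha+\beta+2)t)u'-\lambda(u-u^q)=0\quad\text{on }[-1,1]$$ (which entails $(2\beta+2)u'(-1)-\lambda(u(-1)-u(-1)^q)=0$ and $-(2\alpha+2)u'(1)-\lambda(u(1)-u(1)^q)=0$). Let $\lambda_k=\frac{k(k+\alpha+\beta+1)}{q-1}$. If $\lambda\ne\lambda_k$ for all $k\ge1$, the trivial family $\{(1,\lambda)\}$ is locally rigid at $(1,\lambda)$, i.e. some neighborhood of $(1,\lambda)$ in $C^{2,\gamma}[-1,1]\times(0,\infty)$ contains no solution $(u,\mu)$ with $u\ne1$. For each $k\ge1$, $(1,\lambda_k)$ is a bifurcation point, and the set of nontrivial solutions in a neighborhood of $(1,\lambda_k)$ is given by a smooth path $s\mapsto(u(s),\lambda(s))$ with $u(0)=1$, $\lambda(0)=\lambda_k$, $u(s)\ne1$ for $s\ne0$, and $\frac{du}{ds}(0)=P_k^{(\alpha,\beta)}$. Moreover $$\frac{d\lambda}{ds}(0)=C\int_{-1}^1\big(P_k^{(\alpha,\beta)}\big)^3(1-t)^\alpha(1+t)^\beta\,dt,\qquad C=\frac{-q\lambda_k}{2\int_{-1}^1\big(P_k^{(\alpha,\beta)}\big)^2(1-t)^\alpha(1+t)^\beta\,dt}<0.$$ If in addition $\alpha+\beta+1>0$, then: if $\alpha>\beta$, or $\alpha=\beta$ and $k$ is even, $\frac{d\lambda}{ds}(0)<0$;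 if $\alpha=\beta$ and $k$ is odd, $\frac{d\lambda}{ds}(0)=0$.
   Context: $P_k^{(\alpha,\beta)}$ denotes the Jacobi polynomial of degree $k$: the polynomial solution of $(1-t^2)y''+(\beta-\alpha-(\alpha+\beta+2)t)y'+k(k+\alpha+\beta+1)y=0$ normalized by $P_k^{(\alpha,\beta)}(t)=(1-t)^{-\alpha}(1+t)^{-\beta}\frac{(-1)^k}{2^kk!}\frac{d^k}{dt^k}\big((1-t)^{k+\alpha}(1+t)^{k+\beta}\big)$. Here $\gamma\in(0,1)$ is a Hölder exponent. *)

(* Defs.v *)
From Stdlib Require Import Reals Lra.
From Coquelicot Require Import Coquelicot.
Open Scope R_scope.

Definition inI (t : R) : Prop := -1 <= t <= 1.

Definition deriv_on (f f' : R -> R) : Prop :=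
  forall x, inI x -> forall eps, 0 < eps -> exists delta, 0 < delta /\
    forall y, inI y -> 0 < Rabs (y - x) < delta ->
      Rabs ((f y - f x) / (y - x) - f' x) < eps.

Definition holder_bound (gam : R) (g : R -> R) (d : R) : Prop :=
  forall s t, inI s -> inI t -> s <> t ->
    Rabs (g s - g t) <= d * Rpower (Rabs (s - t)) gam.

Definition C2g_with (gam : R) (f f1 f2 : R -> R) : Prop :=
  deriv_on f f1 /\ deriv_on f1 f2 /\ exists d, holder_bound gam f2 d.

Definition C2g (gam : R) (f : R -> R) : Prop :=
  exists f1 f2, C2g_with gam f f1 f2.

(* ||f||_{C^{2,gamma}[-1,1]} < eps, where
   ||f|| = sup|f| + sup|f'| + sup|f''| + [f'']_gamma. *)
Definition c2g_norm_lt (gam : R) (f : R -> R) (eps : R) : Prop :=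
  exists f1 f2, C2g_with gam f f1 f2 /\
  exists a b c d, a + b + c + d < eps /\
    (forall t, inI t -> Rabs (f t) <= a) /\
    (forall t, inI t -> Rabs (f1 t) <= b) /\
    (forall t, inI t -> Rabs (f2 t) <= c) /\
    holder_bound gam f2 d.

Definition is_solution (alpha beta q gam : R) (u : R -> R) (mu : R) : Prop :=
  0 < mu /\ (forall t, inI t -> 0 < u t) /\
  exists u1 u2, C2g_with gam u u1 u2 /\
    forall t, inI t ->
      (1 - t ^ 2) * u2 t + (beta - alpha - (alpha + beta + 2) * t) * u1 t
        - mu * (u t - Rpower (u t) q) = 0.

Definition is_one (u : R -> R) : Prop := forall t, inI t -> u t = 1.

Definition near (gam : R) (lam eps : R) (u : R -> R) (mu : R) : Prop :=
  c2g_norm_lt gam (fun t => u t - 1) eps /\ Rabs (mu - lam) < eps.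

Definition lambda_k (alpha beta q : R) (k : nat) : R :=
  INR k * (INR k + alpha + beta + 1) / (q - 1).

(* Jacobi polynomial via Rodrigues' formula (meaningful for -1 < t < 1). *)
Definition jacobiP (alpha beta : R) (k : nat) (t : R) : R :=
  Rpower (1 - t) (- alpha) * Rpower (1 + t) (- beta) *
  ((-1) ^ k / (2 ^ k * INR (Factorial.fact k))) *
  Derive_n (fun x => Rpower (1 - x) (INR k + alpha) * Rpower (1 + x) (INR k + beta)) k t.

Definition jweight (alpha beta t : R) : R :=
  Rpower (1 - t) alpha * Rpower (1 + t) beta.

Definition int_m11 (f : R -> R) : R :=
  RInt_gen f (at_right (-1)) (at_left 1).

Definition path_deriv (gam delta : R) (U V : R -> R -> R) : Prop :=
  forall s, -delta < s < delta -> forall eps, 0 < eps -> exists eta, 0 < eta /\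
    forall h, 0 < Rabs h < eta -> -delta < s + h < delta ->
      c2g_norm_lt gam (fun t => (U (s + h) t - U s t) / h - V s t) eps.

Fixpoint path_Cn (gam delta : R) (n : nat) (U : R -> R -> R) : Prop :=
  (forall s, -delta < s < delta -> C2g gam (U s)) /\
  match n with
  | O => True
  | S m => exists V, path_deriv gam delta U V /\ path_Cn gam delta m V
  end.

Definition path_smooth (gam delta : R) (U : R -> R -> R) : Prop :=
  forall n, path_Cn gam delta n U.

Definition real_smooth (delta : R) (L : R -> R) : Prop :=
  forall n s, -delta < s < delta -> ex_derive_n L n s.

Definition bifurcation_point (alpha beta q gam lam : R) : Prop :=
  forall eps, 0 < eps -> exists u mu,
    is_solution alpha beta q gam u mu /\ near gam lam eps u mu /\ ~ is_one u.

(* Main.v *)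
(** The branch is constructed by an analytic Lyapunov-Schmidt reduction.  In the variable
    [x = (1 - t) / 2] the Jacobi operator [D] is bidiagonal on monomials, so that
    [D + K], [K = k (k + alpha + beta + 1)], has an inverse on the complement of [P_k]
    which is bounded for the norm [sum_i |f_i| r^i] once [r] is large.  The equation
    then determines formal series [u = 1 + s P_k + ...] and [lambda = lambda_k + ...]
    with polynomial coefficients, and a majorant argument gives their convergence.

    Rigidity and uniqueness of the branch take place in the weighted [L^2] space:
    polynomials are dense (Bernstein), the eigenvalues of [D] are discrete, and hence
    [D + K] is bounded below on the orthogonal complement of its kernel, which
    absorbs the nonlinear remainder.

    The sign of [int P_k^3 w] comes from the moments [m_j = int P_k^2 P_j w].  The
    third-order differential equation for [P_k^2] makes them satisfy a three-term
    recurrence, whose coefficients for [j <= k] have the signs that propagate [m_0 > 0]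
    up to [m_k] when [alpha > beta]; when [alpha = beta] the recurrence only links
    indices of the same parity. *)
Require Import Defs.
From Stdlib Require Import Reals.
From Coquelicot Require Import Coquelicot.
From Stdlib Require Import Lra Lia Classical FunctionalExtensionality.
From mathcomp Require all_boot all_order all_algebra Rstruct ring lra.
Open Scope R_scope.

(** * Jacobi polynomials and the moments of their squares *)

(** The operator degenerates at both ends of [-1, 1], so existence is not sought by an implicit
    function theorem in Hoelder spaces but among power series in [s] with polynomial coefficients,
    where the coefficient norm of radius 8 controls the C^{2,gamma} norm. The noninteger power [u^q]
    is carried as a second unknown series [z] subject to [u z' = q u' z], a recursion linear in the
    newest coefficients; only at the end is [z] identified with [Rpower u q], separately for each
    [t]. Every coefficient of [u] after the first order is kept orthogonal to [P_k], so [s] is the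
    coordinate of [u - 1] along [P_k]. This coordinate can be read off from any solution, and
    uniqueness becomes a comparison of two solutions with the same [s]. The algebra is done over an
    abstract ordered field with a functional [J] that is linear, positive on squares and symmetric
    for the operator; the weighted integral is substituted for it later. *)

Section Jac.
Import all_boot all_order all_algebra Rstruct ring lra.
Import Order.TTheory GRing.Theory Num.Theory.
Local Open Scope ring_scope.
Local Set Implicit Arguments.
Local Unset Strict Implicit.
Local Unset Printing Implicit Defensive.
Variable F : realFieldType.
Implicit Types (a b c : F) (f g : {poly F}).

(** In the variable [x = (1 - t) / 2] with [w = x^a (1 - x)^b], [rho a b f] is
    [(x (1 - x) w f)' / w], [Dop] is the Jacobi operator, and [jacr a b k] is
    [(x^k (1 - x)^k w)^(k) / w = k! P_k]. *)
Definition rho a b f : {poly F} :=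
  ('X - 'X ^+ 2) * f^`() + ((a + 1)%:P - (a + b + 2)%:P * 'X) * f.
Definition Dop a b f : {poly F} := rho a b f^`().
Fixpoint jacr a b k : {poly F} :=
  if k is k'.+1 then rho a b (jacr (a + 1) (b + 1) k') else 1.
Definition Lam a b k : F := k%:R * (k%:R + (a + b + 1)).

Lemma rhoD a b f g : rho a b (f + g) = rho a b f + rho a b g.
Proof. rewrite /rho derivD; ring. Qed.
Lemma rhoZ a b c f : rho a b (c%:P * f) = c%:P * rho a b f.
Proof. rewrite /rho derivM derivC; ring. Qed.
Lemma DopD a b f g : Dop a b (f + g) = Dop a b f + Dop a b g.
Proof. by rewrite /Dop derivD rhoD. Qed.
Lemma DopZ a b c f : Dop a b (c%:P * f) = c%:P * Dop a b f.
Proof. by rewrite /Dop derivM derivC mul0r add0r rhoZ. Qed.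

(** Since [Dop a b] is [rho a b] after differentiation, this reduces to [(rho a b f)' = Dop (a + 1)
    (b + 1) f - (a + b + 2) f]. Raising both parameters intertwines the operators, which drives the
    induction on the degree. *)
Lemma Dop_rho a b f :
  Dop a b (rho a b f) = rho a b (Dop (a + 1) (b + 1) f - (a + b + 2)%:P * f).
Proof.
rewrite /Dop; congr (rho a b _); rewrite /rho.
rewrite !(derivD, derivN, derivM, derivC, derivXn, derivX) /= expr1.
ring.
Qed.

Lemma Dop_jacr a b k : Dop a b (jacr a b k) = (- Lam a b k)%:P * jacr a b k.
Proof.
elim: k a b => [|k IH] a b /=.
  by rewrite /Dop /rho derivC derivC /Lam; ring.
(* The eigenvalues match because [k (k + a + b + 3) + (a + b + 2) = (k + 1) (k + a + b + 2)]. *)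
rewrite Dop_rho IH -mulrBl -polyCB rhoZ; congr (_%:P * _).
rewrite /Lam -natr1; ring.
Qed.

Lemma coef_rho a b f j : (rho a b f)`_j.+1 =
  (j%:R + 1 + a + 1) * f`_j.+1 - (j%:R + a + b + 2) * f`_j.
Proof.
have -> : rho a b f = ('X * f^`() - 'X * ('X * f^`())) +
   ((a + 1)%:P * f - (a + b + 2)%:P * ('X * f)) by rewrite /rho; ring.
rewrite coefD !coefB !coefXM !coefCM coefXM /= !coef_deriv -mulr_natr.
case: j => [|j] /=; first ring.
rewrite -mulr_natr -!natr1; ring.
Qed.

Lemma size_rho a b f n : (size f <= n)%N -> (size (rho a b f) <= n.+1)%N.
Proof.
move=> /leq_sizeP sf; apply/leq_sizeP => -[//|j] nj.
by rewrite coef_rho (sf j.+1) ?(sf j) ?(leqW nj) ?mulr0 ?subr0 //; apply: ltnW.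
Qed.

Lemma size_jacr a b k : (size (jacr a b k) <= k.+1)%N.
Proof.
elim: k a b => [|k IH] a b /=; first by rewrite size_poly1.
exact: size_rho.
Qed.

(** Each [rho] multiplies the top coefficient, of index [j], by [- (j + a + b + 2)], which is
    negative for parameters above -1. This fixes the exact degree and, later, the sign of the upper
    recurrence coefficient. *)
Lemma lead_jacr a b k : -1 < a -> -1 < b -> 0 < (-1) ^+ k * (jacr a b k)`_k.
Proof.
have H : forall m a b, -1 < a -> -1 < b -> 0 < (-1) ^+ m * (jacr a b m)`_m.
  elim=> [|m IH] a' b' ha hb /=; first by rewrite coef1 mulr1.
  have s0 : (jacr (a' + 1) (b' + 1) m)`_m.+1 = 0.
    by apply: nth_default; exact: size_jacr.
  rewrite coef_rho s0 mulr0 sub0r exprS mulN1r mulrNN.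
  rewrite mulrCA; apply: mulr_gt0; last by apply: IH; lra.
  have : (0 : F) <= m%:R by rewrite ler0n. 
  lra.
exact: H.
Qed.

Lemma size_jacrE a b k : -1 < a -> -1 < b -> size (jacr a b k) = k.+1.
Proof.
move=> ha hb; apply/eqP; rewrite eqn_leq size_jacr /= ltnNge; apply/negP => h.
have := lead_jacr k ha hb; by rewrite (nth_default 0 h) mulr0 ltxx.
Qed.

(** * Orthogonality and the three-term recurrence for an abstract functional *)

Section Functional.
Variables a b : F.
Hypotheses (ha : -1 < a) (hb : -1 < b).
Variable J : {poly F} -> F.
Hypothesis JD : forall f g, J (f + g) = J f + J g.
Hypothesis JZ : forall c f, J (c%:P * f) = c * J f.
Hypothesis Jpos : forall f, f != 0 -> 0 < J (f * f).
Hypothesis Jsym : forall f g, J (Dop a b f * g) = J (f * Dop a b g).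

Let p k := jacr a b k.
Let L k := Lam a b k.

Lemma functionalN f : J (- f) = - J f.
Proof. by have := JZ (-1) f; rewrite polyCN mulN1r mulN1r. Qed.
Lemma functionalB f g : J (f - g) = J f - J g.
Proof. by rewrite JD functionalN. Qed.
Lemma functional0 : J 0 = 0.
Proof. by have := JZ 0 0; rewrite mulr0 mul0r. Qed.
Lemma functional_sum n (G : nat -> {poly F}) : J (\sum_(i < n) G i) = \sum_(i < n) J (G i).
Proof. by elim: n => [|n IH]; rewrite ?big_ord0 ?functional0 // !big_ord_recr /= JD IH. Qed.

Lemma jacr_neq0 k : p k != 0.
Proof. by rewrite -size_poly_gt0 /p size_jacrE. Qed.

(** The difference factors as [(j - i) (i + j + a + b + 1)]; the second factor is positive even if
    [a + b + 1] is negative, because [i < j] forces [1 <= i + j]. *)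
Lemma Lam_lt i j : (i < j)%N -> L i < L j.
Proof.
move=> ij; rewrite /L /Lam -subr_gt0.
have -> : j%:R * (j%:R + (a + b + 1)) - i%:R * (i%:R + (a + b + 1)) =
  (j%:R - i%:R) * (i%:R + j%:R + (a + b + 1)) :> F by ring.
have h : i%:R + 1 <= j%:R :> F by rewrite natr1 ler_nat.
have h0 : 0 <= i%:R :> F by rewrite ler0n.
apply: mulr_gt0; first by lra.
by move: ha hb => ha' hb'; lra.
Qed.

Lemma Lam_inj i j : i != j -> L i != L j.
Proof.
by rewrite neq_ltn => /orP[] /Lam_lt h; rewrite ?(lt_eqF h) // (gt_eqF h).
Qed.

Lemma jacr_orth i j : i != j -> J (p i * p j) = 0.
Proof.
move=> /Lam_inj ij.
have := Jsym (p i) (p j); rewrite /p !Dop_jacr -/(p i) -/(p j) mulrCA !JZ -mulrA JZ.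
rewrite -/(L i) -/(L j) !mulNr => /oppr_inj e.
have : (L i - L j) * J (p i * p j) = 0 by rewrite mulrBl e subrr.
by move/eqP; rewrite mulf_eq0 subr_eq0 (negbTE ij) => /eqP.
Qed.

Let h k := J (p k * p k).
Lemma jacr_norm_gt0 k : 0 < h k.
Proof. exact/Jpos/jacr_neq0. Qed.

Lemma jacr_span0 n f : (size f <= n)%N ->
  exists c : nat -> F, f = \sum_(i < n) (c i)%:P * p i.
Proof.
elim: n f => [|n IH] f sf.
  by exists (fun=> 0); rewrite big_ord0; apply/eqP; rewrite -size_poly_leq0.
have l0 : (p n)`_n != 0.
  by apply/eqP => e; have := lead_jacr n ha hb; rewrite -/(p n) e mulr0 ltxx.
pose c := f`_n / (p n)`_n.
have [|d Hd] := IH (f - c%:P * p n).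
  apply/leq_sizeP => j; rewrite leq_eqVlt => /orP[/eqP <-|nj].
    by rewrite coefB coefCM /c divfK // subrr.
  rewrite coefB coefCM !nth_default ?mulr0 ?subr0 //; first by rewrite /p size_jacrE.
  exact: leq_trans nj.
exists (fun i => if i == n then c else d i); rewrite big_ord_recr /= eqxx.
rewrite -[f in LHS](subrK (c%:P * p n)) {1}Hd; congr (_ + _).
by apply: eq_bigr => i _; rewrite (ltn_eqF (ltn_ord i)).
Qed.

Lemma jacr_coef n (c : nat -> F) j : (j < n)%N ->
  J ((\sum_(i < n) (c i)%:P * p i) * p j) = c j * h j.
Proof.
move=> jn; rewrite mulr_suml (functional_sum n (fun i => (c i)%:P * p i * p j)).
rewrite (bigD1 (Ordinal jn)) //= -mulrA JZ big1 ?addr0 // => i ij.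
rewrite -mulrA JZ jacr_orth ?mulr0 //; apply: contra ij => /eqP e; exact/eqP/val_inj.
Qed.

Lemma jacr_span n f : (size f <= n)%N ->
  f = \sum_(i < n) (J (f * p i) / h i)%:P * p i.
Proof.
move=> /jacr_span0 [c E]; rewrite [LHS]E; apply: eq_bigr => i _.
by rewrite E jacr_coef // mulfK // gt_eqF // jacr_norm_gt0.
Qed.

Lemma orth_low f n : (size f <= n)%N -> J (p n * f) = 0.
Proof.
move=> /jacr_span0 [c ->]; rewrite mulr_sumr (functional_sum n (fun i => p n * ((c i)%:P * p i))).
apply: big1 => i _; rewrite mulrCA JZ jacr_orth ?mulr0 //.
by rewrite gtn_eqF.
Qed.

Let t : {poly F} := 1 - 2%:P * 'X.
Let s : F := a + b + 1.
Let dl : F := a - b.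

(** Pairing this double commutator with an eigenfunction gives the middle coefficient
    of the three-term recurrence without any explicit formula for [P_k]. *)
Lemma double_comm f :
  Dop a b (Dop a b (t * f)) - 2%:P * Dop a b (t * Dop a b f) + t * Dop a b (Dop a b f) =
  (- 2)%:P * (Dop a b (t * f) + t * Dop a b f) + (s ^+ 2 - 1)%:P * (t * f) + (dl * (s - 1))%:P * f.
Proof.
rewrite /t /s /dl /Dop /rho.
do ![rewrite !(derivD, derivN, derivM, derivC, derivXn, derivX) /= ?expr1].
ring.
Qed.

Let E f : {poly F} := Dop a b (t * f) - t * Dop a b f + (dl%:P + (s + 1)%:P * t) * f.

(** The third-order equation satisfied by the square of an eigenfunction: here
    [G = 2 x (1 - x) f'^2] and [E g = - 4 x (1 - x) g'], written through [Dop] and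
    multiplication by [t] so that it can be paired with the [p j]. *)
Lemma square_ode f l : Dop a b f = (- l)%:P * f ->
  let z := f * f in let G := Dop a b z + (2 * l)%:P * z in
  E G - 4%:P * ((dl%:P + s%:P * t) * G) + (2 * l)%:P * E z = 0.
Proof.
move=> Hf z G.
have EE g : E g = (- 4)%:P * (('X - 'X^2) * g^`()).
  rewrite /E /t /s /dl /Dop /rho.
  do ![rewrite !(derivD, derivN, derivM, derivC, derivXn, derivX) /= ?expr1].
  ring.
have EG : G = 2%:P * (('X - 'X^2) * (f^`() * f^`())).
  have : G = 2%:P * (('X - 'X^2) * (f^`() * f^`())) + 2%:P * f * (Dop a b f - (- l)%:P * f).
    rewrite /G /z /Dop /rho !(derivD, derivN, derivM, derivC, derivXn, derivX) /=; ring.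
  by rewrite Hf subrr mulr0 addr0.
rewrite !EE EG.
suff -> : (-4)%:P * (('X - 'X^2) * (2%:P * (('X - 'X^2) * (f^`() * f^`())))^`()) -
  4%:P * ((dl%:P + s%:P * t) * (2%:P * (('X - 'X^2) * (f^`() * f^`())))) +
  (2 * l)%:P * ((-4)%:P * (('X - 'X^2) * z^`())) =
  (-16)%:P * ('X - 'X^2) * f^`() * (Dop a b f - (- l)%:P * f).
  by rewrite Hf subrr mulr0.
rewrite /z /t /s /dl /Dop /rho !(derivD, derivN, derivM, derivC, derivXn, derivX) /= expr1; ring.
Qed.

(** [A], [B], [C] are the upper, middle and lower coefficients of multiplication by [t]. The value 0
    of [C] at index 0 neutralizes the default [0.-1 = 0]. *)
Let B j := J (t * p j * p j) / h j.
Let A j := J (t * p j * p j.+1) / h j.+1.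
Let C j := if j is i.+1 then J (t * p j * p i) / h i else 0.

Lemma size_mul_t f n : (size f <= n)%N -> (size (t * f)%R <= n.+1)%N.
Proof.
move=> /leq_sizeP sf; apply/leq_sizeP => -[//|i] ni.
have -> : t * f = f - 2%:P * ('X * f) by rewrite /t; ring.
rewrite coefB coefCM coefXM /= (sf i.+1) ?(sf i) ?mulr0 ?subr0 //; exact: leqW.
Qed.

(** Components below [j - 1] vanish: [J (t p_j p_i) = J (p_j (t p_i))], and there [t p_i] has degree
    less than [j]. *)
Lemma three_term j : t * p j = (A j)%:P * p j.+1 + (B j)%:P * p j + (C j)%:P * p j.-1.
Proof.
have sz : (size (t * p j)%R <= j.+2)%N by apply: size_mul_t; exact: size_jacr.
rewrite (jacr_span sz).
case: j sz => [|j] sz /=.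
  by rewrite !big_ord_recr big_ord0 /= add0r polyC0 mul0r addr0 addrC.
rewrite !big_ord_recr /= big1 ?add0r => [|i _].
  by rewrite addrC addrCA addrA [in RHS]addrC addrA.
have -> : t * p j.+1 * p i = p j.+1 * (t * p i) by ring.
rewrite (@orth_low _ j.+1) ?mul0r ?polyC0 ?mul0r //.
apply: size_mul_t; exact: leq_trans (size_jacr a b i) (ltn_ord i).
Qed.

(** Comparison of top coefficients: multiplication by [t = 1 - 2 x] contributes -2, and the top
    coefficients of [p j] and [p j.+1] have opposite signs. *)
Lemma three_term_up_gt0 j : 0 < A j.
Proof.
have E1 : (t * p j)`_j.+1 = - 2 * (p j)`_j.
  have -> : t * p j = p j - 2%:P * ('X * p j) by rewrite /t; ring.
  by rewrite coefB coefCM coefXM /= (nth_default 0 (size_jacr _ _ _)); ring.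
have E2 : (t * p j)`_j.+1 = A j * (p j.+1)`_j.+1.
  have z1 : (p j)`_j.+1 = 0 by apply: nth_default; exact: size_jacr.
  have z2 : (p j.-1)`_j.+1 = 0.
    apply: nth_default; apply: leq_trans (size_jacr a b j.-1) _.
    by rewrite ltnS leq_pred.
  by rewrite three_term 2!coefD !coefCM z1 z2 !mulr0 !addr0.
have l1 := lead_jacr j ha hb; have l2 := lead_jacr j.+1 ha hb.
rewrite -(pmulr_lgt0 _ l2).
have -> : A j * ((-1) ^+ j.+1 * (jacr a b j.+1)`_j.+1) = 2 * ((-1) ^+ j * (jacr a b j)`_j).
  by rewrite mulrCA -/(p j.+1) -E2 E1 exprS; ring.
by apply: mulr_gt0 => //; rewrite ltr0n.
Qed.

(** Multiplication by [t] is symmetric, whence [C j.+1 * h j = A j * h j.+1]. *)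
Lemma three_term_down_gt0 j : 0 < C j.+1.
Proof.
have -> : C j.+1 = A j * h j.+1 / h j.
  rewrite /C /A divfK; last by rewrite gt_eqF //; exact: jacr_norm_gt0.
  by congr (J _ / _); ring.
have ? := three_term_up_gt0 j; have ? := jacr_norm_gt0 j; have ? := jacr_norm_gt0 j.+1.
by rewrite divr_gt0 // mulr_gt0.
Qed.

Lemma Dop_jacr_eigen j : Dop a b (p j) = (- L j)%:P * p j.
Proof. exact: Dop_jacr. Qed.

Lemma functional_Dop f j : J (Dop a b f * p j) = - L j * J (f * p j).
Proof. by rewrite Jsym Dop_jacr_eigen mulrCA JZ. Qed.

(** Paired with the eigenfunction [q] itself, every [Dop] in [double_comm] becomes [- l]; the left
    side cancels as [l^2 - 2 l^2 + l^2], and only the lower-order right side survives. *)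
Lemma double_comm_diag q l : Dop a b q = (- l)%:P * q ->
  (4 * l + (s ^+ 2 - 1)) * J (t * q * q) + dl * (s - 1) * J (q * q) = 0.
Proof.
move=> Hq.
have JDq f : J (Dop a b f * q) = - l * J (f * q) by rewrite Jsym Hq mulrCA JZ.
have e : t * ((- l)%:P * q) = (- l)%:P * (t * q) by rewrite mulrCA.
have := congr1 (fun g => J (g * q)) (double_comm q).
rewrite Hq DopZ Hq !e DopZ.
have -> : J ((Dop a b (Dop a b (t * q)) - 2%:P * ((- l)%:P * Dop a b (t * q)) +
    t * ((- l)%:P * ((- l)%:P * q))) * q) =
  J (Dop a b (Dop a b (t * q)) * q) - 2 * (- l * J (Dop a b (t * q) * q)) + l ^+ 2 * J (t * q * q).
  by rewrite -!JZ -functionalB -JD; congr J; ring.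
have -> : J (((- 2)%:P * (Dop a b (t * q) + (- l)%:P * (t * q)) +
     (s ^+ 2 - 1)%:P * (t * q) + (dl * (s - 1))%:P * q) * q) =
  - 2 * (J (Dop a b (t * q) * q) - l * J (t * q * q)) + (s ^+ 2 - 1) * J (t * q * q) +
     dl * (s - 1) * J (q * q).
  by rewrite -[l * _]JZ -functionalB -!JZ -!JD; congr J; ring.
rewrite !JDq => e'; apply/eqP; move/eqP: e'; rewrite -subr_eq0 -oppr_eq0 => /eqP e'.
by rewrite -[X in _ == X]e'; apply/eqP; ring.
Qed.

Lemma three_term_diagE j : B j * (4 * L j + (s ^+ 2 - 1)) = - (dl * (s - 1)).
Proof.
have := double_comm_diag (Dop_jacr_eigen j); rewrite -/(h j).
have h0 : h j != 0 by rewrite gt_eqF //; exact: jacr_norm_gt0.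
have -> : J (t * p j * p j) = B j * h j by rewrite /B divfK.
move=> e; apply: (mulIf h0); apply/eqP; rewrite -subr_eq0; apply/eqP; rewrite -[RHS]e; ring.
Qed.

(** At index 0 the general relation reads [B 0 (s^2 - 1) = - dl (s - 1)] and is empty when [s = 1].
    Pairing [Dop t] with a constant gives it with the factor [s - 1] cancelled. *)
Lemma three_term_diag0 : B 0 * (s + 1) = - dl.
Proof.
have := functional_Dop t 0.
have -> : Dop a b t * p 0 = - ((s + 1)%:P * (t * p 0 * p 0)) - dl%:P * (p 0 * p 0).
  rewrite /p /= /Dop /rho /t /s /dl !(derivD, derivN, derivM, derivC, derivXn, derivX) /=; ring.
rewrite functionalB functionalN (JZ (s + 1)) (JZ dl) -/(h 0) /L /Lam mul0r oppr0 mul0r.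
have h0 : h 0 != 0 by rewrite gt_eqF //; exact: jacr_norm_gt0.
have -> : J (t * p 0 * p 0) = B 0 * h 0 by rewrite /B divfK.
move=> e.
apply: (mulIf h0); rewrite mulNr; apply/eqP; rewrite -subr_eq0 -oppr_eq0; apply/eqP.
by rewrite -e; ring.
Qed.

(** [Dop] is moved onto [p j] and [t * p j] is expanded by the three-term recurrence; the commutator
    part of [E] then produces the differences of eigenvalues. *)
Lemma moment_ladder f j : J (E f * p j) =
  A j * (L j.+1 - L j + (s + 1)) * J (f * p j.+1) +
  (B j * (s + 1) + dl) * J (f * p j) +
  C j * (L j.-1 - L j + (s + 1)) * J (f * p j.-1).
Proof.
move: (p j.+1) (p j) (p j.-1) (Dop_jacr_eigen j.+1) (Dop_jacr_eigen j) (Dop_jacr_eigen j.-1) (three_term j) => q1 q q2 H1 H H2 Ht.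
have -> : J (E f * q) = - L j * J (f * (t * q)) - J (f * Dop a b (t * q)) +
   (s + 1) * J (f * (t * q)) + dl * J (f * q).
  rewrite -Jsym.
  have -> : - L j * J (f * (t * q)) = J (Dop a b (t * f) * q).
    by rewrite Jsym H (mulrCA _ (- L j)%:P) JZ; congr (_ * J _); ring.
  rewrite -!JZ -functionalB -!JD; congr J; rewrite /E; ring.
rewrite Ht !(DopD, DopZ) H1 H H2 !mulrDr.
have J3 c c' r : J (f * (c%:P * (c'%:P * r))) = c * c' * J (f * r).
  have -> : f * (c%:P * (c'%:P * r)) = c%:P * (c'%:P * (f * r)) by ring.
  by rewrite !JZ mulrA.
have J2 c r : J (f * (c%:P * r)) = c * J (f * r) by rewrite mulrCA JZ.
rewrite !JD !J3 !J2 /s; ring.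
Qed.

(** * The recurrence for the moments of the square of an eigenfunction *)

Section Cube.
Variable k : nat.
Hypothesis k1 : (1 <= k)%N.
Hypothesis s0 : 0 < s.
Let m j := J (p k * p k * p j).
Let K := L k.
Let Q j := B j * ((s + 1) * (4 * K - L j) - 4 * s * (2 * K - L j)) + dl * (3 * L j - 4 * K).

(** This is [square_ode] paired with [p j]: the moments of [G] are [(2 K - L i) * m i], and
    [moment_ladder] handles both terms in [E]. *)
Lemma moment_rec j : A j * (((L j.+1 - L j + (s + 1)) * (4 * K - L j.+1)) - 4 * s * (2 * K - L j.+1)) * m j.+1
   + Q j * m j +
   C j * ((L j.-1 - L j + (s + 1)) * (4 * K - L j.-1) - 4 * s * (2 * K - L j.-1)) * m j.-1 = 0.
Proof.
have := congr1 (fun g => J (g * p j)) (square_ode (Dop_jacr_eigen k)).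
rewrite -/K mul0r functional0 /=; set z := p k * p k; set G := Dop a b z + _.
have JG i : J (G * p i) = (2 * K - L i) * m i.
  by rewrite /G mulrDl JD functional_Dop -(mulrA _%:P) JZ -/(m i); ring.
have JGt : J (G * (t * p j)) = A j * J (G * p j.+1) + B j * J (G * p j) + C j * J (G * p j.-1).
  by rewrite three_term -!JZ -!JD; congr J; ring.
have -> : J ((E G - 4%:P * ((dl%:P + s%:P * t) * G) + (2 * K)%:P * E z) * p j) =
  J (E G * p j) - 4 * (dl * J (G * p j) + s * J (G * (t * p j))) + 2 * K * J (E z * p j).
  by rewrite -!JZ -!JD -!JZ -functionalB -!JD; congr J; ring.
rewrite !moment_ladder JGt !JG -!/(m _) => e; rewrite -e /Q; ring.
Qed.

(** [T] and [S] are the outer coefficients of [moment_rec] in factored form. The factored form shows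
    the signs: the first positive zeros, [2 k + s] for [T] and [2 k] for [S], lie beyond the range
    [j <= k]. *)
Let T j : F := 2 * (j%:R * (2 * k%:R + s - j%:R) * (2 * k%:R + s + j%:R)).
Let S j : F := 2 * ((j%:R + s) * (2 * k%:R - j%:R) * (2 * k%:R + j%:R + 2 * s)).

(** For [0 < s], [0 <= dl] and indices in the range [j <= k], the coefficients [A], [C],
    [T], [S] and [- Q] are nonnegative, so positivity propagates from [m 0]. *)
Lemma moment_recS j : A j.+1 * T j.+2 * m j.+2 = - Q j.+1 * m j.+1 + C j.+1 * S j * m j.
Proof.
have e := moment_rec j.+1; apply/eqP; rewrite -subr_eq0; apply/eqP; rewrite -[RHS]e /=.
rewrite /T /S /Q /K /L /Lam -/s -!natr1 ; ring.
Qed.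
Lemma moment_rec1 : A 0 * T 1 * m 1 = - Q 0 * m 0.
Proof.
have e := moment_rec 0; apply/eqP; rewrite -subr_eq0; apply/eqP; rewrite -[RHS]e /=.
rewrite /T /S /Q /K /L /Lam -/s; ring.
Qed.

Lemma moment_up_gt0 j : (1 <= j)%N -> (j <= k)%N -> 0 < T j.
Proof.
move=> j1 jk; rewrite /T.
have h1 : 1 <= j%:R :> F by rewrite ler1n.
have h2 : j%:R <= k%:R :> F by rewrite ler_nat.
by rewrite !mulr_gt0 //; move: s0 => s0'; lra.
Qed.
Lemma moment_down_gt0 j : (j < k)%N -> 0 < S j.
Proof.
move=> jk; rewrite /S.
have h1 : 0 <= j%:R :> F by rewrite ler0n.
have h2 : j%:R + 1 <= k%:R :> F by rewrite natr1 ler_nat.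
by rewrite !mulr_gt0 //; move: s0 => s0'; lra.
Qed.

Lemma Lam_ge : 1 + s <= K.
Proof.
rewrite /K /L /Lam -/s.
have k1' : 1 <= k%:R :> F by rewrite ler1n.
have : 0 <= (k%:R - 1) * (k%:R + 1 + s).
  by apply: mulr_ge0; move: s0 => s0'; lra.
lra.
Qed.

(** Both [B j] and the explicit term of [Q j] are multiples of [dl]. Keeping [dl] as a factor serves
    the strict case and the symmetric case at once. For positive indices the constant comes from
    clearing the denominator [N], the factor of [B] in [three_term_diagE]; its numerator is positive
    because [1 + s <= L j <= K]. *)
Lemma moment_diag_le0 j : (j <= k)%N -> exists2 c : F, 0 < c & Q j = - (dl * c).
Proof.
case: j => [|j] jk.
  exists (8 * K / (s + 1)).
    have K0 : 0 < K by apply: lt_le_trans Lam_ge; move: s0 => s0'; lra.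
    apply: divr_gt0; first by apply: mulr_gt0 => //; rewrite ltr0n.
    by apply: addr_gt0.
  have s1 : s + 1 != 0 by rewrite gt_eqF //; move: s0 => s0'; lra.
  apply: (mulIf s1); rewrite mulNr -[dl * _ * _]mulrA divfK //.
  rewrite /Q [L 0]/L /Lam mul0r.
  have e : B 0 * (s + 1) = - dl := three_term_diag0.
  by rewrite mulrDl mulrAC e; ring.
have Lge : 1 + s <= L j.+1.
  rewrite /L /Lam -/s -natr1.
  have j0 : 0 <= j%:R :> F by rewrite ler0n.
  have : 0 <= j%:R * (j%:R + 2 + s).
    by apply: mulr_ge0; move: s0 => s0'; lra.
  lra.
have LK : L j.+1 <= K.
  by move: jk; rewrite leq_eqVlt => /orP[/eqP ->|/Lam_lt /ltW].
pose N := 4 * L j.+1 + (s ^+ 2 - 1).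
have N0 : 0 < N.
  rewrite /N; have : 0 <= s ^+ 2 by apply: sqr_ge0.
  by move: s0 => s0'; lra.
exists (4 * (L j.+1 * (L j.+1 + s - 1) + (K - L j.+1) * (4 * L j.+1 + 2 * s - 2)) / N).
  rewrite divr_gt0 // mulr_gt0 // ltr_pwDl //.
    by rewrite mulr_gt0 //; move: s0 => s0'; lra.
  by rewrite mulr_ge0 //; move: s0 => s0'; lra.
apply: (mulIf (lt0r_neq0 N0)); rewrite mulNr -[dl * _ * _]mulrA divfK ?lt0r_neq0 //.
rewrite /Q mulrDl mulrAC (three_term_diagE j.+1) /N; ring.
Qed.

Lemma moment0_gt0 : 0 < m 0.
Proof. by rewrite /m mulr1; exact: jacr_norm_gt0. Qed.

Lemma moment_gt0 j : 0 < dl -> (j <= k)%N -> 0 < m j.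
Proof.
move=> d0; suff H : ((j <= k)%N -> 0 < m j) /\ ((j.+1 <= k)%N -> 0 < m j.+1) by case: H.
elim: j => [|j [IH1 IH2]]; split=> // jk.
- exact: moment0_gt0.
- have [c c0 e] := moment_diag_le0 (leq0n k).
  rewrite -(pmulr_rgt0 _ (mulr_gt0 (three_term_up_gt0 0) (@moment_up_gt0 1 isT jk))) moment_rec1 e opprK.
  by rewrite !mulr_gt0 // moment0_gt0.
- have jk' : (j.+1 <= k)%N by exact: ltnW.
  have [c c0 e] := moment_diag_le0 jk'.
  rewrite -(pmulr_rgt0 _ (mulr_gt0 (three_term_up_gt0 j.+1) (@moment_up_gt0 j.+2 isT jk))) moment_recS e opprK.
  apply: addr_gt0; first by rewrite !mulr_gt0 // IH2.
  have C0 := three_term_down_gt0 j; have S0 := moment_down_gt0 jk'; have m0 := IH1 (ltnW jk').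
  by apply: mulr_gt0 => //; apply: mulr_gt0.
Qed.

Lemma moment_parity j : dl = 0 -> (j <= k)%N -> if odd j then m j = 0 else 0 < m j.
Proof.
move=> d0; pose P j := (j <= k)%N -> if odd j then m j = 0 else 0 < m j.
suff H : P j /\ P j.+1 by case: H.
have Q0 i : (i <= k)%N -> Q i = 0.
  by move=> ik; have [c _ ->] := moment_diag_le0 ik; rewrite d0 mul0r oppr0.
elim: j => [|j [IH1 IH2]]; split=> // jk.
- exact: moment0_gt0.
- have := moment_rec1; rewrite Q0 // oppr0 mul0r => /eqP.
  by rewrite mulf_eq0 (gt_eqF (mulr_gt0 (three_term_up_gt0 0) (@moment_up_gt0 1 isT jk))) /= => /eqP.
- have jk' : (j.+1 <= k)%N by exact: ltnW.
  have := moment_recS j; rewrite Q0 // oppr0 mul0r add0r /= negbK.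
  have AT := mulr_gt0 (three_term_up_gt0 j.+1) (@moment_up_gt0 j.+2 isT jk).
  have CS := mulr_gt0 (three_term_down_gt0 j) (moment_down_gt0 jk').
  have := IH1 (ltnW jk'); case: (odd j) => [->|mj].
    by rewrite mulr0 => /eqP; rewrite mulf_eq0 (gt_eqF AT) /= => /eqP.
  by move=> e; rewrite -(pmulr_rgt0 _ AT) e; apply: mulr_gt0.
Qed.
End Cube.
End Functional.
End Jac.

(** * Inverting the Jacobi operator in a weighted coefficient norm *)

Section Norm.
Import all_boot all_order all_algebra Rstruct ring lra.
Import Order.TTheory GRing.Theory Num.Theory.
Local Open Scope ring_scope.
Local Set Implicit Arguments.
Local Unset Strict Implicit.
Local Unset Printing Implicit Defensive.
Variable F : realFieldType.
Implicit Types (a b c r : F) (f g : {poly F}).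

Definition nrm r f : F := \sum_(i < size f) `|f`_i| * r ^+ i.

Lemma nrm_wide r f n : (size f <= n)%N -> nrm r f = \sum_(i < n) `|f`_i| * r ^+ i.
Proof.
move=> fn; rewrite /nrm (big_ord_widen n (fun i => `|f`_i| * r ^+ i)) //.
rewrite big_mkcond /=; apply: eq_bigr => i _; case: ltnP => // h.
by rewrite (nth_default 0 h) normr0 mul0r.
Qed.

Lemma nrm_cons r f c : nrm r (f * 'X + c%:P) = r * nrm r f + `|c|.
Proof.
have sz : (size (f * 'X + c%:P)%R <= (size f).+1)%N.
  apply: leq_trans (size_polyD _ _) _; rewrite geq_max.
  rewrite (leq_trans (size_polyC_leq1 c)) // andbT.
  by apply: leq_trans (size_polyMleq _ _) _; rewrite size_polyX addn2.
rewrite (nrm_wide _ sz) big_ord_recl /= coefD coefMX coefC /= add0r expr0 mulr1 addrC.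
congr (_ + _); rewrite /nrm mulr_sumr; apply: eq_bigr => i _.
by rewrite /bump /= add1n coefD coefMX coefC /= addr0 exprS mulrCA.
Qed.

Lemma nrm0 r : nrm r 0 = 0.
Proof. by rewrite /nrm size_poly0 big_ord0. Qed.

Lemma nrm_ge0 r f : 0 <= r -> 0 <= nrm r f.
Proof. by move=> r0; apply: sumr_ge0 => i _; rewrite mulr_ge0 ?exprn_ge0. Qed.

Lemma nrmC r c : nrm r c%:P = `|c|.
Proof. by have := nrm_cons r 0 c; rewrite mul0r add0r nrm0 mulr0 add0r. Qed.

Lemma nrmX r f : nrm r (f * 'X) = r * nrm r f.
Proof. by have := nrm_cons r f 0; rewrite polyC0 addr0 normr0 addr0. Qed.

Lemma nrmD r f g : 0 <= r -> nrm r (f + g) <= nrm r f + nrm r g.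
Proof.
move=> r0; pose n := maxn (size f) (size g).
rewrite (@nrm_wide _ f n) ?leq_maxl // (@nrm_wide _ g n) ?leq_maxr //.
rewrite (@nrm_wide _ (f + g) n) ?size_polyD // -big_split /=.
apply: ler_sum => i _; rewrite coefD -mulrDl ler_wpM2r ?exprn_ge0 //.
exact: ler_normD.
Qed.

Lemma nrmZ r c f : nrm r (c%:P * f) = `|c| * nrm r f.
Proof.
have sz : (size (c%:P * f)%R <= size f)%N by rewrite mul_polyC size_scale_leq.
rewrite (nrm_wide _ sz) /nrm mulr_sumr; apply: eq_bigr => i _.
by rewrite coefCM normrM mulrA.
Qed.

Lemma nrmN r f : nrm r (- f) = nrm r f.
Proof. by have := nrmZ r (-1) f; rewrite polyCN mulN1r normrN1 mul1r. Qed.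

Lemma nrmB r f g : 0 <= r -> nrm r (f - g) <= nrm r f + nrm r g.
Proof. by move=> r0; rewrite -(nrmN r g); exact: nrmD. Qed.

Lemma nrm_sum r n (G : nat -> {poly F}) : 0 <= r ->
  nrm r (\sum_(i < n) G i) <= \sum_(i < n) nrm r (G i).
Proof.
move=> r0; elim: n => [|n IH]; first by rewrite !big_ord0 nrm0.
rewrite !big_ord_recr /=; apply: le_trans (nrmD _ _ r0) _; exact: lerD.
Qed.

Lemma nrmM r f g : 0 <= r -> nrm r (f * g) <= nrm r f * nrm r g.
Proof.
move=> r0; elim/poly_ind: f => [|f c IH]; first by rewrite mul0r nrm0 mul0r.
rewrite mulrDl mulrAC nrm_cons mulrDl; apply: le_trans (nrmD _ _ r0) _.
by rewrite nrmX nrmZ lerD // -mulrA ler_wpM2l.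
Qed.

Lemma nrm_horner r f x : 1 <= r -> `|x| <= 1 -> `|f.[x]| <= nrm r f.
Proof.
move=> r1 x1; elim/poly_ind: f => [|f c IH]; first by rewrite horner0 normr0 nrm0.
rewrite hornerMXaddC nrm_cons; apply: le_trans (ler_normD _ _) _.
rewrite lerD // normrM mulrC; apply: ler_pM => //; exact: le_trans r1.
Qed.

(** The factor [i + 1] from differentiation is absorbed by [2 ^ (i + 1)], and the missing power of
    [r] by [1 <= r]. *)
Lemma nrm_deriv r f : 1 <= r -> nrm r f^`() <= nrm (2 * r) f.
Proof.
move=> r1; have r0 : 0 <= r by apply: le_trans r1.
have sd : (size f^`() <= size f)%N.
  have [->|/lt_size_deriv/ltnW //] := eqVneq f 0; by rewrite derivC size_poly0.
rewrite (nrm_wide _ (leqW sd)) (nrm_wide _ (leqnSn (size f))) big_ord_recr /=.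
rewrite (nth_default 0 sd) normr0 mul0r addr0 big_ord_recl /= ler_wpDl //.
  by rewrite mulr_ge0 ?exprn_ge0 // mulr_ge0.
apply: ler_sum => i _; rewrite /bump /= add1n coef_deriv normrMn -[X in X * _ <= _]mulr_natr -mulrA.
rewrite ler_wpM2l // exprMn ler_pM ?exprn_ge0 ?ler0n //.
  by rewrite -natrX ler_nat ltnW // ltn_expl.
by rewrite exprS ler_peMl ?exprn_ge0.
Qed.

Section Inverse.
Variables a b : F.
Hypotheses (ha : -1 < a) (hb : -1 < b).
Variable k : nat.
Hypothesis k1 : (1 <= k)%N.
Let K := Lam a b k.
Let L := Lam a b.

(** [Dop] is bidiagonal on monomials: [Dop x^i = i (i + a) x^(i-1) - L i x^i].  Hence
    [Dop + K] is inverted degree by degree, up to a multiple of [x^k]. *)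
Fixpoint monoinv i : {poly F} :=
  if i is i'.+1 then
    if i == k then 0 else ((K - L i)^-1)%:P * ('X^i - (i%:R * (i%:R + a))%:P * monoinv i')
  else (K^-1)%:P.

Lemma Lam_gt0 : 0 < K.
Proof.
rewrite /K /Lam; have k0 : 1 <= k%:R :> F by rewrite ler1n.
by apply: mulr_gt0; move: ha hb => ha' hb'; lra.
Qed.

Lemma Dop_Xn i : Dop a b 'X^(i.+1) = (i.+1%:R * (i.+1%:R + a))%:P * 'X^i - (L i.+1)%:P * 'X^(i.+1).
Proof.
have H m : 'X * ('X^m)^`() = (m%:R)%:P * 'X^m :> {poly F}.
  case: m => [|m]; first by rewrite expr0 derivC mulr0 polyC0 mul0r.
  by rewrite derivXn /= mulrnAr -exprS polyC_natr mulr_natl.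
rewrite /Dop /rho derivXn /= -mulr_natl derivM.
rewrite -polyC_natr derivC mul0r add0r.
have -> : 'X - 'X^2 = (1 - 'X) * 'X :> {poly F} by ring.
have -> : (1 - 'X) * 'X * ((i.+1%:R)%:P * ('X^i)^`()) = (1 - 'X) * (i.+1%:R)%:P * ('X * ('X^i)^`()) :> {poly F} by ring.
rewrite H /L /Lam exprS -natr1; ring.
Qed.

Lemma monoinvE i : exists c, Dop a b (monoinv i) + K%:P * monoinv i = 'X^i - c%:P * 'X^k.
Proof.
have K0 : K != 0 by rewrite gt_eqF // Lam_gt0.
elim: i => [|i [c IH]].
  exists 0; rewrite /= /Dop /rho derivC derivC !mulr0 !add0r -polyCM divff //.
  by rewrite polyC0 mul0r subr0.
rewrite [monoinv _]/=; have [<-|ik] := eqVneq.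
  by exists 1; rewrite /Dop /rho derivC derivC; ring.
have KL : K - L i.+1 != 0.
  rewrite subr_eq0; apply: contra_neq ik => e; apply/eqP; apply: contraT => n.
  by move: (Lam_inj ha hb n); rewrite -/(L i.+1) -/K e eqxx.
exists (- ((K - L i.+1)^-1 * (i.+1%:R * (i.+1%:R + a)) * c)).
rewrite DopZ; set m := monoinv i; set e := (K - _)^-1.
have ee : e * (K - L i.+1) = 1 by rewrite mulVf.
have -> : Dop a b ('X^(i.+1) - (i.+1%:R * (i.+1%:R + a))%:P * m) =
  Dop a b 'X^(i.+1) + (- (i.+1%:R * (i.+1%:R + a)))%:P * Dop a b m.
  by rewrite -DopZ -DopD; congr (Dop a b _); ring.
rewrite Dop_Xn.
have -> : Dop a b m = 'X^i - c%:P * 'X^k - K%:P * m by rewrite -IH addrK.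
transitivity ((e * (K - L i.+1))%:P * 'X^(i.+1) +
   (e * (i.+1%:R * (i.+1%:R + a)) * c)%:P * 'X^k); first by ring.
by rewrite ee; ring.
Qed.

(** With [c = k + a + b + 1 > 0] one has [K - L i = (k - i) (i + c)]. The first factor is at least 1
    in absolute value, and [i (i + a)] grows quadratically like the denominator, so both quotients
    are bounded uniformly in [i]. *)
Lemma Lam_gap : exists2 M, 1 <= M & forall i, i != k ->
  `|(K - L i)^-1| <= M /\ `|i%:R * (i%:R + a) * (K - L i)^-1| <= M.
Proof.
have kc : 1 <= k%:R :> F by rewrite ler1n.
pose c := k%:R + (a + b + 1).
have c0 : 0 < c by rewrite /c; move: ha hb => ha' hb'; lra.
have cE : c = k%:R + (a + b + 1) by [].
move: c c0 cE => c c0 cE.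
have na : 0 <= `|a| by exact: normr_ge0.
exists (1 + c^-1 + (k%:R + 1) * (1 + `|a|)).
  have : 0 < c^-1 by rewrite invr_gt0.
  have : 0 <= (k%:R + 1) * (1 + `|a|) by apply: mulr_ge0; lra.
  lra.
have ci0 : 0 < c^-1 by rewrite invr_gt0.
have ka : 0 <= (k%:R + 1) * (1 + `|a|) by apply: mulr_ge0; lra.
move=> i ik; have i0 : 0 <= i%:R :> F by rewrite ler0n.
have e : K - L i = (k%:R - i%:R) * (i%:R + c) by rewrite /K /L /Lam cE; ring.
pose d : F := `|k%:R - i%:R|.
(* The inequality [i <= (k + 1) |k - i|] expresses uniformly that the distance to [k] grows linearly
   with [i]. *)
have d1 : 1 <= d /\ i%:R <= (k%:R + 1) * d.
  rewrite /d; move: ik; rewrite neq_ltn => /orP[] h.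
    have h' : i%:R + 1 <= k%:R :> F by rewrite natr1 ler_nat.
    rewrite ger0_norm; last by lra.
    split; first by lra.
    have : 0 <= (k%:R + 1) * (k%:R - i%:R - 1) :> F by apply: mulr_ge0; lra.
    lra.
  have h' : k%:R + 1 <= i%:R :> F by rewrite natr1 ler_nat.
  rewrite ler0_norm; last by lra.
  split; first by lra.
  have : 0 <= k%:R * (i%:R - k%:R - 1) :> F by apply: mulr_ge0; lra.
  lra.
case: d1 => d1 d2.
have en : `|K - L i| = d * (i%:R + c) by rewrite e normrM (ger0_norm (_ : 0 <= i%:R + c)) //; lra.
move: d d1 d2 en => d d1 d2 en.
have d0 : 0 < d by lra.
have ic : 0 < i%:R + c by lra.
have dic : 0 < d * (i%:R + c) by apply: mulr_gt0.
rewrite normrM normfV en; split.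
  rewrite -[_^-1]mul1r ler_pdivrMr //.
  have : 1 <= c^-1 * (d * (i%:R + c)).
    have h : c <= d * (i%:R + c).
      by apply: (@le_trans _ _ (i%:R + c)); [rewrite lerDr | rewrite ler_peMl // ltW].
    by have := ler_wpM2l (ltW ci0) h; rewrite mulVf // gt_eqF.
  have : 0 <= (1 + (k%:R + 1) * (1 + `|a|)) * (d * (i%:R + c)).
    by apply: mulr_ge0; lra.
  lra.
rewrite ler_pdivrMr // normrM (ger0_norm i0).
have h1 : `|i%:R + a| <= i%:R + `|a| by apply: le_trans (ler_normD _ _) _; rewrite (ger0_norm i0).
have h2 : i%:R * `|i%:R + a| <= i%:R * (i%:R + `|a|) by rewrite ler_wpM2l.
have h3 : i%:R * (i%:R + `|a|) <= (k%:R + 1) * (1 + `|a|) * (d * (i%:R + c)).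
  case: (posnP i) => [->|ipos].
    by rewrite mul0r; apply: mulr_ge0 => //; apply: ltW; apply: mulr_gt0 => //; lra.
  have i1 : 1 <= i%:R :> F by rewrite ler1n.
  have h4 : i%:R + `|a| <= (1 + `|a|) * (i%:R + c).
    have : 0 <= `|a| * (i%:R - 1 + c) by apply: mulr_ge0; lra.
    lra.
  have -> : (k%:R + 1) * (1 + `|a|) * (d * (i%:R + c)) = ((k%:R + 1) * d) * ((1 + `|a|) * (i%:R + c)) by ring.
  by apply: ler_pM => //; lra.
have : 0 <= (1 + c^-1) * (d * (i%:R + c)) by apply: mulr_ge0; lra.
lra.
Qed.

(** The off-diagonal entry of [Dop] lowers the degree by one: it costs a factor [M] but gains
    [1 / r]. For [2 * M <= r] the recursive term therefore adds at most [M * r ^ i], as much as the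
    leading one, and the bound reproduces itself. *)
Lemma monoinv_bound : exists M, 1 <= M /\ forall r i, 2 * M <= r ->
  nrm r (monoinv i) <= 2 * M * r ^+ i.
Proof.
have [M M1 H] := Lam_gap; exists M; split=> // r i rM.
have r0 : 0 < r by lra.
have r0' : 0 <= r by lra.
elim: i => [|i IH].
  rewrite expr0 mulr1 /= nrmC.
  have [|+ _] := H 0; first by rewrite eq_sym -lt0n.
  by rewrite /L /Lam mul0r subr0; lra.
rewrite [monoinv _]/=; have [_|ik] := eqVneq.
  by rewrite nrm0 mulr_ge0 ?exprn_ge0 //; lra.
have [h1 h2] := H _ ik; rewrite nrmZ.
have nX n : nrm r 'X^n = r ^+ n.
  by elim: n => [|n IHn]; rewrite ?expr0 ?nrmC ?normr1 // exprSr nrmX IHn exprS.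
have h3 : nrm r ('X^(i.+1) - (i.+1%:R * (i.+1%:R + a))%:P * monoinv i) <=
  r ^+ i.+1 + `|i.+1%:R * (i.+1%:R + a)| * (2 * M * r ^+ i).
  apply: le_trans (nrmB _ _ r0') _; rewrite nX nrmZ lerD // ler_wpM2l //.
apply: le_trans (ler_wpM2l _ h3) _ => //.
rewrite mulrDr mulrA [X in X * (2 * _ * _)]mulrC -normrM.
have -> : 2 * M * r ^+ i.+1 = M * r ^+ i.+1 + M * (r * r ^+ i) by rewrite exprS; ring.
have ri : 0 <= r ^+ i by rewrite exprn_ge0.
apply: lerD; first by rewrite ler_wpM2r // exprn_ge0.
apply: ler_pM => //; first by rewrite !mulr_ge0 //; lra.
by rewrite ler_wpM2r.
Qed.

Definition polyinv f : {poly F} := \sum_(i < size f) (f`_i)%:P * monoinv i.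

Lemma polyinvE f : exists c, Dop a b (polyinv f) + K%:P * polyinv f = f - c%:P * 'X^k.
Proof.
rewrite /polyinv.
suff : exists c, Dop a b (\sum_(i < size f) (f`_i)%:P * monoinv i) +
   K%:P * (\sum_(i < size f) (f`_i)%:P * monoinv i) = (\sum_(i < size f) (f`_i)%:P * 'X^i) - c%:P * 'X^k.
  move=> [c ->]; exists c; congr (_ - _); rewrite -[RHS]coefK poly_def.
  by apply: eq_bigr => i _; rewrite mul_polyC.
elim: (size f) => [|n [c IH]].
  by exists 0; rewrite !big_ord0 /Dop /rho derivC derivC; ring.
have [d Hd] := monoinvE n.
exists (c + f`_n * d); rewrite !big_ord_recr /= DopD DopZ.
transitivity ((Dop a b (\sum_(i < n) (f`_i)%:P * monoinv i) + K%:P * (\sum_(i < n) (f`_i)%:P * monoinv i)) +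
   (f`_n)%:P * (Dop a b (monoinv n) + K%:P * monoinv n)); first by ring.
by rewrite IH Hd; ring.
Qed.

Lemma polyinv_bound : exists M, 1 <= M /\ forall r f, 2 * M <= r ->
  nrm r (polyinv f) <= 2 * M * nrm r f.
Proof.
have [M [M1 H]] := monoinv_bound; exists M; split=> // r f rM.
have r0' : 0 <= r by lra.
apply: le_trans (@nrm_sum r _ (fun i => (f`_i)%:P * monoinv i) r0') _.
rewrite /nrm mulr_sumr; apply: ler_sum => i _; rewrite -/(nrm _ _) nrmZ mulrCA.
by rewrite ler_wpM2l // H.
Qed.

Section WithJ.
Variable J : {poly F} -> F.
Hypothesis JD : forall f g, J (f + g) = J f + J g.
Hypothesis JZ : forall c f, J (c%:P * f) = c * J f.
Hypothesis Jpos : forall f, f != 0 -> 0 < J (f * f).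
Hypothesis Jsym : forall f g, J (Dop a b f * g) = J (f * Dop a b g).
Variable B : F.
Hypothesis Jbnd : forall r f, 1 <= r -> `|J f| <= B * nrm r f.
Variable c0 : F.
Hypothesis c0n : c0 != 0.
Let p : {poly F} := c0%:P * jacr a b k.

Lemma scaled_jacr_neq0 : p != 0.
Proof. by rewrite /p mulf_neq0 ?polyC_eq0 // -size_poly_gt0 size_jacrE. Qed.
Lemma Dop_scaled_jacr : Dop a b p = (- K)%:P * p.
Proof. by rewrite /p DopZ Dop_jacr mulrCA. Qed.

Definition proj f : F := J (f * p) / J (p * p).
(** Reduced inverse: the component along [p] is removed from the data to make the equation solvable,
    and from the solution to normalize it, as solutions differ by multiples of [p]. *)
Definition redinv f : {poly F} :=
  let w := polyinv (f - (proj f)%:P * p) in w - (proj w)%:P * p.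

Lemma proj_lin f c : proj (f - c%:P * p) = proj f - c.
Proof.
have h0 : J (p * p) != 0 by rewrite gt_eqF // Jpos // scaled_jacr_neq0.
by rewrite /proj mulrBl (functionalB JD JZ) -mulrA JZ mulrBl mulfK.
Qed.

Lemma proj_redinv f : proj (redinv f) = 0.
Proof. by rewrite /redinv proj_lin subrr. Qed.

(** The defect [c x^k] left by [polyinv] is zero: paired with [p], the left side vanishes by
    symmetry and so does [g], hence [c * J ('X^k * p) = 0]. If [J ('X^k * p)] were zero, then [p],
    which is a multiple of [x^k] plus lower degrees, would be orthogonal to itself. *)
Lemma redinvE f : Dop a b (redinv f) + K%:P * redinv f = f - (proj f)%:P * p.
Proof.
have h0 : J (p * p) != 0 by rewrite gt_eqF // Jpos // scaled_jacr_neq0.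
set g := f - _; have gp : J (g * p) = 0.
  by have := subrr (proj f); rewrite -proj_lin -/g /proj => /eqP; rewrite mulf_eq0 invr_eq0 (negbTE h0) orbF => /eqP.
have [c Hc] := polyinvE g; have c00 : c = 0.
  have e : J ((Dop a b (polyinv g) + K%:P * polyinv g) * p) = 0.
    rewrite mulrDl JD Jsym Dop_scaled_jacr mulrCA JZ -mulrA JZ; ring.
  move: e; rewrite Hc mulrBl (functionalB JD JZ) gp sub0r -mulrA JZ => /eqP.
  rewrite oppr_eq0 mulf_eq0 => /orP[/eqP //|/eqP Xp].
  exfalso; move/eqP: h0; apply.
  pose l := (jacr a b k)`_k.
  have low : (size (jacr a b k - l%:P * 'X^k)%R <= k)%N.
    apply/leq_sizeP => j; rewrite leq_eqVlt coefB coefCM coefXn => /orP[/eqP <-|kj].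
      by rewrite eqxx mulr1 subrr.
    by rewrite gtn_eqF // mulr0 subr0 nth_default // size_jacrE.
  have := orth_low ha hb JD JZ Jsym low.
  rewrite mulrBr (functionalB JD JZ) mulrCA JZ => e.
  rewrite [in LHS]/p mulrACA mulrA -!mulrA JZ JZ.
  have e2 : J (jacr a b k * 'X^k) = 0.
    by move: Xp; rewrite /p mulrCA JZ => /eqP; rewrite mulf_eq0 (negbTE c0n) /= mulrC => /eqP.
  by move: e; rewrite e2 mulr0 subr0 => ->; rewrite !mulr0.
move: Hc; rewrite c00 polyC0 mul0r subr0 => Hc.
rewrite /redinv -/g -[RHS]Hc.
have -> h c' : h - (c')%:P * p = h + (- c')%:P * p by ring.
rewrite DopD DopZ Dop_scaled_jacr; ring.
Qed.

Lemma redinv_bound : exists R, 1 <= R /\ forall r, R <= r ->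
  exists C, 0 <= C /\ forall f, `|proj f| <= C * nrm r f /\ nrm r (redinv f) <= C * nrm r f.
Proof.
have [M [M1 HM]] := polyinv_bound.
exists (2 * M); split; first by lra.
move=> r rM; have r1 : 1 <= r by lra.
have r0 : 0 <= r by lra.
have J0 : 0 < J (p * p) by rewrite Jpos // scaled_jacr_neq0.
pose Q := B * nrm r p / J (p * p).
have HQ f : `|proj f| <= Q * nrm r f.
  rewrite /proj normrM normfV (ger0_norm (ltW J0)).
  have -> : Q * nrm r f = B * (nrm r p * nrm r f) / J (p * p) by rewrite /Q; ring.
  rewrite ler_pM2r ?invr_gt0 //; apply: le_trans (Jbnd _ r1) _.
  rewrite ler_wpM2l //; last by rewrite mulrC nrmM.
  have := le_trans (normr_ge0 _) (Jbnd 1 r1).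
  by have := nrmC r 1; rewrite polyC1 normr1 => ->; rewrite mulr1.
have Q0 : 0 <= Q.
  have := le_trans (normr_ge0 _) (HQ 1).
  by have := nrmC r 1; rewrite polyC1 normr1 => ->; rewrite mulr1.
pose S := 1 + Q * nrm r p.
have np : 0 <= nrm r p by apply: nrm_ge0.
have S1 : 1 <= S by rewrite /S lerDl mulr_ge0.
have HS f : nrm r (f - (proj f)%:P * p) <= S * nrm r f.
  apply: le_trans (nrmB _ _ r0) _; rewrite nrmZ /S mulrDl mul1r lerD //.
  by rewrite mulrAC ler_wpM2r.
move: S S1 HS => S S1 HS; exists (Q + S * (2 * M * S)).
have S0 : 0 <= S * (2 * M * S) by rewrite !mulr_ge0 //; lra.
split=> [|f]; first exact: addr_ge0.
have nf : 0 <= nrm r f by apply: nrm_ge0.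
rewrite mulrDl; split; first by apply: le_trans (HQ f) _; rewrite lerDl mulr_ge0.
suff h : nrm r (redinv f) <= S * (2 * M * S) * nrm r f.
  by apply: (le_trans h); rewrite lerDr mulr_ge0.
apply: le_trans (HS _) _.
have -> : S * (2 * M * S) * nrm r f = S * (2 * M * (S * nrm r f)) by ring.
rewrite ler_wpM2l //; first by lra.
apply: le_trans (HM _ _ rM) _.
by rewrite ler_wpM2l //; lra.
Qed.
End WithJ.
End Inverse.
End Norm.

(** * The formal branch and its convergence *)

Section Recursion.
Import all_boot all_order all_algebra Rstruct ring lra.
Import Order.TTheory GRing.Theory Num.Theory.
Local Open Scope ring_scope.
Local Set Implicit Arguments.
Local Unset Strict Implicit.
Local Unset Printing Implicit Defensive.
Variable F : realFieldType.

(** The convolutions run over a triangle of index pairs contained in the square that the product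
    covers. *)
Lemma sum_conv_le (x y : nat -> F) n : (forall i, 0 <= x i) -> (forall i, 0 <= y i) ->
  \sum_(m < n) \sum_(i < m.+1) x i * y (m - i)%N <= (\sum_(i < n) x i) * (\sum_(i < n) y i).
Proof.
move=> x0 y0; elim: n x x0 => [|n IH] x x0; first by rewrite !big_ord0 mul0r.
have -> : \sum_(m < n.+1) \sum_(i < m.+1) x i * y (m - i)%N =
  x 0 * (\sum_(i < n.+1) y i) + \sum_(m < n) \sum_(i < m.+1) x i.+1 * y (m - i)%N.
  rewrite mulr_sumr; under eq_bigr do rewrite big_ord_recl subn0.
  rewrite big_split /=; congr (_ + _).
  rewrite big_ord_recl big_ord0 add0r; apply: eq_bigr => m _.
  by apply: eq_bigr => i _; rewrite /bump !add1n subSS.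
rewrite [X in _ <= X * _]big_ord_recl mulrDl lerD2l.
apply: le_trans (IH (fun i => x i.+1) _) _ => //.
rewrite ler_wpM2l //; last by rewrite big_ord_recr /= lerDl.
by apply: sumr_ge0.
Qed.

Section Majorant.
Variables (x y l : nat -> F) (kap : F).
Hypotheses (x0 : forall i, 0 <= x i) (y0 : forall i, 0 <= y i) (l0 : forall i, 0 <= l i).
Hypothesis kap1 : 1 <= kap.
(** The constants close the induction on partial sums: [2 * kap ^+ 2 * eps ^+ 2 = eps / 2] for the
    quadratic terms and [4 * kap ^+ 5 * rho_ = eps / 4] for the source; the remaining source
    [4 * kap ^+ 3 * rho_] is also at most [eps / 4], and the sum is [eps]. *)
Let eps : F := (4 * kap ^+ 2)^-1.
Let rho_ : F := eps / (16 * kap ^+ 5).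
Let w m := \sum_(i < m.+1) x i * y (m - i)%N.
Let g m := kap * rho_ * w m + \sum_(i < m) l i.+1 * (x (m - i)%N + y (m - i)%N).
Hypotheses (hx0 : x 0 <= kap) (hy0 : y 0 <= kap).
Hypothesis hx : forall m, x m.+1 <= kap * g m.
Hypothesis hl : forall m, l m.+1 <= kap * g m.
Hypothesis hy : forall m, y m.+1 <= kap * x m.+1 + kap * rho_ * w m.

(** Partial sums, unlike single terms, turn the convolutions into products.  The factor
    [rho_] in the hypotheses is gained by rescaling the path parameter. *)
Lemma majorant n : (\sum_(i < n) x i.+1 <= eps) /\ (\sum_(i < n) y i.+1 <= eps) /\
  (\sum_(i < n) l i.+1 <= eps).
Proof.
have k0 : 0 < kap by exact: lt_le_trans kap1.
have e0 : 0 < eps by rewrite invr_gt0 mulr_gt0 // exprn_gt0.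
have eE : 4 * kap ^+ 2 * eps = 1 by rewrite mulfV // gt_eqF // mulr_gt0 // exprn_gt0.
have r0 : 0 < rho_ by rewrite divr_gt0 // mulr_gt0 // exprn_gt0.
have rE : 16 * kap ^+ 5 * rho_ = eps.
  by rewrite mulrC divfK // gt_eqF // mulr_gt0 // exprn_gt0.
elim: n => [|n [IHx [IHy IHl]]]; first by rewrite !big_ord0 ltW.
set X := \sum_(i < n) x i.+1 in IHx; set Y := \sum_(i < n) y i.+1 in IHy.
set Z := \sum_(i < n) l i.+1 in IHl.
have kk : 1 <= kap ^+ 2 by rewrite expr_ge1 // ltW.
have epskap : eps <= kap.
  have : eps * 1 <= eps * (4 * kap ^+ 2) by rewrite ler_wpM2l ?(ltW e0) //; lra.
  by rewrite [eps * (4 * _)]mulrC eE; move: kap1 => k1; lra.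
(* Partial sums that include index 0 are at most [kap + eps <= 2 * kap]. *)
have W : \sum_(m < n.+1) w m <= 4 * kap ^+ 2.
  apply: le_trans (sum_conv_le _ x0 y0) _; rewrite !big_ord_recl /=.
  have -> : 4 * kap ^+ 2 = (2 * kap) * (2 * kap) by ring.
  have X0 : 0 <= X by apply: sumr_ge0.
  have Y0 : 0 <= Y by apply: sumr_ge0.
  rewrite -/X -/Y.
  have ? := x0 0; have ? := y0 0; have ? := hx0; have ? := hy0; have ? := epskap.
  by apply: ler_pM; move: X Y IHx IHy X0 Y0 => X Y *; lra.
have V : \sum_(m < n.+1) \sum_(i < m) l i.+1 * (x (m - i)%N + y (m - i)%N) <= eps * (2 * eps).
  rewrite big_ord_recl big_ord0 add0r.
  have -> : \sum_(i < n) \sum_(i0 < bump 0 i) l i0.+1 * (x (bump 0 i - i0)%N + y (bump 0 i - i0)%N) =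
    \sum_(m < n) \sum_(i < m.+1) l i.+1 * (x (m - i).+1 + y (m - i).+1).
    apply: eq_bigr => m _; rewrite /bump /= add1n; apply: eq_bigr => i _.
    by rewrite subSn // -ltnS.
  apply: le_trans (@sum_conv_le (fun i => l i.+1) (fun j => x j.+1 + y j.+1) n _ _) _ => //.
    by move=> i; apply: addr_ge0.
  rewrite big_split /= -/X -/Y -/Z.
  have X0 : 0 <= X by apply: sumr_ge0.
  have Y0 : 0 <= Y by apply: sumr_ge0.
  have Z0 : 0 <= Z by apply: sumr_ge0.
  apply: ler_pM => //; first exact: addr_ge0.
  by move: X Y IHx IHy X0 Y0 => X Y *; lra.
have G : \sum_(m < n.+1) g m <= kap * rho_ * (4 * kap ^+ 2) + eps * (2 * eps).
  rewrite big_split /= -mulr_sumr lerD //.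
  by rewrite ler_wpM2l // mulr_ge0 // ltW.
have HX : \sum_(i < n.+1) x i.+1 <= 4 * kap ^+ 4 * rho_ + 2 * kap * eps ^+ 2.
  apply: (@le_trans _ _ (kap * \sum_(m < n.+1) g m)).
    by rewrite mulr_sumr; apply: ler_sum.
  apply: le_trans (ler_wpM2l (ltW k0) G) _; rewrite le_eqVlt; apply/orP; left; apply/eqP; ring.
have HL : \sum_(i < n.+1) l i.+1 <= 4 * kap ^+ 4 * rho_ + 2 * kap * eps ^+ 2.
  apply: (@le_trans _ _ (kap * \sum_(m < n.+1) g m)).
    by rewrite mulr_sumr; apply: ler_sum.
  apply: le_trans (ler_wpM2l (ltW k0) G) _; rewrite le_eqVlt; apply/orP; left; apply/eqP; ring.
have HY : \sum_(i < n.+1) y i.+1 <=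
    kap * (4 * kap ^+ 4 * rho_ + 2 * kap * eps ^+ 2) + kap * rho_ * (4 * kap ^+ 2).
  apply: (@le_trans _ _ (kap * (\sum_(i < n.+1) x i.+1) + kap * rho_ * \sum_(m < n.+1) w m)).
    by rewrite !mulr_sumr -big_split; apply: ler_sum.
  apply: lerD; first by rewrite ler_wpM2l // ltW.
  by apply: ler_wpM2l => //; apply: mulr_ge0; exact: ltW.
have E1 : 4 * kap ^+ 5 * rho_ = eps / 4 by rewrite -rE; field.
have E2 : 2 * kap ^+ 2 * eps ^+ 2 = eps / 2.
  have -> : 2 * kap ^+ 2 * eps ^+ 2 = (4 * kap ^+ 2 * eps) * eps / 2 by field.
  by rewrite eE mul1r.
have kn m : kap ^+ m <= kap ^+ m.+1 by rewrite exprS ler_peMl // exprn_ge0 // ltW.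
have H4 : 4 * kap ^+ 4 * rho_ <= eps / 4.
  by rewrite -E1 ler_wpM2r ?(ltW r0) // ler_wpM2l ?kn.
have H3 : 4 * kap ^+ 3 * rho_ <= eps / 4.
  by rewrite -E1 ler_wpM2r ?(ltW r0) // ler_wpM2l // (le_trans (kn 3)).
have H2 : 2 * kap * eps ^+ 2 <= eps / 2.
  by rewrite -E2 ler_wpM2r ?sqr_ge0 // ler_wpM2l // -[X in X <= _]expr1.
have E5 : kap * (4 * kap ^+ 4 * rho_ + 2 * kap * eps ^+ 2) + kap * rho_ * (4 * kap ^+ 2) =
  eps / 4 + eps / 2 + 4 * kap ^+ 3 * rho_ by rewrite -E1 -E2; ring.
rewrite E5 in HY.
have e4 : 0 < eps / 4 by rewrite divr_gt0.
have e42 : eps / 2 = eps / 4 + eps / 4 by field.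
have e44 : eps = eps / 4 + eps / 4 + eps / 4 + eps / 4 by field.
rewrite e42 in H2 HY.
split; first by apply: (le_trans HX); rewrite [X in _ <= X]e44; lra.
split; first by apply: (le_trans HY); rewrite [X in _ <= X]e44; lra.
by apply: (le_trans HL); rewrite [X in _ <= X]e44; lra.
Qed.

Lemma majorant_term m : x m.+1 <= eps /\ y m.+1 <= eps /\ l m.+1 <= eps.
Proof.
have H (z : nat -> F) : (forall i, 0 <= z i) -> \sum_(i < m.+1) z i.+1 <= eps -> z m.+1 <= eps.
  by move=> z0; rewrite big_ord_recr /=; apply: le_trans; rewrite lerDr sumr_ge0.
by have [hX [hY hL]] := majorant m.+1; do !split; apply: H.
Qed.
End Majorant.

Variables (D G : {poly F} -> {poly F}) (proj : {poly F} -> F) (r : F).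
Variables (q lam0 : F) (p : {poly F}).
Hypothesis q1 : 1 < q.
Hypothesis lam00 : 0 < lam0.
Hypothesis r0 : 0 <= r.
Let K : F := lam0 * (q - 1).
Hypothesis DZ : forall c f, D (c%:P * f) = c%:P * D f.
Hypothesis Dp : D p = (- K)%:P * p.
Hypothesis GE : forall f, D (G f) + K%:P * G f = f - (proj f)%:P * p.
Hypothesis projG : forall f, proj (G f) = 0.
Variable C : F.
Hypothesis Gbnd : forall f, nrm r (G f) <= C * nrm r f.
Hypothesis pbnd : forall f, `|proj f| <= C * nrm r f.

Definition branch_triple : Type := ({poly F} * {poly F} * F)%type.
Let vv (c : branch_triple) := c.1.1.
Let zz (c : branch_triple) := c.1.2.
Let ll (c : branch_triple) := c.2.

(** A triple [(V m, Z m, l m)] holds the coefficients of [s^(m+1)] in [v = u - 1] and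
    [z = u^q], and of [s^m] in [lambda].  The power is encoded by [u z' = q u' z]:
    [Z m = q V m + pow_rest], where [pow_rest] only involves earlier coefficients.
    The choice of [l m] is the solvability condition for [V m]. *)
Definition pow_rest (h : nat -> branch_triple) m : {poly F} :=
  ((m.+2%:R)^-1)%:P * \sum_(i < m.+1)
    (q * i.+1%:R - (m.+1 - i)%:R)%:P * (vv (h i) * zz (h (m - i)%N)).
Definition branch_rhs (h : nat -> branch_triple) m : {poly F} :=
  (- lam0)%:P * pow_rest h m +
  \sum_(i < m) (ll (h i.+1))%:P * (vv (h (m - i)%N) - zz (h (m - i)%N)).
Definition branch_step (h : nat -> branch_triple) m : branch_triple :=
  let g := branch_rhs h m in (G g, q%:P * G g + pow_rest h m, proj g / (q - 1)).
(** Course-of-values recursion through tables: [branch_hist n] is correct up to index [n], and its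
    later entries are fillers that are never read. *)
Fixpoint branch_hist n : nat -> branch_triple :=
  if n is m.+1 then fun i => if (i <= m)%N then branch_hist m i else branch_step (branch_hist m) m
  else fun=> (p, q%:P * p, lam0).
Definition branch_coefs n := branch_hist n n.

Lemma branch_histE m n : (m <= n)%N -> branch_hist n m = branch_coefs m.
Proof.
elim: n => [|n IH]; first by rewrite leqn0 => /eqP ->.
rewrite leq_eqVlt ltnS => /orP[/eqP -> //|mn] /=.
by rewrite mn IH.
Qed.

Lemma branch_coefsS m : branch_coefs m.+1 = branch_step branch_coefs m.
Proof.
rewrite /branch_coefs /= ltnn /branch_step.
have Hz : pow_rest (branch_hist m) m = pow_rest branch_coefs m.
  rewrite /pow_rest; congr (_ * _); apply: eq_bigr => i _.
  by rewrite !branch_histE ?leq_subr // -ltnS.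
have -> : branch_rhs (branch_hist m) m = branch_rhs branch_coefs m.
  rewrite /branch_rhs Hz; congr (_ + _); apply: eq_bigr => i _.
  by rewrite !branch_histE ?leq_subr.
by rewrite Hz.
Qed.

Let V m := vv (branch_coefs m).
Let Z m := zz (branch_coefs m).
Let l m := ll (branch_coefs m).

(** The newest unknowns enter linearly. The term [l 0] contributes [- K V m] and
    [- lam0 * pow_rest], while [l m] multiplies [V 0 - Z 0 = (1 - q) p] and supplies exactly the
    multiple of [p] by which [G] fails to invert [D + K]. *)
Lemma series_ode m :
  D (V m) = \sum_(i < m.+1) (l i)%:P * (V (m - i)%N - Z (m - i)%N).
Proof.
have q0 : q - 1 != 0 by rewrite subr_eq0 gt_eqF.
case: m => [|m].
  rewrite big_ord_recl big_ord0 addr0 /V /Z /l /branch_coefs /= /vv /zz /ll /= Dp /K; ring.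
rewrite big_ord_recl big_ord_recr subn0 /=.
set S := \sum_(i < m) _.
have -> : (m.+1 - bump 0 m)%N = 0%N by rewrite /bump add1n subnn.
have -> : bump 0 m = m.+1 by [].
have e0 : V 0 - Z 0 = (1 - q)%:P * p by rewrite /V /Z /branch_coefs /vv /zz /=; ring.
have l0 : l 0 = lam0 by [].
rewrite e0 l0 /V /Z /l branch_coefsS /branch_step /vv /zz /ll /=.
set g := branch_rhs branch_coefs m.
have -> : D (G g) = g - (proj g)%:P * p - K%:P * G g by rewrite -GE addrK.
have gE : g = (- lam0)%:P * pow_rest branch_coefs m + S.
  by rewrite /g /branch_rhs; congr (_ + _).
have -> : (proj g / (q - 1))%:P * ((1 - q)%:P * p) = - (proj g)%:P * p.
  rewrite mulrA -polyCM; have -> : proj g / (q - 1) * (1 - q) = - proj g by field.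
  by rewrite polyCN.
rewrite [X in X - _ - _]gE /K; ring.
Qed.

Lemma series_pow m : (m.+1%:R)%:P * Z m = (q * m.+1%:R)%:P * V m +
  \sum_(i < m) (q * i.+1%:R - (m - i)%:R)%:P * (V i * Z (m.-1 - i)%N).
Proof.
case: m => [|m]; first by rewrite big_ord0 addr0 /Z /V /branch_coefs /vv /zz /=; ring.
rewrite /Z /V branch_coefsS /branch_step /zz /vv /= /pow_rest -/zz -/vv.
have m0 : m.+2%:R != 0 :> F by rewrite pnatr_eq0.
rewrite mulrDr [in X in _ + X]mulrA -[in X in _ + X]polyCM mulfV // polyC1 mul1r; congr (_ + _).
ring.
Qed.

Lemma series_proj m : proj (V m.+1) = 0.
Proof. by rewrite /V branch_coefsS /branch_step /vv /= projG. Qed.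

Hypothesis projZ : forall c f, proj (c%:P * f) = c * proj f.

(** The first [pow_rest] is [q (q - 1) / 2 * p * p], the quadratic Taylor term of [(1 + v)^q];
    division by [q - 1] leaves [q / 2]. *)
Lemma series_lam1 : l 1 = - lam0 * q / 2 * proj (p * p).
Proof.
have q0 : q - 1 != 0 by rewrite subr_eq0 gt_eqF.
rewrite /l branch_coefsS /branch_step /ll /= /branch_rhs big_ord0 addr0 /pow_rest big_ord_recl big_ord0 addr0.
rewrite /branch_coefs /= /vv /zz /= !projZ.
have -> : p * (q%:P * p) = q%:P * (p * p) by ring.
by rewrite projZ subn0; field.
Qed.

Lemma series_bound : exists A R, 0 < R /\ forall m,
  nrm r (V m) <= A * R ^+ m /\ nrm r (Z m) <= A * R ^+ m /\ `|l m| <= A * R ^+ m.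
Proof.
have q0 : 0 < q - 1 by rewrite subr_gt0.
have qp : 0 < q by apply: lt_trans q1.
have np : 0 <= nrm r p by apply: nrm_ge0.
have C0 : 0 <= `|C| by apply: normr_ge0.
have qi : 0 < (q - 1)^-1 by rewrite invr_gt0.
have cq : 0 <= `|C| / (q - 1) by apply: mulr_ge0 => //; apply: ltW.
have qn : 0 <= q * nrm r p by apply: mulr_ge0 => //; apply: ltW.
have lq : 0 <= lam0 * (q + 1) by rewrite mulr_ge0 ?(ltW lam00) // addr_ge0 // ltW.
(* Summing all constants of the recursion, each of them nonnegative, gives one number that dominates
   every one of them. *)
pose kap := 1 + nrm r p + q * nrm r p + `|C| + `|C| / (q - 1) + lam0 * (q + 1) + (q + 1).
have [k1 [kp [kqp [kC [kCq [klq kq]]]]]] : 1 <= kap /\ nrm r p <= kap /\ q * nrm r p <= kap /\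
  `|C| <= kap /\ `|C| / (q - 1) <= kap /\ lam0 * (q + 1) <= kap /\ q + 1 <= kap.
  rewrite /kap; do !split; lra.
have kg0 : 0 < kap by apply: lt_le_trans k1.
pose eps := (4 * kap ^+ 2)^-1.
pose rh := eps / (16 * kap ^+ 5).
have e0 : 0 < eps by rewrite invr_gt0 mulr_gt0 // exprn_gt0.
have rh0 : 0 < rh by rewrite divr_gt0 // mulr_gt0 // exprn_gt0.
pose x m := nrm r (V m) * rh ^+ m.
pose y m := nrm r (Z m) * rh ^+ m.
pose w m := `|l m| * rh ^+ m.
have rn m : 0 <= rh ^+ m by rewrite exprn_ge0 // ltW.
have x0 m : 0 <= x m by rewrite mulr_ge0 // nrm_ge0.
have y0 m : 0 <= y m by rewrite mulr_ge0 // nrm_ge0.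
have w0 m : 0 <= w m by rewrite mulr_ge0.
pose W m := \sum_(i < m.+1) x i * y (m - i)%N.
pose gg m := kap * rh * W m + \sum_(i < m) w i.+1 * (x (m - i)%N + y (m - i)%N).
have W0 m : 0 <= W m by apply: sumr_ge0 => i _; rewrite mulr_ge0.
(* Division by [m.+2] compensates the integer factors of the recursion, so the power costs only
   [q + 1]. The spare factor [rh] comes from the index shift: entries [i] and [m - i] multiply into
   entry [m.+1]. *)
have hz m : nrm r (pow_rest branch_coefs m) * rh ^+ m.+1 <= (q + 1) * rh * W m.
  rewrite /pow_rest nrmZ normfV ger0_norm ?ler0n //.
  have h : nrm r (\sum_(i < m.+1) (q * i.+1%:R - (m.+1 - i)%:R)%:P * (V i * Z (m - i)%N)) * rh ^+ m
     <= m.+2%:R * ((q + 1) * W m).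
    rewrite /W !mulr_sumr.
    apply: le_trans (ler_wpM2r (rn m) (nrm_sum _ (fun i => (q * i.+1%:R - (m.+1 - i)%:R)%:P * (V i * Z (m - i)%N)) r0)) _.
    rewrite mulr_suml; apply: ler_sum => i _; rewrite nrmZ.
    have im : (i <= m)%N by rewrite -ltnS.
    have h1 : `|q * i.+1%:R - (m.+1 - i)%:R| <= m.+2%:R * (q + 1).
      have e1 : i.+1%:R <= m.+2%:R :> F by rewrite ler_nat ltnS ltnW.
      have e2 : (m.+1 - i)%:R <= m.+2%:R :> F by rewrite ler_nat (leq_trans (leq_subr _ _)).
      have e3 : 0 <= (m.+1 - i)%:R :> F by rewrite ler0n.
      have e4 : q * i.+1%:R <= q * m.+2%:R by rewrite ler_wpM2l // ltW.
      have e5 : 0 <= q * i.+1%:R by rewrite mulr_ge0 ?ler0n // ltW.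
      rewrite ler_norml; apply/andP; split; lra.
    rewrite mulrA -[_ * (q + 1) * _]mulrA -[X in X <= _]mulrA.
    have -> : m.+2%:R * ((q + 1) * (x i * y (m - i)%N)) = (m.+2%:R * (q + 1)) * (x i * y (m - i)%N) by ring.
    apply: ler_pM => //; first by rewrite mulr_ge0 // nrm_ge0.
    have -> : x i * y (m - i)%N = nrm r (V i) * nrm r (Z (m - i)%N) * rh ^+ m.
      have -> : rh ^+ m = rh ^+ i * rh ^+ (m - i) by rewrite -exprD subnKC.
      by rewrite /x /y; ring.
    by rewrite ler_wpM2r // nrmM.
  have -> : (q + 1) * rh * W m = (m.+2%:R)^-1 * (m.+2%:R * ((q + 1) * W m)) * rh.
    by rewrite mulKf ?pnatr_eq0 //; ring.
  move: h; set N := nrm r _ => h.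
  have -> : m.+2%:R^-1 * N * rh ^+ m.+1 = m.+2%:R^-1 * (N * rh ^+ m) * rh by rewrite exprS; ring.
  rewrite ler_wpM2r ?(ltW rh0) // ler_wpM2l //.
  by rewrite invr_ge0 ler0n.
have hg m : nrm r (branch_rhs branch_coefs m) * rh ^+ m.+1 <= gg m.
  rewrite /branch_rhs; apply: le_trans (ler_wpM2r (rn _) (nrmD _ _ r0)) _.
  rewrite mulrDl /gg; apply: lerD.
    rewrite nrmZ normrN (ger0_norm (ltW lam00)) -[X in X <= _]mulrA.
    apply: le_trans (ler_wpM2l (ltW lam00) (hz m)) _.
    have -> : lam0 * ((q + 1) * rh * W m) = lam0 * (q + 1) * (rh * W m) by ring.
    have -> : kap * rh * W m = kap * (rh * W m) by ring.
    by apply: ler_wpM2r => //; apply: mulr_ge0 => //; apply: ltW.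
  apply: le_trans (ler_wpM2r (rn m.+1) (nrm_sum m (fun i => (l i.+1)%:P * (V (m - i)%N - Z (m - i)%N)) r0)) _.
  rewrite mulr_suml; apply: ler_sum => i _; rewrite nrmZ.
  have im : (i <= m)%N by rewrite ltnW.
  have -> : w i.+1 * (x (m - i)%N + y (m - i)%N) =
     `|l i.+1| * (nrm r (V (m - i)%N) + nrm r (Z (m - i)%N)) * rh ^+ m.+1.
    have -> : rh ^+ m.+1 = rh ^+ i.+1 * rh ^+ (m - i) by rewrite -exprD addSn subnKC.
    by rewrite /x /y /w; ring.
  by rewrite ler_wpM2r // ler_wpM2l // nrmB.
have gg0 m : 0 <= gg m by apply: le_trans (hg m); rewrite mulr_ge0 // nrm_ge0.
have ng0 m : 0 <= nrm r (branch_rhs branch_coefs m) by rewrite nrm_ge0.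
have hGn m : nrm r (G (branch_rhs branch_coefs m)) <= `|C| * nrm r (branch_rhs branch_coefs m).
  by apply: le_trans (Gbnd _) _; rewrite ler_wpM2r // ler_norm.
have hx m : x m.+1 <= kap * gg m.
  rewrite /x {1}/V branch_coefsS /branch_step /vv /=.
  apply: le_trans (ler_wpM2r (rn _) (hGn m)) _; rewrite -mulrA.
  by apply: ler_pM => //; rewrite mulr_ge0.
have hl m : w m.+1 <= kap * gg m.
  rewrite /w {1}/l branch_coefsS /branch_step /ll /= normrM (ger0_norm (ltW qi)).
  have hp : `|proj (branch_rhs branch_coefs m)| <= `|C| * nrm r (branch_rhs branch_coefs m).
    by apply: le_trans (pbnd _) _; rewrite ler_wpM2r // ler_norm.
  apply: (@le_trans _ _ (`|C| / (q - 1) * (nrm r (branch_rhs branch_coefs m) * rh ^+ m.+1))).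
    have -> : `|C| / (q - 1) * (nrm r (branch_rhs branch_coefs m) * rh ^+ m.+1) =
      `|C| * nrm r (branch_rhs branch_coefs m) / (q - 1) * rh ^+ m.+1 by ring.
    by rewrite ler_wpM2r // ler_wpM2r // ltW.
  by apply: ler_pM => //; rewrite mulr_ge0.
have hy m : y m.+1 <= kap * x m.+1 + kap * rh * W m.
  rewrite /y /x {1}/Z {1}/V branch_coefsS /branch_step /vv /zz /=.
  apply: le_trans (ler_wpM2r (rn _) (nrmD _ _ r0)) _.
  rewrite mulrDl nrmZ (ger0_norm (ltW qp)); apply: lerD.
    rewrite -mulrA ler_wpM2r ?mulr_ge0 ?nrm_ge0 //; lra.
  apply: le_trans (hz m) _.
  have -> : (q + 1) * rh * W m = (q + 1) * (rh * W m) by ring.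
  have -> : kap * rh * W m = kap * (rh * W m) by ring.
  by apply: ler_wpM2r => //; apply: mulr_ge0 => //; apply: ltW.
have hx0 : x 0 <= kap by rewrite /x mulr1.
have hy0 : y 0 <= kap.
  by rewrite /y mulr1 /Z /branch_coefs /zz /= nrmZ (ger0_norm (ltW qp)).
have H := majorant_term x0 y0 w0 k1 hx0 hy0 hx hl hy.
have l00 := lam00.
exists (kap + eps + lam0), rh^-1; split; first by rewrite invr_gt0.
have conv (c d : F) m : c * rh ^+ m <= d -> d <= kap + eps + lam0 ->
   c <= (kap + eps + lam0) * rh^-1 ^+ m.
  by move=> h1 h2; rewrite exprVn ler_pdivlMr ?exprn_gt0 //; apply: le_trans h2.
case=> [|m].
  have lE : `|l 0| * rh ^+ 0 <= lam0 by rewrite mulr1 /l /branch_coefs /ll /= ger0_norm // ltW.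
  split; [apply: (conv _ _ _ hx0) | split; [apply: (conv _ _ _ hy0) | apply: (conv _ _ _ lE)]]; lra.
have [h1 [h2 h3]] := H m.
split; [apply: (conv _ _ _ h1) | split; [apply: (conv _ _ _ h2) | apply: (conv _ _ _ h3)]]; rewrite -/eps; lra.
Qed.

Theorem formal_branch : exists (V Z : nat -> {poly F}) (l : nat -> F) (A R : F),
  [/\ V 0 = p, Z 0 = q%:P * p & l 0 = lam0] /\
  [/\ forall m, D (V m) = \sum_(i < m.+1) (l i)%:P * (V (m - i)%N - Z (m - i)%N),
   forall m, (m.+1%:R)%:P * Z m = (q * m.+1%:R)%:P * V m +
      \sum_(i < m) (q * i.+1%:R - (m - i)%:R)%:P * (V i * Z (m.-1 - i)%N),
   forall m, proj (V m.+1) = 0 & l 1 = - lam0 * q / 2 * proj (p * p)] /\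
  0 < R /\ forall m,
  nrm r (V m) <= A * R ^+ m /\ nrm r (Z m) <= A * R ^+ m /\ `|l m| <= A * R ^+ m.
Proof.
have [A [R [R0 H]]] := series_bound.
exists V, Z, l, A, R; split; first by [].
split; last by [].
split; [exact: series_ode | exact: series_pow | exact: series_proj | exact: series_lam1].
Qed.

End Recursion.

(** * Weighted integrals on [-1, 1] *)

Definition endlim (G : R -> R) (l1 l2 : R) : Prop :=
  forall eps, 0 < eps -> exists d, 0 < d < 1 /\ forall t,
    (1 - d < t < 1 -> Rabs (G t - l2) < eps) /\ (-1 < t < -1 + d -> Rabs (G t - l1) < eps).

Definition anti (h G : R -> R) : Prop :=
  (forall t, -1 < t < 1 -> is_derive G t (h t)) /\ (forall t, -1 < t < 1 -> continuous h t).

Lemma continuous_is_derive (f : R -> R) (t l : R) : is_derive f t l -> continuous f t.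
Proof. intros H; apply (ex_derive_continuous f); now exists l. Qed.

Lemma ball_R_inv (x y : R) (e : posreal) : ball x e y -> Rabs (y - x) < e.
Proof. exact (fun H => H). Qed.

Lemma ball_R (x y : R) (e : posreal) : Rabs (y - x) < e -> ball x e y.
Proof. exact (fun H => H). Qed.

Lemma locally_interior (P : R -> Prop) t :
  -1 < t < 1 -> (forall y, -1 < y < 1 -> P y) -> locally t P.
Proof.
intros ht H.
assert (h0 : 0 < Rmin (t + 1) (1 - t)) by (apply Rmin_case; lra).
exists (mkposreal _ h0); intros y Hy; apply ball_R_inv in Hy; simpl in Hy.
apply Rabs_def2 in Hy; apply H.
generalize (Rmin_l (t + 1) (1 - t)) (Rmin_r (t + 1) (1 - t)); intros; lra.
Qed.

Lemma at_left_intro (P : R -> Prop) d :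
  0 < d -> (forall t, 1 - d < t < 1 -> P t) -> at_left 1 P.
Proof.
intros d0 H; exists (mkposreal d d0); intros y Hy Hy'; apply ball_R_inv in Hy; simpl in Hy.
apply Rabs_def2 in Hy; apply H; lra.
Qed.

Lemma at_right_intro (P : R -> Prop) d :
  0 < d -> (forall t, -1 < t < -1 + d -> P t) -> at_right (-1) P.
Proof.
intros d0 H; exists (mkposreal d d0); intros y Hy Hy'; apply ball_R_inv in Hy; simpl in Hy.
apply Rabs_def2 in Hy; apply H; lra.
Qed.

(** Improper integrals are handled through a primitive with limits at both ends; existence,
    linearity and symmetry are all proved by exhibiting such primitives. *)
Lemma is_RInt_gen_anti h G l1 l2 : anti h G -> endlim G l1 l2 ->
  is_RInt_gen h (at_right (-1)) (at_left 1) (l2 - l1).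
Proof.
intros [HG Hh] HL P [eps HP].
destruct (HL (pos eps / 2)) as [d [Hd H]]; [destruct eps; simpl; lra|].
apply (Filter_prod _ _ _ (fun a => -1 < a < -1 + d) (fun b => 1 - d < b < 1)).
- apply at_right_intro with d; [lra | auto].
- apply at_left_intro with d; [lra | auto].
- intros a b Ha Hb; exists (G b - G a); split.
  + apply (is_RInt_derive G h); simpl; intros x Hx;
    assert (-1 < x < 1) by (unfold Rmin, Rmax in Hx; destruct (Rle_dec a b); lra); auto.
  + apply HP; apply ball_R.
    destruct (H a) as [_ H1]; destruct (H b) as [H2 _].
    specialize (H1 Ha); specialize (H2 Hb); simpl in *.
    apply Rabs_def2 in H1; apply Rabs_def2 in H2; apply Rabs_def1; lra.
Qed.

Lemma int_m11_anti h G l1 l2 : anti h G -> endlim G l1 l2 -> int_m11 h = l2 - l1.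
Proof.
intros H1 H2; unfold int_m11; apply is_RInt_gen_unique; now apply is_RInt_gen_anti with G.
Qed.

Lemma continuous_ext_interior (f g : R -> R) :
  (forall t, -1 < t < 1 -> f t = g t) ->
  (forall t, -1 < t < 1 -> continuous f t) -> forall t, -1 < t < 1 -> continuous g t.
Proof.
intros E H t ht; apply (continuous_ext_loc g f t); [|now apply H].
apply locally_interior; [exact ht | intros; symmetry; now apply E || now symmetry; apply E].
Qed.

Lemma anti_ext f g G : (forall t, -1 < t < 1 -> f t = g t) -> anti f G -> anti g G.
Proof.
intros E [H1 H2]; split.
- intros t ht; rewrite <- E by exact ht; now apply H1.
- now apply continuous_ext_interior with f.
Qed.

Lemma Rpower_pos_small e eps : 0 < e -> 0 < eps ->
  exists d, 0 < d < 1 /\ forall x, 0 < x < d -> Rpower x e < eps.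
Proof.
intros he heps; exists (Rmin (1/2) (Rpower eps (1 / e))).
assert (0 < Rpower eps (1 / e)) by apply exp_pos.
split; [unfold Rmin; destruct Rle_dec; lra|].
intros x [Hx0 Hx].
assert (x < Rpower eps (1 / e)) by (eapply Rlt_le_trans; [apply Hx | apply Rmin_r]).
replace eps with (Rpower (Rpower eps (1 / e)) e).
apply Rlt_Rpower_l; lra.
rewrite Rpower_mult; replace (1 / e * e) with 1 by (field; lra); now apply Rpower_1.
Qed.

Lemma is_derive_Rpower_m a t : t < 1 ->
  is_derive (fun x => Rpower (1 - x) a) t (- (a * Rpower (1 - t) (a - 1))).
Proof.
intros ht.
evar_last; [apply (is_derive_comp (fun y => Rpower y a) (fun x => 1 - x)) |].
apply is_derive_Reals; apply derivable_pt_lim_power; lra.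
auto_derive; [trivial | reflexivity].
unfold scal; simpl; unfold mult; simpl; ring.
Qed.

Lemma is_derive_Rpower_p a t : -1 < t ->
  is_derive (fun x => Rpower (1 + x) a) t (a * Rpower (1 + t) (a - 1)).
Proof.
intros ht.
evar_last; [apply (is_derive_comp (fun y => Rpower y a) (fun x => 1 + x)) |].
apply is_derive_Reals; apply derivable_pt_lim_power; lra.
auto_derive; [trivial | reflexivity].
unfold scal; simpl; unfold mult; simpl; ring.
Qed.

(** The integrands against which the possibly singular weight is improperly integrable. *)
Definition adm (f : R -> R) : Prop :=
  (forall t, -1 < t < 1 -> continuous f t) /\
  exists M, forall t, -1 < t < 1 -> Rabs (f t) <= M.

Lemma adm_ext f g : (forall t, -1 < t < 1 -> f t = g t) -> adm f -> adm g.
Proof.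
intros E [H1 [M H2]]; split; [now apply continuous_ext_interior with f|].
exists M; intros t ht; rewrite <- E; auto.
Qed.

Lemma adm_const c : adm (fun _ => c).
Proof.
split; [intros; apply continuous_const | exists (Rabs c); intros; lra].
Qed.

Lemma adm_id : adm (fun t => t).
Proof.
split; [intros; apply continuous_id | exists 1; intros; apply Rabs_le; lra].
Qed.

Lemma adm_plus f g : adm f -> adm g -> adm (fun t => f t + g t).
Proof.
intros [Hf [M HM]] [Hg [N HN]]; split.
- intros t ht; apply (continuous_plus f g); auto.
- exists (M + N); intros t ht; eapply Rle_trans; [apply Rabs_triang|].
  specialize (HM t ht); specialize (HN t ht); lra.
Qed.

Lemma adm_mult f g : adm f -> adm g -> adm (fun t => f t * g t).
Proof.
intros [Hf [M HM]] [Hg [N HN]]; split.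
- intros t ht; apply (continuous_mult f g); auto.
- exists (M * N); intros t ht; rewrite Rabs_mult.
  apply Rmult_le_compat; auto using Rabs_pos.
Qed.

Lemma adm_scal c f : adm f -> adm (fun t => c * f t).
Proof. intros H; apply adm_mult; [apply adm_const | exact H]. Qed.

Lemma adm_minus f g : adm f -> adm g -> adm (fun t => f t - g t).
Proof.
intros Hf Hg; apply (adm_ext (fun t => f t + -1 * g t)); [intros; ring|].
apply adm_plus; [exact Hf | now apply adm_scal].
Qed.

Lemma cauchy_left (G : R -> R) :
  (forall eps, 0 < eps -> exists d, 0 < d < 1 /\
    forall x y, 1 - d < x < 1 -> 1 - d < y < 1 -> Rabs (G x - G y) < eps) ->
  exists l, forall eps, 0 < eps -> exists d, 0 < d < 1 /\
    forall t, 1 - d < t < 1 -> Rabs (G t - l) < eps.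
Proof.
intros H; assert (HF : exists l : R, filterlim G (at_left 1) (locally l)).
{ apply (proj1 (filterlim_locally_cauchy (F := at_left 1) G)); intros eps.
  destruct (H eps (cond_pos eps)) as [d [Hd H1]].
  exists (fun t => 1 - d < t < 1); split.
  - apply at_left_intro with d; [lra | auto].
  - intros u v hu hv; apply ball_R; apply H1; assumption. }
destruct HF as [l Hl]; exists l; intros eps he.
destruct (proj1 (filterlim_locally G l) Hl (mkposreal eps he)) as [[d d0] Hd].
exists (Rmin (d / 2) (1/2)); split; [unfold Rmin; destruct Rle_dec; lra|]; intros t ht.
apply (Hd t); [|lra]; change (Rabs (t - 1) < d).
generalize (Rmin_l (d / 2) (1 / 2)); intros; apply Rabs_def1; lra.
Qed.

Section Weight.
Variables alpha beta : R.
Hypotheses (halpha : -1 < alpha) (hbeta : -1 < beta).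

Let w := jweight alpha beta.
Definition Jint (f : R -> R) : R := int_m11 (fun t => f t * w t).

Lemma jweight_pos t : 0 < w t.
Proof. unfold w, jweight, Rpower; apply Rmult_lt_0_compat; apply exp_pos. Qed.

Lemma jweight_continuous t : -1 < t < 1 -> continuous w t.
Proof.
intros ht; unfold w, jweight.
apply (continuous_mult (fun t => Rpower (1 - t) alpha) (fun t => Rpower (1 + t) beta)).
- eapply continuous_is_derive; apply is_derive_Rpower_m; lra.
- eapply continuous_is_derive; apply is_derive_Rpower_p; lra.
Qed.

Let C := 1 + Rpower 2 alpha + Rpower 2 beta.
(** [W] is a primitive of a majorant of the weight that stays bounded at [-1] and [1]. *)
Let W t := C * (Rpower (1 + t) (beta + 1) / (beta + 1) - Rpower (1 - t) (alpha + 1) / (alpha + 1)).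

Lemma majorant_const_pos : 0 < C.
Proof. unfold C, Rpower; generalize (exp_pos (alpha * ln 2)) (exp_pos (beta * ln 2)); intros; lra. Qed.

Lemma Rpower_le_2 x a : 1 <= x <= 2 -> Rpower x a <= 1 + Rpower 2 a.
Proof.
intros hx; destruct (Rle_dec 0 a).
- assert (Rpower x a <= Rpower 2 a) by (apply Rle_Rpower_l; lra). lra.
- assert (Rpower x a <= 1).
  { replace 1 with (Rpower 1 a) by (unfold Rpower; now rewrite ln_1, Rmult_0_r, exp_0).
    unfold Rpower; destruct (Req_dec x 1) as [->|]; [lra|].
    apply Rlt_le; apply exp_increasing.
    assert (ln 1 < ln x) by (apply ln_increasing; lra); nra. }
  assert (0 < Rpower 2 a) by apply exp_pos; lra.
Qed.

(** For [0 <= t] the factor [(1 + t)^beta] is at most [C], for [t < 0] the factor [(1 - t)^alpha]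
    is; each half keeps only its own singular factor. *)
Lemma jweight_le t : -1 < t < 1 -> w t <= C * (Rpower (1 - t) alpha + Rpower (1 + t) beta).
Proof.
intros ht; unfold w, jweight.
assert (H1 : 0 < Rpower (1 - t) alpha) by apply exp_pos.
assert (H2 : 0 < Rpower (1 + t) beta) by apply exp_pos.
assert (H3 : 0 < Rpower 2 alpha) by apply exp_pos.
assert (H4 : 0 < Rpower 2 beta) by apply exp_pos.
destruct (Rle_dec 0 t).
- assert (Rpower (1 + t) beta <= C).
  { generalize (Rpower_le_2 (1 + t) beta); unfold C; lra. }
  generalize majorant_const_pos; intros; nra.
- assert (Rpower (1 - t) alpha <= C).
  { generalize (Rpower_le_2 (1 - t) alpha); unfold C; lra. }
  generalize majorant_const_pos; intros; nra.
Qed.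

Lemma weight_majorant_derive t : -1 < t < 1 ->
  is_derive W t (C * (Rpower (1 - t) alpha + Rpower (1 + t) beta)).
Proof.
intros ht; unfold W.
apply (is_derive_scal (fun t => Rpower (1 + t) (beta + 1) / (beta + 1) - Rpower (1 - t) (alpha + 1) / (alpha + 1))).
assert (H1 := is_derive_Rpower_m (alpha + 1) t (proj2 ht)).
assert (H2 := is_derive_Rpower_p (beta + 1) t (proj1 ht)).
replace (alpha + 1 - 1) with alpha in H1 by ring.
replace (beta + 1 - 1) with beta in H2 by ring.
evar_last.
apply (is_derive_minus (fun t => Rpower (1 + t) (beta + 1) / (beta + 1)) (fun t => Rpower (1 - t) (alpha + 1) / (alpha + 1))).
apply (is_derive_ext (fun t => / (beta + 1) * Rpower (1 + t) (beta + 1))).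
intros; unfold Rdiv; apply Rmult_comm.
apply is_derive_scal; apply H2.
apply (is_derive_ext (fun t => / (alpha + 1) * Rpower (1 - t) (alpha + 1))).
intros; unfold Rdiv; apply Rmult_comm.
apply is_derive_scal; apply H1.
unfold minus, plus, opp; simpl; field; lra.
Qed.

Lemma weight_majorant_cauchy eps : 0 < eps -> exists d, 0 < d < 1 /\
  (forall x y, 1 - d < x < 1 -> 1 - d < y < 1 -> Rabs (W x - W y) < eps) /\
  (forall x y, -1 < x < -1 + d -> -1 < y < -1 + d -> Rabs (W x - W y) < eps).
Proof.
intros he; generalize majorant_const_pos; intros C0.
destruct (Rpower_pos_small (beta + 1) (eps * (beta + 1) / (4 * C))) as [d1 [Hd1 H1]].
lra. apply Rdiv_lt_0_compat; nra.
destruct (Rpower_pos_small (alpha + 1) (eps * (alpha + 1) / (4 * C))) as [d2 [Hd2 H2]].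
lra. apply Rdiv_lt_0_compat; nra.
(* Near an end, one term of [W] is a small positive power ([side]) and the other is continuous up to
   that end ([side']). *)
assert (side : forall e d z, 0 < e -> (forall x, 0 < x < d -> Rpower x e < eps * e / (4 * C)) ->
  0 < z < d -> 0 < C * (Rpower z e / e) < eps / 4).
{ intros e d z e0 H hz; specialize (H z hz).
  assert (0 < Rpower z e) by apply exp_pos.
  split.
  - apply Rmult_lt_0_compat; [lra | now apply Rdiv_lt_0_compat].
  - apply Rlt_le_trans with (C * ((eps * e / (4 * C)) / e)); [|right; field; lra].
    apply Rmult_lt_compat_l; [lra|]; apply Rmult_lt_compat_r; [now apply Rinv_0_lt_compat | lra]. }
assert (side' : forall (g : R -> R) (t0 e : R), 0 < e -> continuous g t0 -> exists d, 0 < d /\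
  forall x y, Rabs (x - t0) < d -> Rabs (y - t0) < d -> Rabs (C * (g x / e) - C * (g y / e)) < eps / 2).
{ intros g t0 e e0 Hg.
  assert (k0 : 0 < eps * e / (4 * C)) by (apply Rdiv_lt_0_compat; nra).
  destruct (proj1 (filterlim_locally g (g t0)) Hg (mkposreal _ k0)) as [d Hd].
  exists d; split; [apply cond_pos|]; intros x y hx hy.
  apply ball_R, Hd, ball_R_inv in hx; apply ball_R, Hd, ball_R_inv in hy; simpl in hx, hy.
  assert (hxy : Rabs (g x - g y) < eps * e / (2 * C)).
  { replace (eps * e / (2 * C)) with (eps * e / (4 * C) + eps * e / (4 * C)) by (field; lra).
    apply Rabs_def2 in hx; apply Rabs_def2 in hy; apply Rabs_def1; lra. }
  replace (C * (g x / e) - C * (g y / e)) with ((C / e) * (g x - g y)) by (field; lra).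
  assert (0 < C / e) by (apply Rdiv_lt_0_compat; lra).
  rewrite Rabs_mult, (Rabs_pos_eq (C / e)) by lra.
  replace (eps / 2) with (C / e * (eps * e / (2 * C))) by (field; lra).
  now apply Rmult_lt_compat_l. }
destruct (side' (fun t => Rpower (1 + t) (beta + 1)) 1 (beta + 1)) as [d3 [Hd3 H3]].
lra. eapply continuous_is_derive; apply is_derive_Rpower_p; lra.
destruct (side' (fun t => Rpower (1 - t) (alpha + 1)) (-1) (alpha + 1)) as [d4 [Hd4 H4]].
lra. eapply continuous_is_derive; apply is_derive_Rpower_m; lra.
assert (hm : exists d, 0 < d < 1 /\ d <= d1 /\ d <= d2 /\ d <= d3 /\ d <= d4).
{ exists (Rmin (Rmin d1 d2) (Rmin d3 d4)).
  generalize (Rmin_l (Rmin d1 d2) (Rmin d3 d4)) (Rmin_r (Rmin d1 d2) (Rmin d3 d4))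
    (Rmin_l d1 d2) (Rmin_r d1 d2) (Rmin_l d3 d4) (Rmin_r d3 d4); intros.
  assert (0 < Rmin (Rmin d1 d2) (Rmin d3 d4)) by (repeat apply Rmin_case; lra).
  repeat split; lra. }
destruct hm as [d [hd [k1 [k2 [k3 k4]]]]].
exists d; split; [exact hd|]; split; intros x y hx hy; unfold W.
- assert (A1 := side (alpha + 1) d2 (1 - x) ltac:(lra) H2 ltac:(lra)).
  assert (A2 := side (alpha + 1) d2 (1 - y) ltac:(lra) H2 ltac:(lra)).
  assert (A3 := H3 x y ltac:(apply Rabs_def1; lra) ltac:(apply Rabs_def1; lra)); simpl in A3.
  rewrite !Rmult_minus_distr_l; apply Rabs_def2 in A3; apply Rabs_def1; lra.
- assert (A1 := side (beta + 1) d1 (1 + x) ltac:(lra) H1 ltac:(lra)).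
  assert (A2 := side (beta + 1) d1 (1 + y) ltac:(lra) H1 ltac:(lra)).
  assert (A3 := H4 x y ltac:(apply Rabs_def1; lra) ltac:(apply Rabs_def1; lra)); simpl in A3.
  rewrite !Rmult_minus_distr_l; apply Rabs_def2 in A3; apply Rabs_def1; lra.
Qed.

(** The primitive [G] from 0 inherits limits from [W]: the mean value theorem applied to [|M| W - G]
    and [|M| W + G] gives [|G x - G y| <= |M| |W x - W y|], and [W] is Cauchy at both ends. *)
Lemma Jint_repr f : adm f -> exists G l1 l2,
  anti (fun t => f t * w t) G /\ endlim G l1 l2 /\ Jint f = l2 - l1.
Proof.
intros [Hc [M HM]].
pose (h := fun t => f t * w t).
assert (Hh : forall t, -1 < t < 1 -> continuous h t).
{ intros t ht; apply (continuous_mult f w); [now apply Hc | now apply jweight_continuous]. }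
pose (G := fun t => RInt h 0 t).
assert (HG : forall t, -1 < t < 1 -> is_derive G t (h t)).
{ intros t ht; apply (is_derive_RInt h G 0 t); [|now apply Hh].
  apply locally_interior; [exact ht|]; intros y Hy.
  apply (RInt_correct h); apply ex_RInt_continuous; intros z Hz; apply Hh.
  unfold Rmin, Rmax in Hz; destruct (Rle_dec 0 y); lra. }
assert (HGW : forall x y, -1 < x < 1 -> -1 < y < 1 ->
  Rabs (G x - G y) <= Rabs M * Rabs (W x - W y)).
{ assert (HH : forall x y, -1 < x < 1 -> -1 < y < 1 -> x <= y ->
    Rabs (G y - G x) <= Rabs M * (W y - W x)).
  { intros x y hx hy hxy.
    assert (mono : forall e, (e = 1 \/ e = -1) -> e * (G y - G x) <= Rabs M * (W y - W x)).
    { intros e he.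
      destruct (MVT_gen (fun t => Rabs M * W t - e * G t) x y
        (fun t => Rabs M * (C * (Rpower (1 - t) alpha + Rpower (1 + t) beta)) - e * h t)) as [c [Hc1 Hc2]].
      - rewrite Rmin_left, Rmax_right by lra; intros t ht.
        apply (is_derive_minus (fun t => Rabs M * W t) (fun t => e * G t)).
        apply is_derive_scal; apply weight_majorant_derive; lra.
        apply is_derive_scal; apply HG; lra.
      - rewrite Rmin_left, Rmax_right by lra; intros t ht.
        apply continuity_pt_filterlim.
        apply (continuous_minus (fun t => Rabs M * W t) (fun t => e * G t)).
        eapply continuous_is_derive; apply is_derive_scal; apply weight_majorant_derive; lra.
        eapply continuous_is_derive; apply is_derive_scal; apply HG; lra.
      - rewrite Rmin_left, Rmax_right in Hc1 by lra.
        assert (hc : -1 < c < 1) by lra.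
        specialize (HM c hc); generalize (jweight_le c hc) (jweight_pos c); intros.
        assert (e * h c <= Rabs M * w c).
        { unfold h; generalize (Rle_abs M); intros; apply Rabs_le_between in HM.
          destruct he; subst e; nra. }
        assert (0 <= Rabs M) by apply Rabs_pos.
        assert (Rabs M * w c <= Rabs M * (C * (Rpower (1 - c) alpha + Rpower (1 + c) beta)))
          by (apply Rmult_le_compat_l; lra).
        nra. }
    apply Rabs_le; generalize (mono 1 (or_introl eq_refl)) (mono (-1) (or_intror eq_refl)); intros; lra. }
  intros x y hx hy; destruct (Rle_dec x y).
  - rewrite Rabs_minus_sym, (Rabs_minus_sym (W x)).
    eapply Rle_trans; [apply HH; lra|]; apply Rmult_le_compat_l; [apply Rabs_pos | apply Rle_abs].
  - eapply Rle_trans; [apply HH; lra|]; apply Rmult_le_compat_l; [apply Rabs_pos | apply Rle_abs]. }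
assert (Hcau : forall eps, 0 < eps -> exists d, 0 < d < 1 /\
  (forall x y, 1 - d < x < 1 -> 1 - d < y < 1 -> Rabs (G x - G y) < eps) /\
  (forall x y, -1 < x < -1 + d -> -1 < y < -1 + d -> Rabs (G x - G y) < eps)).
{ intros eps he; destruct (weight_majorant_cauchy (eps / (Rabs M + 1))) as [d [Hd [H1 H2]]].
  apply Rdiv_lt_0_compat; [lra | generalize (Rabs_pos M); intros; lra].
  assert (fin : forall z, Rabs z < eps / (Rabs M + 1) -> Rabs M * Rabs z < eps).
  { intros z Hz; generalize (Rabs_pos M) (Rabs_pos z); intros.
    apply Rle_lt_trans with ((Rabs M + 1) * Rabs z); [nra|].
    apply Rlt_le_trans with ((Rabs M + 1) * (eps / (Rabs M + 1))).
    apply Rmult_lt_compat_l; lra. right; field; lra. }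
  exists d; split; [exact Hd|]; split; intros x y hx hy;
   (eapply Rle_lt_trans; [apply HGW; lra|]); apply fin; auto. }
destruct (cauchy_left G) as [l2 H2].
{ intros eps he; destruct (Hcau eps he) as [d [Hd [H _]]]; exists d; auto. }
(* The end -1 is reached by the reflection of [t]. *)
destruct (cauchy_left (fun t => G (- t))) as [l1 H1].
{ intros eps he; destruct (Hcau eps he) as [d [Hd [_ H]]]; exists d; split; [exact Hd|].
  intros x y hx hy; apply H; lra. }
exists G, l1, l2; split; [split; assumption|].
assert (EL : endlim G l1 l2).
{ intros eps he; destruct (H1 eps he) as [d1 [Hd1 K1]]; destruct (H2 eps he) as [d2 [Hd2 K2]].
  exists (Rmin d1 d2); split; [unfold Rmin; destruct Rle_dec; lra|].
  generalize (Rmin_l d1 d2) (Rmin_r d1 d2); intros; split; intros; [apply K2; lra|].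
  rewrite <- (Ropp_involutive t); apply K1; lra. }
split; [exact EL|].
apply int_m11_anti with G; [split; assumption | exact EL].
Qed.

Lemma Jint_ext f g : adm f -> (forall t, -1 < t < 1 -> f t = g t) -> Jint f = Jint g.
Proof.
intros Hf E; destruct (Jint_repr f Hf) as [G [l1 [l2 [HG [HL ->]]]]]; symmetry.
apply int_m11_anti with G; [|exact HL].
apply anti_ext with (2 := HG); intros t ht; simpl; now rewrite E.
Qed.

Lemma Jint_int_m11 f g : adm f -> (forall t, -1 < t < 1 -> g t = f t * w t) -> int_m11 g = Jint f.
Proof.
intros Hf E; destruct (Jint_repr f Hf) as [G [l1 [l2 [HG [HL ->]]]]].
apply int_m11_anti with G; [|exact HL].
apply anti_ext with (2 := HG); intros t ht; simpl; now rewrite E.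
Qed.

Lemma Jint_lin c d f g : adm f -> adm g ->
  Jint (fun t => c * f t + d * g t) = c * Jint f + d * Jint g.
Proof.
intros Hf Hg.
destruct (Jint_repr f Hf) as [G [l1 [l2 [[HG1 HG2] [HL E1]]]]].
destruct (Jint_repr g Hg) as [H [m1 [m2 [[HH1 HH2] [HM E2]]]]].
rewrite E1, E2; replace (c * (l2 - l1) + d * (m2 - m1)) with ((c * l2 + d * m2) - (c * l1 + d * m1)) by ring.
apply int_m11_anti with (fun t => c * G t + d * H t).
- split; intros t ht.
  + evar_last.
    apply (is_derive_plus (fun t => c * G t) (fun t => d * H t)); apply is_derive_scal; auto.
    simpl; unfold plus; simpl; ring.
  + apply (continuous_ext (fun t => plus (scal c (f t * w t)) (scal d (g t * w t)))).
    intros; unfold plus, scal; simpl; unfold mult; simpl; ring.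
    apply (continuous_plus (fun t => scal c (f t * w t)) (fun t => scal d (g t * w t))).
    apply (continuous_scal_r c (fun t => f t * w t)); auto.
    apply (continuous_scal_r d (fun t => g t * w t)); auto.
- intros eps he.
  assert (k0 : 0 < Rabs c + Rabs d + 1) by (generalize (Rabs_pos c) (Rabs_pos d); intros; lra).
  assert (k1 : 0 < eps / (Rabs c + Rabs d + 1)) by now apply Rdiv_lt_0_compat.
  destruct (HL _ k1) as [d1 [Hd1 K1]]; destruct (HM _ k1) as [d2 [Hd2 K2]].
  set (e := eps / (Rabs c + Rabs d + 1)) in *.
  assert (key : forall a b, Rabs a < e -> Rabs b < e -> Rabs (c * a + d * b) < eps).
  { intros a b ha hb; eapply Rle_lt_trans; [apply Rabs_triang|]; rewrite !Rabs_mult.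
    replace eps with (e * (Rabs c + Rabs d + 1)) by (unfold e; field; lra).
    generalize (Rabs_pos c) (Rabs_pos d) (Rabs_pos a) (Rabs_pos b); intros; nra. }
  exists (Rmin d1 d2); split; [unfold Rmin; destruct Rle_dec; lra|].
  generalize (Rmin_l d1 d2) (Rmin_r d1 d2); intros; split; intros ht.
  + replace (c * G t + d * H t - (c * l2 + d * m2)) with (c * (G t - l2) + d * (H t - m2)) by ring.
    apply key; [apply (K1 t) | apply (K2 t)]; lra.
  + replace (c * G t + d * H t - (c * l1 + d * m1)) with (c * (G t - l1) + d * (H t - m1)) by ring.
    apply key; [apply (K1 t) | apply (K2 t)]; lra.
Qed.

Lemma Jint_ge_on f c d : adm f -> (forall t, -1 < t < 1 -> 0 <= f t) ->
  -1 < c -> c <= d -> d < 1 -> RInt (fun t => f t * w t) c d <= Jint f.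
Proof.
intros Hf Hp hc hcd hd.
destruct (Jint_repr f Hf) as [G [l1 [l2 [[HG1 HG2] [HL E]]]]]; rewrite E.
assert (mono : forall x y, -1 < x -> x <= y -> y < 1 -> G x <= G y).
{ intros x y hx hxy hy.
  destruct (MVT_gen G x y (fun t => f t * w t)) as [z [Hz1 Hz2]].
  - rewrite Rmin_left, Rmax_right by lra; intros; apply HG1; lra.
  - rewrite Rmin_left, Rmax_right by lra; intros t ht; apply continuity_pt_filterlim.
    eapply continuous_is_derive; apply HG1; lra.
  - rewrite Rmin_left, Rmax_right in Hz1 by lra.
    assert (0 <= f z * w z) by (apply Rmult_le_pos; [apply Hp; lra | apply Rlt_le, jweight_pos]); nra. }
assert (I : RInt (fun t => f t * w t) c d = G d - G c).
{ apply is_RInt_unique; apply (is_RInt_derive G (fun t => f t * w t));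
  rewrite Rmin_left, Rmax_right by lra; intros; [apply HG1 | apply HG2]; lra. }
rewrite I.
assert (G d <= l2).
{ apply le_epsilon; intros eps he; destruct (HL eps he) as [e [He K]].
  assert (Hm : exists t, 1 - e < t < 1 /\ d <= t).
  { exists (Rmax d (1 - e / 2)); split; [split|apply Rmax_l].
    apply Rlt_le_trans with (1 - e / 2); [lra | apply Rmax_r].
    apply Rmax_lub_lt; lra. }
  destruct Hm as [t [ht1 ht2]]; destruct (K t) as [K1 _]; specialize (K1 ht1).
  apply Rabs_def2 in K1; generalize (mono d t); intros; lra. }
assert (l1 <= G c).
{ apply le_epsilon; intros eps he; destruct (HL eps he) as [e [He K]].
  assert (Hm : exists t, -1 < t < -1 + e /\ t <= c).
  { exists (Rmin c (-1 + e / 2)); split; [split|apply Rmin_l].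
    apply Rmin_glb_lt; lra.
    apply Rle_lt_trans with (-1 + e / 2); [apply Rmin_r | lra]. }
  destruct Hm as [t [ht1 ht2]]; destruct (K t) as [_ K1]; specialize (K1 ht1).
  apply Rabs_def2 in K1; generalize (mono t c); intros; lra. }
lra.
Qed.

Lemma Jint_ge0 f : adm f -> (forall t, -1 < t < 1 -> 0 <= f t) -> 0 <= Jint f.
Proof.
intros Hf Hp; assert (H := Jint_ge_on f 0 0 Hf Hp ltac:(lra) ltac:(lra) ltac:(lra)).
rewrite RInt_point in H; exact H.
Qed.

Lemma Jint_gt0 f t0 : adm f -> (forall t, -1 < t < 1 -> 0 <= f t) ->
  -1 < t0 < 1 -> 0 < f t0 -> 0 < Jint f.
Proof.
intros Hf Hp h0 H0.
assert (Hc : continuous f t0) by (apply Hf; exact h0).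
assert (k0 : 0 < f t0 / 2) by lra.
destruct (proj1 (filterlim_locally f (f t0)) Hc (mkposreal _ k0)) as [e He].
set (d := Rmin (e / 2) (Rmin ((1 - t0) / 2) ((1 + t0) / 2))).
assert (hd : 0 < d /\ d <= e / 2 /\ d <= (1 - t0) / 2 /\ d <= (1 + t0) / 2).
{ destruct e as [e e0]; unfold d; simpl in *.
  generalize (Rmin_l (e / 2) (Rmin ((1 - t0) / 2) ((1 + t0) / 2)))
    (Rmin_r (e / 2) (Rmin ((1 - t0) / 2) ((1 + t0) / 2)))
    (Rmin_l ((1 - t0) / 2) ((1 + t0) / 2)) (Rmin_r ((1 - t0) / 2) ((1 + t0) / 2)); intros.
  repeat split; try lra; repeat apply Rmin_case; lra. }
apply Rlt_le_trans with (2 := Jint_ge_on f (t0 - d) (t0 + d) Hf Hp ltac:(lra) ltac:(lra) ltac:(lra)).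
apply RInt_gt_0; [lra | |].
- intros x hx; apply Rmult_lt_0_compat; [|apply jweight_pos].
  assert (B : Rabs (f x - f t0) < f t0 / 2).
  { apply (ball_R_inv _ _ (mkposreal _ k0)); apply He; apply ball_R; apply Rabs_def1; lra. }
  apply Rabs_def2 in B; lra.
- intros x hx; apply (continuous_mult f w); [apply Hf | apply jweight_continuous]; lra.
Qed.

Lemma Jint_minus f g : adm f -> adm g -> Jint (fun t => f t - g t) = Jint f - Jint g.
Proof.
intros Hf Hg; replace (Jint f - Jint g) with (1 * Jint f + -1 * Jint g) by ring.
rewrite <- Jint_lin by assumption; apply Jint_ext; [now apply adm_minus | intros; ring].
Qed.

Lemma Jint_plus f g : adm f -> adm g -> Jint (fun t => f t + g t) = Jint f + Jint g.
Proof.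
intros Hf Hg; replace (Jint f + Jint g) with (1 * Jint f + 1 * Jint g) by ring.
rewrite <- Jint_lin by assumption; apply Jint_ext; [now apply adm_plus | intros; ring].
Qed.

Lemma Jint_scal c f : adm f -> Jint (fun t => c * f t) = c * Jint f.
Proof.
intros Hf; replace (c * Jint f) with (c * Jint f + 0 * Jint f) by ring.
rewrite <- Jint_lin by assumption; apply Jint_ext; [now apply adm_scal | intros; ring].
Qed.

Lemma Jint_le f g : adm f -> adm g -> (forall t, -1 < t < 1 -> f t <= g t) -> Jint f <= Jint g.
Proof.
intros Hf Hg H; assert (0 <= Jint (fun t => g t - f t)).
{ apply Jint_ge0; [now apply adm_minus | intros t ht; specialize (H t ht); lra]. }
rewrite Jint_minus in H0 by assumption; lra.
Qed.

Lemma Jint_abs f M : adm f -> (forall t, -1 < t < 1 -> Rabs (f t) <= M) ->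
  Rabs (Jint f) <= M * Jint (fun _ => 1).
Proof.
intros Hf H.
assert (E : forall c, Jint (fun _ => c) = c * Jint (fun _ => 1)).
{ intros c; rewrite <- Jint_scal by apply adm_const; apply Jint_ext; [apply adm_const | intros; ring]. }
apply Rabs_le; rewrite <- E, <- (Ropp_involutive (Jint f)); split.
- apply Ropp_le_contravar; replace (- Jint f) with (-1 * Jint f) by ring; rewrite <- Jint_scal by assumption.
  apply Jint_le; [now apply adm_scal | apply adm_const |].
  intros t ht; specialize (H t ht); apply Rabs_le_between in H; lra.
- rewrite Ropp_involutive; apply Jint_le; [assumption | apply adm_const |].
  intros t ht; specialize (H t ht); apply Rabs_le_between in H; lra.
Qed.

Lemma Jint_CS f g : adm f -> adm g ->
  Jint (fun t => f t * g t) ^ 2 <= Jint (fun t => f t ^ 2) * Jint (fun t => g t ^ 2).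
Proof.
intros Hf Hg.
assert (sq : forall f, adm f -> adm (fun t => f t ^ 2)).
{ intros h Hh; apply (adm_ext (fun t => h t * h t)); [intros; ring | now apply adm_mult]. }
set (a := Jint (fun t => f t ^ 2)); set (b := Jint (fun t => f t * g t)); set (c := Jint (fun t => g t ^ 2)).
assert (Q : forall x y, 0 <= x ^ 2 * a + 2 * x * y * b + y ^ 2 * c).
{ intros x y.
  assert (E : Jint (fun t => (x * f t + y * g t) ^ 2) = x ^ 2 * a + 2 * x * y * b + y ^ 2 * c).
  { unfold a, b, c.
    replace (x ^ 2 * Jint (fun t => f t ^ 2) + 2 * x * y * Jint (fun t => f t * g t) + y ^ 2 * Jint (fun t => g t ^ 2))
     with (1 * (x ^ 2 * Jint (fun t => f t ^ 2) + 2 * x * y * Jint (fun t => f t * g t)) + y ^ 2 * Jint (fun t => g t ^ 2)) by ring.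
    rewrite <- (Jint_lin (x ^ 2)) by auto using adm_mult.
    rewrite <- Jint_lin by auto using adm_plus, adm_scal, adm_mult.
    apply Jint_ext; [apply sq; auto using adm_plus, adm_scal | intros; ring]. }
  rewrite <- E; apply Jint_ge0; [apply sq; auto using adm_plus, adm_scal | intros; apply pow2_ge_0]. }
assert (a0 : 0 <= a) by (unfold a; apply Jint_ge0; [auto | intros; apply pow2_ge_0]).
assert (c0 : 0 <= c) by (unfold c; apply Jint_ge0; [auto | intros; apply pow2_ge_0]).
destruct (Req_dec c 0) as [E|E].
(* When [c = 0], the second test vector gives [- b ^ 2 * (a + 2) >= 0], hence [b = 0]. *)
- generalize (Q 1 (- b)) (Q b (- (a + 1))); rewrite E; intros Q1 Q2.
  assert (b = 0) by nra. rewrite H; lra.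
- assert (H := Q c (- b)). assert (0 < c) by lra.
  assert (0 <= a * c - b ^ 2); [|lra].
  apply Rmult_le_reg_l with c; [assumption|]; nra.
Qed.

Lemma Jint_sq_eq0 f : adm f -> Jint (fun t => f t ^ 2) = 0 -> forall t, -1 < t < 1 -> f t = 0.
Proof.
intros Hf H t ht; destruct (Req_dec (f t) 0) as [E|E]; [exact E|exfalso].
assert (0 < Jint (fun t => f t ^ 2)); [|lra].
apply Jint_gt0 with t; [|intros; apply pow2_ge_0 | exact ht | now apply pow2_gt_0].
apply (adm_ext (fun t => f t * f t)); [intros; ring | now apply adm_mult].
Qed.

(** The operator takes the two derivatives as arguments because at -1 and 1 they are only
    one-sided. *)
Definition DI (f1 f2 : R -> R) (t : R) : R :=
  (1 - t ^ 2) * f2 t + (beta - alpha - (alpha + beta + 2) * t) * f1 t.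

Definition C2adm (f f1 f2 : R -> R) : Prop :=
  (forall t, -1 < t < 1 -> is_derive f t (f1 t)) /\
  (forall t, -1 < t < 1 -> is_derive f1 t (f2 t)) /\ adm f /\ adm f1 /\ adm f2.

Lemma adm_DI f1 f2 : adm f1 -> adm f2 -> adm (DI f1 f2).
Proof.
intros H1 H2; apply (adm_ext (fun t => (1 - t * t) * f2 t + (beta - alpha - (alpha + beta + 2) * t) * f1 t)).
intros; unfold DI; ring.
auto 10 using adm_plus, adm_mult, adm_minus, adm_const, adm_id.
Qed.

(** Lagrange's identity: the difference of the integrands is the derivative of [(1 - t)^(alpha + 1)
    (1 + t)^(beta + 1) (f' g - f g')], which tends to 0 at both ends since the exponents are
    positive and the Wronskian is bounded. *)
Lemma Jint_sym f f1 f2 g g1 g2 : C2adm f f1 f2 -> C2adm g g1 g2 ->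
  Jint (fun t => DI f1 f2 t * g t) = Jint (fun t => f t * DI g1 g2 t).
Proof.
intros [Hf1 [Hf2 [Af [Af1 Af2]]]] [Hg1 [Hg2 [Ag [Ag1 Ag2]]]].
assert (A1 := adm_DI f1 f2 Af1 Af2); assert (A2 := adm_DI g1 g2 Ag1 Ag2).
apply Rminus_diag_uniq; rewrite <- Jint_minus by auto using adm_mult.
replace 0 with (0 - 0) by ring.
set (h := fun t => f1 t * g t - f t * g1 t).
assert (Ah : adm h) by (unfold h; auto using adm_minus, adm_mult).
destruct Ah as [_ [M HM]].
apply int_m11_anti with (fun t => Rpower (1 - t) (alpha + 1) * Rpower (1 + t) (beta + 1) * h t).
- split.
  + intros t ht.
    assert (D1 := is_derive_Rpower_m (alpha + 1) t (proj2 ht)).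
    assert (D2 := is_derive_Rpower_p (beta + 1) t (proj1 ht)).
    replace (alpha + 1 - 1) with alpha in D1 by ring.
    replace (beta + 1 - 1) with beta in D2 by ring.
    assert (D3 : is_derive h t (f2 t * g t - f t * g2 t)).
    { evar_last. unfold h.
      apply (is_derive_minus (fun t => f1 t * g t) (fun t => f t * g1 t)).
      apply (is_derive_mult f1 g); [now apply Hf2 | now apply Hg1 | apply Rmult_comm].
      apply (is_derive_mult f g1); [now apply Hf1 | now apply Hg2 | apply Rmult_comm].
      unfold minus, plus, opp, mult; simpl; ring. }
    assert (E1 : Rpower (1 - t) (alpha + 1) = Rpower (1 - t) alpha * (1 - t)).
    { rewrite Rpower_plus, Rpower_1; lra. }
    assert (E2 : Rpower (1 + t) (beta + 1) = Rpower (1 + t) beta * (1 + t)).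
    { rewrite Rpower_plus, Rpower_1; lra. }
    evar_last.
    apply (is_derive_mult (fun t => Rpower (1 - t) (alpha + 1) * Rpower (1 + t) (beta + 1)) h);
      [apply (is_derive_mult (fun t => Rpower (1 - t) (alpha + 1)) (fun t => Rpower (1 + t) (beta + 1)));
        [exact D1 | exact D2 | apply Rmult_comm] | exact D3 | apply Rmult_comm].
    unfold mult, plus; simpl; unfold mult, plus; simpl.
    rewrite E1, E2; unfold DI, w, jweight, h; ring.
  + intros t ht; apply (continuous_mult (fun t => DI f1 f2 t * g t - f t * DI g1 g2 t) w).
    * assert (AA : adm (fun t => DI f1 f2 t * g t - f t * DI g1 g2 t)) by auto using adm_minus, adm_mult.
      now apply AA.
    * now apply jweight_continuous.
- intros eps he.
  set (A := 1 + Rpower 2 (alpha + 1)); set (B := 1 + Rpower 2 (beta + 1)).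
  assert (hA : 1 < A) by (unfold A; generalize (exp_pos ((alpha + 1) * ln 2)); unfold Rpower; lra).
  assert (hB : 1 < B) by (unfold B; generalize (exp_pos ((beta + 1) * ln 2)); unfold Rpower; lra).
  assert (M0 : 0 <= Rabs M) by apply Rabs_pos.
  set (k := eps / (A * B * (Rabs M + 1))).
  assert (k0 : 0 < k) by (apply Rdiv_lt_0_compat; [lra | repeat apply Rmult_lt_0_compat; lra]).
  assert (small : forall x y z, 0 < x < k -> 0 < y <= A * B -> Rabs z <= M -> Rabs (x * y * z) < eps).
  { intros x y z hx hy hz; rewrite !Rabs_mult, (Rabs_pos_eq x), (Rabs_pos_eq y) by lra.
    replace eps with (k * (A * B * (Rabs M + 1))) by (unfold k; field; repeat split; lra).
    assert (0 <= Rabs z <= Rabs M) by (split; [apply Rabs_pos | eapply Rle_trans; [exact hz | apply Rle_abs]]).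
    rewrite Rmult_assoc; apply Rlt_le_trans with (k * (y * (Rabs M + 1))).
    - apply Rle_lt_trans with (x * (y * (Rabs M + 1))).
      + apply Rmult_le_compat_l; [lra|]; apply Rmult_le_compat_l; lra.
      + apply Rmult_lt_compat_r; [apply Rmult_lt_0_compat |]; lra.
    - apply Rmult_le_compat_l; [lra|]; apply Rmult_le_compat_r; lra. }
  destruct (Rpower_pos_small (beta + 1) k) as [d1 [Hd1 H1]]; [lra | exact k0 |].
  destruct (Rpower_pos_small (alpha + 1) k) as [d2 [Hd2 H2]]; [lra | exact k0 |].
  exists (Rmin d1 d2); split; [unfold Rmin; destruct Rle_dec; lra|].
  generalize (Rmin_l d1 d2) (Rmin_r d1 d2); intros m1 m2 t; rewrite Rminus_0_r.
  assert (P1 : 0 < Rpower (1 - t) (alpha + 1)) by apply exp_pos.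
  assert (P2 : 0 < Rpower (1 + t) (beta + 1)) by apply exp_pos.
  split; intros ht.
  + apply small; [split; [exact P1 | apply H2; lra] | split; [exact P2|] | apply HM; lra].
    assert (Rpower (1 + t) (beta + 1) <= B) by (apply Rpower_le_2; lra); nra.
  + rewrite (Rmult_comm (Rpower (1 - t) (alpha + 1))).
    apply small; [split; [exact P2 | apply H1; lra] | split; [exact P1|] | apply HM; lra].
    assert (Rpower (1 - t) (alpha + 1) <= A) by (apply Rpower_le_2; lra); nra.
Qed.
End Weight.

(** * Bernstein approximation *)

(** Bernstein polynomials by de Casteljau's recursion. *)
Fixpoint bern (n : nat) (h : nat -> R) (x : R) : R :=
  match n with
  | O => h O
  | S m => x * bern m (fun k => h (S k)) x + (1 - x) * bern m h x
  end.

Lemma bern_le n h h' x : 0 <= x <= 1 -> (forall k, (k <= n)%nat -> h k <= h' k) ->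
  bern n h x <= bern n h' x.
Proof.
revert h h'; induction n as [|n IH]; intros h h' hx H; simpl; [apply H; lia|].
assert (H1 : bern n (fun k => h (S k)) x <= bern n (fun k => h' (S k)) x)
  by (apply IH; [exact hx | intros; apply H; lia]).
assert (H2 : bern n h x <= bern n h' x) by (apply IH; [exact hx | intros; apply H; lia]).
apply Rplus_le_compat; apply Rmult_le_compat_l; lra.
Qed.

Lemma bern_ext n h h' x : (forall k, h k = h' k) -> bern n h x = bern n h' x.
Proof.
revert h h'; induction n as [|n IH]; intros h h' H; simpl; [apply H|].
rewrite (IH h h'), (IH (fun k => h (S k)) (fun k => h' (S k))); auto.
Qed.

Lemma bern_lin n a b h h' x :
  bern n (fun k => a * h k + b * h' k) x = a * bern n h x + b * bern n h' x.
Proof.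
revert h h'; induction n as [|n IH]; intros h h'; simpl; [ring|].
rewrite (IH h h'), (IH (fun k => h (S k)) (fun k => h' (S k))); ring.
Qed.

Lemma bern_const n c x : bern n (fun _ => c) x = c.
Proof. induction n as [|n IH]; simpl; [reflexivity | rewrite IH; ring]. Qed.

Lemma bern_mean n x : bern n INR x = INR n * x.
Proof.
induction n as [|n IH]; [simpl; ring|].
cbn [bern]; rewrite (bern_ext n (fun k => INR (S k)) (fun k => 1 * INR k + 1 * 1)).
2: intros; rewrite S_INR; ring.
rewrite (bern_lin n 1 1 INR (fun _ => 1)), bern_const, IH, S_INR; ring.
Qed.

Lemma bern_sq n x : bern n (fun k => INR k ^ 2) x = INR n * (INR n - 1) * x ^ 2 + INR n * x.
Proof.
induction n as [|n IH]; [simpl; ring|].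
cbn [bern]; rewrite (bern_ext n (fun k => INR (S k) ^ 2)
  (fun k => 1 * INR k ^ 2 + 1 * (2 * INR k + 1 * 1))).
2: intros; rewrite S_INR; ring.
rewrite (bern_lin n 1 1 (fun k => INR k ^ 2) (fun k => 2 * INR k + 1 * 1)).
rewrite (bern_lin n 2 1 INR (fun _ => 1)), bern_const, bern_mean, IH, S_INR; ring.
Qed.

Lemma bern_var n x : (0 < n)%nat -> bern n (fun k => (x - INR k / INR n) ^ 2) x = x * (1 - x) / INR n.
Proof.
intros hn; assert (n0 : 0 < INR n) by now apply lt_0_INR.
rewrite (bern_ext n _ (fun k => (/ INR n) ^ 2 * INR k ^ 2 + 1 * ((- 2 * x / INR n) * INR k + x ^ 2 * 1))).
2: intros; field; lra.
rewrite (bern_lin n _ _ (fun k => INR k ^ 2) (fun k => (- 2 * x / INR n) * INR k + x ^ 2 * 1)).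
rewrite (bern_lin n _ _ INR (fun _ => 1)), bern_const, bern_mean, bern_sq; field; lra.
Qed.

(** Bernstein's argument with the binomial variance [bern_var]: [M |x - y|] is at most
    [M (eta / 2 + (x - y)^2 / (2 eta))], so the mean square deviation, below [1 / n < eta^2],
    controls the error. *)
Lemma bern_approx (g : R -> R) M eps : 0 <= M -> 0 < eps ->
  (forall x y, 0 <= x <= 1 -> 0 <= y <= 1 -> Rabs (g x - g y) <= M * Rabs (x - y)) ->
  exists n, forall x, 0 <= x <= 1 ->
    Rabs (g x - bern n (fun k => g (INR k / INR n)) x) <= eps.
Proof.
intros hM he Hg.
pose (eta := eps / (M + 1)).
assert (e0 : 0 < eta) by (unfold eta; apply Rdiv_lt_0_compat; lra).
destruct (archimed_cor1 (eta * eta)) as [n [Hn hn]]; [nra|].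
assert (n0 : 0 < INR n) by now apply lt_0_INR.
exists n; intros x hx.
assert (key : forall k, (k <= n)%nat -> Rabs (g x - g (INR k / INR n)) <=
   M * (eta / 2) * 1 + M / (2 * eta) * (x - INR k / INR n) ^ 2).
{ intros k hk.
  assert (hy : 0 <= INR k / INR n <= 1).
  { split; [apply Rdiv_le_0_compat; [apply pos_INR | lra]|].
    apply Rmult_le_reg_r with (INR n); [lra|]; unfold Rdiv; rewrite Rmult_assoc, Rinv_l by lra.
    rewrite Rmult_1_r, Rmult_1_l; now apply le_INR. }
  eapply Rle_trans; [apply Hg; assumption|].
  set (z := x - INR k / INR n).
  replace (M * (eta / 2) * 1 + M / (2 * eta) * z ^ 2) with (M * (eta / 2 + z ^ 2 / (2 * eta))) by (field; lra).
  apply Rmult_le_compat_l; [exact hM|].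
  rewrite <- (pow2_abs z); set (a := Rabs z).
  assert (0 <= (a - eta) ^ 2 / (2 * eta)) by (apply Rdiv_le_0_compat; [apply pow2_ge_0 | lra]).
  replace (eta / 2 + a ^ 2 / (2 * eta)) with (a + (a - eta) ^ 2 / (2 * eta)) by (field; lra). lra. }
assert (T : Rabs (g x - bern n (fun k => g (INR k / INR n)) x) <=
   bern n (fun k => M * (eta / 2) * 1 + M / (2 * eta) * (x - INR k / INR n) ^ 2) x).
{ apply Rabs_le; split.
  - apply Rle_trans with (- bern n (fun k => M * (eta / 2) * 1 + M / (2 * eta) * (x - INR k / INR n) ^ 2) x); [lra|].
    assert (bern n (fun k => 1 * g (INR k / INR n) + - 1 * g x) x <=
      bern n (fun k => M * (eta / 2) * 1 + M / (2 * eta) * (x - INR k / INR n) ^ 2) x).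
    { apply bern_le; [exact hx|]; intros k hk; specialize (key k hk).
      apply Rabs_le_between in key; lra. }
    rewrite (bern_lin n 1 (-1) (fun k => g (INR k / INR n)) (fun _ => g x)), bern_const in H; lra.
  - assert (bern n (fun k => -1 * g (INR k / INR n) + 1 * g x) x <=
      bern n (fun k => M * (eta / 2) * 1 + M / (2 * eta) * (x - INR k / INR n) ^ 2) x).
    { apply bern_le; [exact hx|]; intros k hk; specialize (key k hk).
      apply Rabs_le_between in key; lra. }
    rewrite (bern_lin n (-1) 1 (fun k => g (INR k / INR n)) (fun _ => g x)), bern_const in H; lra. }
eapply Rle_trans; [exact T|].
rewrite (bern_lin n (M * (eta / 2)) (M / (2 * eta)) (fun _ => 1) (fun k => (x - INR k / INR n) ^ 2)).
rewrite bern_const, (bern_var n) by exact hn.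
assert (x * (1 - x) / INR n <= eta * eta).
{ unfold Rdiv; apply Rle_trans with (1 * / INR n); [|lra].
  apply Rmult_le_compat_r; [apply Rlt_le, Rinv_0_lt_compat; lra | nra]. }
apply Rle_trans with (M * (eta / 2) * 1 + M / (2 * eta) * (eta * eta)).
- apply Rplus_le_compat_l; apply Rmult_le_compat_l; [apply Rdiv_le_0_compat; lra | exact H].
- replace (M * (eta / 2) * 1 + M / (2 * eta) * (eta * eta)) with (M * eta) by (field; lra).
  unfold eta; apply Rmult_le_reg_r with (M + 1); [lra|].
  replace (M * (eps / (M + 1)) * (M + 1)) with (M * eps) by (field; lra); nra.
Qed.

(** * Polynomials in [x] as functions of [t] *)

Definition xvar (t : R) : R := (1 - t) / 2.

Lemma is_derive_xvar t : is_derive xvar t (- / 2).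
Proof. unfold xvar; auto_derive; [trivial | field]. Qed.

Section Eval.
Import all_boot all_order all_algebra Rstruct ring lra.
Import Order.TTheory GRing.Theory Num.Theory.
Local Open Scope ring_scope.
Implicit Types (P Q : {poly R}) (c t : R).

Definition ev P t : R := P.[(xvar t)].

Lemma evD P Q t : ev (P + Q) t = Rplus (ev P t) (ev Q t).
Proof. by rewrite /ev hornerD. Qed.
Lemma evM P Q t : ev (P * Q) t = Rmult (ev P t) (ev Q t).
Proof. by rewrite /ev hornerM. Qed.
Lemma evC c t : ev c%:P t = c.
Proof. by rewrite /ev hornerC. Qed.
Lemma evN P t : ev (- P) t = Ropp (ev P t).
Proof. by rewrite /ev hornerN. Qed.
Lemma evB P Q t : ev (P - Q) t = Rminus (ev P t) (ev Q t).
Proof. by rewrite evD evN. Qed.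
Lemma evX t : ev 'X t = (xvar t).
Proof. by rewrite /ev hornerX. Qed.
Lemma is_derive_horner P x : is_derive (fun y : R => P.[y]) x (P^`()).[x].
Proof.
apply/is_derive_Reals; elim/poly_ind: P => [|P c IH].
  rewrite derivC horner0.
  have -> : (fun y : R => (0 : {poly R}).[y]) = fct_cte (IZR 0).
    by apply: functional_extensionality => y; rewrite horner0.
  exact: derivable_pt_lim_const.
have -> : (fun y : R => (P * 'X + c%:P).[y]) =
    plus_fct (mult_fct (fun y : R => P.[y]) Ranalysis1.id) (fct_cte c).
  by apply: functional_extensionality => y; rewrite hornerMXaddC.
have -> : (P * 'X + c%:P)^`().[x] = Rplus (Rplus (Rmult P^`().[x] (Ranalysis1.id x)) (Rmult P.[x] (IZR 1))) (IZR 0).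
  by rewrite derivD derivC addr0 derivM derivX mulr1 hornerD hornerM hornerX !RealsE mulr1 addr0.
apply: derivable_pt_lim_plus; last exact: derivable_pt_lim_const.
apply: derivable_pt_lim_mult => //; exact: derivable_pt_lim_id.
Qed.

(** Differentiation with respect to [t], where [dx / dt = - 1 / 2]. *)
Definition evd P : {poly R} := (Ropp (Rinv (IZR 2)))%:P * P^`().

Lemma is_derive_ev P t : is_derive (ev P) t (ev (evd P) t).
Proof.
rewrite /evd evM evC /ev.
apply: (is_derive_comp (fun y : R => P.[y]) xvar); first exact: is_derive_horner.
have := is_derive_xvar t; rewrite !RealsE; exact.
Qed.

Fixpoint bernP (n : nat) (h : nat -> R) : {poly R} :=
  if n is m.+1 then 'X * bernP m (fun k => h k.+1) + (1 - 'X) * bernP m h else (h 0%N)%:P.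

Lemma bernPE n h t : ev (bernP n h) t = bern n h (xvar t).
Proof.
elim: n h => [|n IH] h /=; first by rewrite evC.
by rewrite evD !evM evB evX -polyC1 evC !IH.
Qed.
End Eval.

Lemma lipschitz_approx (f : R -> R) M eps : 0 <= M -> 0 < eps ->
  (forall x y, inI x -> inI y -> Rabs (f x - f y) <= M * Rabs (x - y)) ->
  exists P, forall t, inI t -> Rabs (f t - ev P t) <= eps.
Proof.
intros hM he Hf.
destruct (bern_approx (fun x => f (1 - 2 * x)) (2 * M) eps) as [n Hn]; [lra | exact he | |].
- intros x y hx hy; eapply Rle_trans; [apply Hf; unfold inI; lra|].
  replace (1 - 2 * x - (1 - 2 * y)) with ((-2) * (x - y)) by ring.
  rewrite Rabs_mult, (Rabs_left (-2)) by lra; right; ring.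
- exists (bernP n (fun k => f (1 - 2 * (INR k / INR n)))); intros t ht; unfold inI in ht.
  rewrite bernPE; unfold xvar; specialize (Hn ((1 - t) / 2) ltac:(lra)); simpl in Hn.
  replace (1 - 2 * ((1 - t) / 2)) with t in Hn by field; exact Hn.
Qed.

(** * Coercivity from an orthogonal expansion *)

Lemma Rabs_xvar_le t : inI t -> Rabs (xvar t) <= 1.
Proof. unfold inI, xvar; intros; apply Rabs_le; lra. Qed.

Lemma xvar_inv x : xvar (1 - 2 * x) = x.
Proof. unfold xvar; field. Qed.

Lemma DI_xvar a b f1 f2 t :
  (xvar t - xvar t * xvar t) * f2 + (a + 1 - (a + b + 2) * xvar t) * f1 =
  DI a b (fun _ => - / 2 * f1) (fun _ => - / 2 * (- / 2 * f2)) t.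
Proof. unfold DI, xvar; field. Qed.

Section EvalWeight.
Import all_boot all_order all_algebra Rstruct ring lra.
Import Order.TTheory GRing.Theory Num.Theory.
Local Open Scope ring_scope.
Implicit Types (P Q : {poly R}) (c t : R).

Lemma xvar_norm t : inI t -> `|xvar t| <= 1.
Proof. by move=> ht; apply/RleP; rewrite -RabsE; apply: Rabs_xvar_le. Qed.

Lemma ev_bound P t : inI t -> Rle (Rabs (ev P t)) (nrm 1 P).
Proof. by move=> ht; apply/RleP; rewrite RabsE; apply: nrm_horner => //; exact: xvar_norm. Qed.

Lemma adm_ev P : adm (ev P).
Proof.
split=> [t _|]; first exact: (continuous_is_derive _ _ _ (is_derive_ev P t)).
exists (nrm 1 P) => t ht; apply: ev_bound; unfold inI; Lra.lra.
Qed.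

Lemma C2adm_ev P : C2adm (ev P) (ev (evd P)) (ev (evd (evd P))).
Proof.
split; first by move=> t _; exact: is_derive_ev.
split; first by move=> t _; exact: is_derive_ev.
by split; [|split]; exact: adm_ev.
Qed.

Lemma ev_Dop (a b : R) P t : ev (Dop a b P) t = DI a b (ev (evd P)) (ev (evd (evd P))) t.
Proof.
have -> : Dop a b P = ('X - 'X * 'X) * P^`()^`() + ((a + 1)%:P - (a + b + 2)%:P * 'X) * P^`().
  by rewrite /Dop /rho expr2.
rewrite evD !evM !evB !evM !evC !evX -[2]/(IZR 2).
apply: (eq_trans (DI_xvar a b (ev P^`() t) (ev P^`()^`() t) t)).
by rewrite /DI /evd derivM derivC mul0r add0r !(evM, evC).
Qed.

Lemma ev_neq0 P : P != 0 -> exists t, (Rlt (IZR (-1)) t /\ Rlt t (IZR 1)) /\ ev P t <> 0.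
Proof.
move=> P0; apply: NNPP => H.
(* As many distinct points of (0, 1) as the size of [P], one more than its number of roots can be;
   they correspond to points [t] of (-1, 1). *)
pose rs := [seq (i.+2%:R)^-1 : R | i <- iota 0 (size P)].
have := @max_poly_roots _ P rs P0.
rewrite size_map size_iota ltnn => h; suff: false by [].
apply: h.
  apply/allP => x /mapP[i _ ->]; apply/eqP; apply: NNPP => e.
  pose x0 : R := (i.+2%:R)^-1.
  have x00 : Rlt (IZR 0) x0 /\ Rlt x0 (IZR 1).
    split; apply/RltP; first by rewrite invr_gt0 ltr0n.
    by rewrite invf_lt1 ?ltr0n // ltr1n.
  apply: H; exists (Rminus (IZR 1) (Rmult (IZR 2) x0)); split.
    by case: x00 => *; split; Lra.lra.
  rewrite /ev; have -> : xvar (Rminus (IZR 1) (Rmult (IZR 2) x0)) = x0 by exact: xvar_inv.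
  exact: e.
rewrite map_inj_uniq ?iota_uniq // => i j /invr_inj /eqP.
by rewrite eqr_nat !eqSS => /eqP.
Qed.

Section Functional.
Variables alpha beta : R.
Hypotheses (halpha : Rlt (IZR (-1)) alpha) (hbeta : Rlt (IZR (-1)) beta).
Let J P := Jint alpha beta (ev P).

Lemma Jint_evD P Q : J (P + Q) = J P + J Q.
Proof.
rewrite -RplusE -(Jint_plus _ _ halpha hbeta); try exact: adm_ev.
by congr Jint; apply: functional_extensionality => t; rewrite evD.
Qed.

Lemma Jint_evZ c P : J (c%:P * P) = c * J P.
Proof.
rewrite -RmultE -(Jint_scal _ _ halpha hbeta); try exact: adm_ev.
by congr Jint; apply: functional_extensionality => t; rewrite evM evC.
Qed.

Lemma Jint_evM P Q : J (P * Q) = Jint alpha beta (fun t => Rmult (ev P t) (ev Q t)).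
Proof. by congr Jint; apply: functional_extensionality => t; rewrite evM. Qed.

Lemma Jint_ev_sq_gt0 P : P != 0 -> 0 < J (P * P).
Proof.
move=> /ev_neq0 [t [ht e]]; rewrite Jint_evM; apply/RltP.
apply: (Jint_gt0 _ _ halpha hbeta _ t) => //.
- by apply: adm_mult; exact: adm_ev.
- by move=> s _; exact: Rle_0_sqr.
- exact: Rlt_0_sqr.
Qed.

Lemma Jint_ev_Dop P Q : J (Dop alpha beta P * Q) = J (P * Dop alpha beta Q).
Proof.
rewrite !Jint_evM.
have -> : (fun t => Rmult (ev (Dop alpha beta P) t) (ev Q t)) =
   (fun t => Rmult (DI alpha beta (ev (evd P)) (ev (evd (evd P))) t) (ev Q t)).
  by apply: functional_extensionality => t; rewrite ev_Dop.
have -> : (fun t => Rmult (ev P t) (ev (Dop alpha beta Q) t)) =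
   (fun t => Rmult (ev P t) (DI alpha beta (ev (evd Q)) (ev (evd (evd Q))) t)).
  by apply: functional_extensionality => t; rewrite ev_Dop.
exact: (Jint_sym _ _ halpha hbeta _ _ _ _ _ _ (C2adm_ev P) (C2adm_ev Q)).
Qed.

Lemma Jint_ev_bound r P : 1 <= r -> `|J P| <= J 1 * nrm r P.
Proof.
move=> r1; apply/RleP; rewrite -RabsE -RmultE Rmult_comm.
have E : J 1 = Jint alpha beta (fun=> IZR 1).
  by congr Jint; apply: functional_extensionality => t; rewrite -polyC1 evC.
rewrite E; apply: (Jint_abs _ _ halpha hbeta); first exact: adm_ev.
move=> t ht; apply/RleP; rewrite RabsE; apply: nrm_horner => //.
by apply: xvar_norm; case: ht => *; split; exact: Rlt_le.
Qed.
End Functional.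
End EvalWeight.

Section Coercive.
Variables alpha beta : R.
Hypotheses (halpha : -1 < alpha) (hbeta : -1 < beta).
Let J := Jint alpha beta.

Variable e : nat -> R -> R.
Hypothesis adm_e : forall k, adm (e k).
Hypothesis orth_e : forall i j, i <> j -> J (fun t => e i t * e j t) = 0.
Hypothesis norm_e : forall k, 0 < J (fun t => e k t ^ 2).

Fixpoint fsub (d : R -> R) (b : nat -> R) (N : nat) (t : R) : R :=
  match N with O => d t | S n => fsub d b n t - b n * e n t end.

Fixpoint energy (c : nat -> R) (N : nat) : R :=
  match N with O => 0 | S n => energy c n + c n ^ 2 / J (fun t => e n t ^ 2) end.

Lemma adm_sq f : adm f -> adm (fun t => f t ^ 2).
Proof.
intros H; apply (adm_ext (fun t => f t * f t)); [intros; ring | now apply adm_mult].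
Qed.

Lemma adm_fsub d b N : adm d -> adm (fsub d b N).
Proof.
intros Hd; induction N as [|n IH]; [exact Hd|].
apply (adm_minus (fsub d b n) (fun t => b n * e n t)); [exact IH | now apply adm_scal].
Qed.

Lemma fsub_coef d b N j : adm d -> (N <= j)%nat ->
  J (fun t => fsub d b N t * e j t) = J (fun t => d t * e j t).
Proof.
intros Hd; induction N as [|n IH]; intros hj; [reflexivity|].
rewrite <- IH by lia.
assert (H1 : adm (fun t => fsub d b n t * e j t)) by auto using adm_mult, adm_fsub.
assert (H2 : adm (fun t => e n t * e j t)) by auto using adm_mult.
transitivity (J (fun t => 1 * (fsub d b n t * e j t) + (- b n) * (e n t * e j t))).
- apply (Jint_ext _ _ halpha hbeta); [| intros; simpl; ring].
  apply adm_mult; [now apply (adm_fsub d b (S n)) | auto].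
- unfold J; rewrite Jint_lin by assumption; fold J; rewrite orth_e by lia; ring.
Qed.

Lemma fsub_norm d b n : adm d ->
  J (fun t => fsub d b (S n) t ^ 2) = J (fun t => fsub d b n t ^ 2)
    - 2 * b n * J (fun t => d t * e n t) + b n ^ 2 * J (fun t => e n t ^ 2).
Proof.
intros Hd.
rewrite <- (fsub_coef d b n n Hd) by lia.
assert (H0 := adm_fsub d b n Hd).
assert (H1 : adm (fun t => fsub d b n t * e n t)) by auto using adm_mult.
assert (H2 := adm_sq _ H0); assert (H3 := adm_sq _ (adm_e n)).
transitivity (J (fun t => 1 * (1 * fsub d b n t ^ 2 + (- 2 * b n) * (fsub d b n t * e n t)) + b n ^ 2 * (e n t ^ 2))).
- apply (Jint_ext _ _ halpha hbeta); [| intros; simpl; ring].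
  apply adm_sq; now apply (adm_fsub d b (S n)).
- unfold J; rewrite Jint_lin by auto using adm_plus, adm_scal.
  rewrite Jint_lin by assumption; ring.
Qed.

(** Orthogonal coefficients are the best ones: any other choice [b] adds the square
    [h (b n - c / h) ^ 2] at each index. *)
Lemma energy_lower d b N : adm d ->
  J (fun t => d t ^ 2) - energy (fun i => J (fun t => d t * e i t)) N <= J (fun t => fsub d b N t ^ 2).
Proof.
intros Hd; induction N as [|n IH]; [simpl; lra|].
rewrite fsub_norm by exact Hd; cbn [energy].
set (c := J (fun t => d t * e n t)) in *; set (h := J (fun t => e n t ^ 2)).
assert (h0 : 0 < h) by apply norm_e.
assert (0 <= h * (b n - c / h) ^ 2) by (apply Rmult_le_pos; [lra | apply pow2_ge_0]).
replace (h * (b n - c / h) ^ 2) with (c ^ 2 / h - 2 * b n * c + b n ^ 2 * h) in H by (field; lra).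
lra.
Qed.

Lemma bessel d N : adm d -> energy (fun i => J (fun t => d t * e i t)) N <= J (fun t => d t ^ 2).
Proof.
intros Hd; set (c := fun i => J (fun t => d t * e i t)).
set (b := fun i => c i / J (fun t => e i t ^ 2)).
assert (E : J (fun t => fsub d b N t ^ 2) = J (fun t => d t ^ 2) - energy c N).
{ induction N as [|n IH]; [simpl; ring|].
  rewrite fsub_norm, IH by exact Hd; cbn [energy]; fold (c n).
  assert (h0 := norm_e n); unfold b; field; lra. }
assert (0 <= J (fun t => fsub d b N t ^ 2)); [|lra].
apply (Jint_ge0 _ _ halpha hbeta); [now apply adm_sq, adm_fsub | intros; apply pow2_ge_0].
Qed.

(** Parseval for [d], which is a uniform limit of combinations of the [e i], and Bessel
    for [f]. *)
Lemma coercive d f kap :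
  adm d -> adm f ->
  (forall eps, 0 < eps -> exists N b, forall t, -1 < t < 1 -> Rabs (fsub d b N t) <= eps) ->
  (forall i, (kap * J (fun t => d t * e i t)) ^ 2 <= J (fun t => f t * e i t) ^ 2) ->
  kap ^ 2 * J (fun t => d t ^ 2) <= J (fun t => f t ^ 2).
Proof.
intros Hd Hf Happ Hk.
assert (I1 : 0 <= J (fun _ => 1)).
{ apply (Jint_ge0 _ _ halpha hbeta); [apply adm_const | intros; lra]. }
assert (Hen : forall N, kap ^ 2 * energy (fun i => J (fun t => d t * e i t)) N <=
   energy (fun i => J (fun t => f t * e i t)) N).
{ induction N as [|n IH]; cbn [energy]; [lra|].
  specialize (Hk n); assert (h0 := norm_e n).
  rewrite Rmult_plus_distr_l; apply Rplus_le_compat; [exact IH|].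
  unfold Rdiv; rewrite <- Rmult_assoc; apply Rmult_le_compat_r.
  apply Rlt_le, Rinv_0_lt_compat; exact h0.
  rewrite <- Rpow_mult_distr; exact Hk. }
apply le_epsilon; intros eps he.
set (m := kap ^ 2 * J (fun _ => 1) + 1).
assert (k0 : 0 <= kap ^ 2) by apply pow2_ge_0.
assert (m0 : 0 < m) by (unfold m; nra).
(* A uniform error [sqrt (eps / m)] becomes [eps / m] in the squared norm, and [m] exceeds [kap ^ 2]
   times the total mass of the weight. *)
assert (s0 : 0 < sqrt (eps / m)) by (apply sqrt_lt_R0, Rdiv_lt_0_compat; lra).
destruct (Happ _ s0) as [N [b Hb]].
assert (H1 := energy_lower d b N Hd); assert (H2 := bessel f N Hf); assert (H3 := Hen N).
assert (H4 : J (fun t => fsub d b N t ^ 2) <= eps / m * J (fun _ => 1)).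
{ eapply Rle_trans; [apply Rle_abs|].
  apply (Jint_abs _ _ halpha hbeta); [now apply adm_sq, adm_fsub |].
  intros t ht; specialize (Hb t ht).
  rewrite Rabs_pos_eq by apply pow2_ge_0; rewrite <- pow2_abs.
  rewrite <- (pow2_sqrt (eps / m)) by (apply Rlt_le, Rdiv_lt_0_compat; lra).
  apply pow_incr; split; [apply Rabs_pos | exact Hb]. }
assert (H5 : kap ^ 2 * (eps / m * J (fun _ => 1)) <= eps).
{ apply Rmult_le_reg_r with m; [exact m0|].
  replace (kap ^ 2 * (eps / m * J (fun _ => 1)) * m) with (eps * (kap ^ 2 * J (fun _ => 1))) by (field; lra).
  unfold m; nra. }
nra.
Qed.
End Coercive.

(** * Spectral gap and local rigidity *)

Definition eigval (a b : R) (k : nat) : R := INR k * (INR k + (a + b + 1)).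

Section Basis.
Import all_boot all_order all_algebra Rstruct ring lra.
Import Order.TTheory GRing.Theory Num.Theory.
Local Open Scope ring_scope.
Variables a b : R.
Hypotheses (ha : Rlt (IZR (-1)) a) (hb : Rlt (IZR (-1)) b).

Definition jacr_fun (k : nat) : R -> R := ev (jacr a b k).

Lemma ltr_m1 (x : R) : Rlt (IZR (-1)) x -> -1 < x.
Proof. by move=> /RltP. Qed.

Lemma Lam_eigval k : Lam a b k = eigval a b k.
Proof. by rewrite /Lam /eigval INRE !RealsE. Qed.

Lemma jacr_fun_span P : exists N c, forall d t, fsub jacr_fun d c N t = Rminus (d t) (ev P t).
Proof.
have [c Hc] := @jacr_span0 _ a b (ltr_m1 _ ha) (ltr_m1 _ hb) (size P) P (leqnn _).
exists (size P), c => d t; rewrite [in RHS]Hc.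
elim: (size P) => [|n IH]; first by rewrite big_ord0 -polyC0 evC /= Rminus_0_r.
rewrite big_ord_recr /= IH evD evM evC.
rewrite !RealsE; ring.
Qed.

Lemma jacr_fun_orth i j : i <> j -> Jint a b (fun t => Rmult (jacr_fun i t) (jacr_fun j t)) = 0.
Proof.
move=> /eqP ij; rewrite /jacr_fun -Jint_evM.
exact: (jacr_orth (ltr_m1 _ ha) (ltr_m1 _ hb) (Jint_evZ a b ha hb) (Jint_ev_Dop a b ha hb)).
Qed.

Lemma jacr_fun_norm k : Rlt 0 (Jint a b (fun t => pow (jacr_fun k t) 2)).
Proof.
have -> : (fun t => pow (jacr_fun k t) 2) = (fun t => Rmult (jacr_fun k t) (jacr_fun k t)).
  by apply: functional_extensionality => t /=; rewrite Rmult_1_r.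
rewrite /jacr_fun -Jint_evM; apply/RltP; apply: (Jint_ev_sq_gt0 a b ha hb).
exact: (jacr_neq0 (ltr_m1 _ ha) (ltr_m1 _ hb)).
Qed.

Lemma jacr_fun_eigen k t : DI a b (ev (evd (jacr a b k))) (ev (evd (evd (jacr a b k)))) t =
  Rmult (Ropp (eigval a b k)) (jacr_fun k t).
Proof. by rewrite -ev_Dop Dop_jacr evM evC Lam_eigval. Qed.
End Basis.

Section Linear.
Variables alpha beta : R.
Hypotheses (halpha : -1 < alpha) (hbeta : -1 < beta).
Let J := Jint alpha beta.
Let e := jacr_fun alpha beta.
Let L := eigval alpha beta.

Lemma eigval_unbounded K : exists N, forall i, (N <= i)%nat -> K + 1 <= L i.
Proof.
destruct (INR_unbounded (Rabs K + 3)) as [N HN]; exists N; intros i hi.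
apply le_INR in hi; unfold L, eigval.
assert (K <= Rabs K) by apply Rle_abs; assert (0 <= Rabs K) by apply Rabs_pos; nra.
Qed.

(** Only finitely many indices have to be inspected, since [eigval_unbounded] keeps the others at
    distance at least 1 from [K]. *)
Lemma spectral_gap K : exists kap, 0 < kap /\ forall i, L i = K \/ kap <= Rabs (K - L i).
Proof.
destruct (eigval_unbounded K) as [N HN].
assert (H : exists kap, 0 < kap /\ forall i, (i < N)%nat -> L i = K \/ kap <= Rabs (K - L i)).
{ clear HN; induction N as [|n [kap [h0 IH]]]; [exists 1; split; [lra | lia]|].
  destruct (Req_dec (L n) K) as [E|E].
  - exists kap; split; [exact h0|]; intros i hi.
    destruct (Nat.eq_dec i n) as [->|]; [now left | apply IH; lia].
  - exists (Rmin kap (Rabs (K - L n))).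
    assert (0 < Rabs (K - L n)) by (apply Rabs_pos_lt; lra).
    split; [apply Rmin_case; lra|]; intros i hi.
    destruct (Nat.eq_dec i n) as [->|]; [right; apply Rmin_r|].
    destruct (IH i ltac:(lia)) as [?|?]; [now left | right].
    eapply Rle_trans; [apply Rmin_l | assumption]. }
destruct H as [kap [h0 H]]; exists (Rmin kap 1); split; [apply Rmin_case; lra|]; intros i.
destruct (Nat.lt_ge_cases i N) as [hi|hi].
- destruct (H i hi); [now left | right; eapply Rle_trans; [apply Rmin_l | assumption]].
- right; specialize (HN i hi); rewrite Rabs_left by lra.
  eapply Rle_trans; [apply Rmin_r | lra].
Qed.

Definition lip (f : R -> R) : Prop :=
  exists M, 0 <= M /\ forall x y, inI x -> inI y -> Rabs (f x - f y) <= M * Rabs (x - y).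

(** By symmetry the coefficient of [(D + K) d] on [e i] is [K - L i] times that of [d], which the
    spectral gap bounds below off the kernel. The Lipschitz condition provides the uniform
    polynomial approximation that [coercive] requires. *)
Lemma resolvent_bound K : exists kap, 0 < kap /\ forall d d1 d2,
  C2adm d d1 d2 -> lip d -> (forall i, L i = K -> J (fun t => d t * e i t) = 0) ->
  kap ^ 2 * J (fun t => d t ^ 2) <= J (fun t => (DI alpha beta d1 d2 t + K * d t) ^ 2).
Proof.
destruct (spectral_gap K) as [kap [h0 H]]; exists kap; split; [exact h0|].
intros d d1 d2 Hd [M [M0 HM]] Hk.
assert (Ad : adm d) by apply Hd.
assert (ADI : adm (DI alpha beta d1 d2)) by (apply adm_DI; apply Hd).
assert (Ae : forall i, adm (e i)) by (intros; apply adm_ev).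
apply (coercive alpha beta halpha hbeta e) with (f := fun t => DI alpha beta d1 d2 t + K * d t).
- exact Ae.
- intros; apply (jacr_fun_orth alpha beta halpha hbeta); assumption.
- intros; apply (jacr_fun_norm alpha beta halpha hbeta).
- exact Ad.
- apply adm_plus; [exact ADI | now apply adm_scal].
- intros eps he; destruct (lipschitz_approx d M eps M0 he HM) as [P HP].
  destruct (jacr_fun_span alpha beta halpha hbeta P) as [N [c Hc]]; exists N, c; intros t ht.
  unfold e; rewrite Hc; apply HP; unfold inI; lra.
- intros i.
  assert (E : Jint alpha beta (fun t => (DI alpha beta d1 d2 t + K * d t) * e i t) = (K - L i) * J (fun t => d t * e i t)).
  { transitivity (Jint alpha beta (fun t => 1 * (DI alpha beta d1 d2 t * e i t) + K * (d t * e i t))).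
    - apply (Jint_ext _ _ halpha hbeta); [| intros; ring].
      apply adm_mult; [apply adm_plus; [exact ADI | now apply adm_scal] | apply Ae].
    - rewrite Jint_lin by auto using adm_mult.
      unfold e at 1; unfold jacr_fun.
      rewrite (Jint_sym _ _ halpha hbeta d d1 d2 _ _ _ Hd (C2adm_ev _)).
      rewrite (Jint_ext _ _ halpha hbeta _ (fun t => - L i * (d t * e i t))).
      rewrite Jint_scal by auto using adm_mult; unfold J; ring.
      apply adm_mult; [exact Ad | apply adm_DI; apply adm_ev].
      intros t ht; rewrite (jacr_fun_eigen alpha beta); unfold e, L; ring. }
  rewrite E; fold J; destruct (H i) as [H1|H1].
  + rewrite (Hk i H1); lra.
  + rewrite !Rpow_mult_distr; apply Rmult_le_compat_r; [apply pow2_ge_0|].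
    rewrite <- (pow2_abs (K - L i)); apply pow_incr; lra.
Qed.

End Linear.

(** * Differentiability up to the ends of the closed interval *)

Lemma deriv_on_is_derive f f1 t : deriv_on f f1 -> -1 < t < 1 -> is_derive f t (f1 t).
Proof.
intros H ht; apply is_derive_Reals; intros eps he.
destruct (H t ltac:(unfold inI; lra) eps he) as [d [d0 Hd]].
assert (h0 : 0 < Rmin d (Rmin (t + 1) (1 - t))) by (repeat apply Rmin_case; lra).
exists (mkposreal _ h0); intros h hn hh; simpl in hh.
generalize (Rmin_l d (Rmin (t + 1) (1 - t))) (Rmin_r d (Rmin (t + 1) (1 - t)))
  (Rmin_l (t + 1) (1 - t)) (Rmin_r (t + 1) (1 - t)); intros.
assert (hh' := hh); apply Rabs_def2 in hh'.
replace ((f (t + h) - f t) / h) with ((f (t + h) - f t) / (t + h - t)) by (f_equal; ring).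
apply Hd; [unfold inI; lra|]; replace (t + h - t) with h by ring.
split; [now apply Rabs_pos_lt | lra].
Qed.

(** Approximating an endpoint from inside carries identities and Lipschitz bounds from the open
    interval, where the calculus takes place, to the closed one. *)
Lemma deriv_on_cont f f1 x eps : deriv_on f f1 -> inI x -> 0 < eps ->
  exists y, -1 < y < 1 /\ Rabs (y - x) < eps /\ Rabs (f y - f x) < eps.
Proof.
intros H hx he; destruct (H x hx 1 Rlt_0_1) as [d [d0 Hd]].
set (m := Rabs (f1 x) + 2).
assert (m0 : 0 < m) by (unfold m; generalize (Rabs_pos (f1 x)); intros; lra).
set (r := Rmin (Rmin d eps) (Rmin (eps / m) 1) / 2).
assert (hr : 0 < r /\ r < d /\ r < eps /\ r < eps / m /\ r < 1).
{ assert (0 < eps / m) by now apply Rdiv_lt_0_compat.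
  generalize (Rmin_l (Rmin d eps) (Rmin (eps / m) 1)) (Rmin_r (Rmin d eps) (Rmin (eps / m) 1))
   (Rmin_l d eps) (Rmin_r d eps) (Rmin_l (eps / m) 1) (Rmin_r (eps / m) 1); intros.
  assert (0 < Rmin (Rmin d eps) (Rmin (eps / m) 1)) by (repeat apply Rmin_case; lra).
  unfold r; lra. }
assert (hy : exists y, -1 < y < 1 /\ Rabs (y - x) = r).
{ unfold inI in hx; destruct (Rle_dec x 0).
  - exists (x + r); split; [lra|]; rewrite Rabs_pos_eq; lra.
  - exists (x - r); split; [lra|]; rewrite Rabs_left; lra. }
destruct hy as [y [hy E]]; exists y; split; [exact hy|]; split; [lra|].
specialize (Hd y ltac:(unfold inI; lra) ltac:(lra)).
assert (y - x <> 0) by (intros Z; rewrite Z, Rabs_R0 in E; lra).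
replace (f y - f x) with ((f y - f x) / (y - x) * (y - x)) by (field; assumption).
rewrite Rabs_mult, E.
assert (Rabs ((f y - f x) / (y - x)) <= m).
{ replace ((f y - f x) / (y - x)) with ((f y - f x) / (y - x) - f1 x + f1 x) by ring.
  eapply Rle_trans; [apply Rabs_triang | unfold m; lra]. }
apply Rle_lt_trans with (m * r); [apply Rmult_le_compat_r; lra|].
replace eps with (m * (eps / m)) by (field; lra); apply Rmult_lt_compat_l; lra.
Qed.

Lemma lip_interior f f1 M : deriv_on f f1 -> 0 <= M ->
  (forall t, -1 < t < 1 -> Rabs (f1 t) <= M) ->
  forall x y, inI x -> inI y -> Rabs (f x - f y) <= M * Rabs (x - y).
Proof.
intros H M0 HM.
assert (I : forall x y, -1 < x < 1 -> -1 < y < 1 -> Rabs (f x - f y) <= M * Rabs (x - y)).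
{ intros x y hx hy; destruct (MVT_gen f y x f1) as [c [Hc E]].
  - intros t ht; apply (deriv_on_is_derive f); [exact H|].
    unfold Rmin, Rmax in ht; destruct (Rle_dec y x); lra.
  - intros t ht; apply continuity_pt_filterlim; eapply continuous_is_derive.
    apply (deriv_on_is_derive f f1); [exact H|].
    unfold Rmin, Rmax in ht; destruct (Rle_dec y x); lra.
  - rewrite E, Rabs_mult; apply Rmult_le_compat_r; [apply Rabs_pos | apply HM].
    unfold Rmin, Rmax in Hc; destruct (Rle_dec y x); lra. }
intros x y hx hy; apply le_epsilon; intros eps he.
set (r := eps / (2 * M + 2)).
assert (r0 : 0 < r) by (unfold r; apply Rdiv_lt_0_compat; lra).
destruct (deriv_on_cont f f1 x r H hx r0) as [x' [hx' [E1 E2]]].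
destruct (deriv_on_cont f f1 y r H hy r0) as [y' [hy' [E3 E4]]].
specialize (I x' y' hx' hy').
assert (Rabs (f x - f y) <= Rabs (f x' - f y') + 2 * r).
{ replace (f x - f y) with ((f x' - f y') + (- (f x' - f x) + (f y' - f y))) by ring.
  eapply Rle_trans; [apply Rabs_triang|]; apply Rplus_le_compat_l.
  eapply Rle_trans; [apply Rabs_triang|]; rewrite Rabs_Ropp; lra. }
assert (Rabs (x' - y') <= Rabs (x - y) + 2 * r).
{ replace (x' - y') with ((x - y) + ((x' - x) + - (y' - y))) by ring.
  eapply Rle_trans; [apply Rabs_triang|]; apply Rplus_le_compat_l.
  eapply Rle_trans; [apply Rabs_triang|]; rewrite Rabs_Ropp; lra. }
assert (M * Rabs (x' - y') <= M * (Rabs (x - y) + 2 * r)) by now apply Rmult_le_compat_l.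
assert (eps = 2 * M * r + 2 * r) by (unfold r; field; lra).
lra.
Qed.

(** Bounds descend one derivative at a time: the Hoelder condition bounds [f2], so [f1] is Lipschitz
    and bounded, and then so is [f]. *)
Lemma C2g_regular gam f f1 f2 : 0 < gam -> C2g_with gam f f1 f2 -> C2adm f f1 f2 /\ lip f.
Proof.
intros hg [H1 [H2 [d Hd]]].
assert (D1 : forall t, -1 < t < 1 -> is_derive f t (f1 t)) by (intros; now apply deriv_on_is_derive).
assert (D2 : forall t, -1 < t < 1 -> is_derive f1 t (f2 t)) by (intros; now apply deriv_on_is_derive).
(* A negative Hoelder constant is refuted by the two points 0 and 1. *)
assert (d0 : 0 <= d).
{ assert (h := Hd 0 1 ltac:(unfold inI; lra) ltac:(unfold inI; lra) ltac:(lra)).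
  assert (0 < Rpower (Rabs (0 - 1)) gam) by apply exp_pos.
  generalize (Rabs_pos (f2 0 - f2 1)); intros.
  destruct (Rle_dec 0 d); [assumption|exfalso]; nra. }
assert (B2 : forall t, -1 < t < 1 -> Rabs (f2 t) <= Rabs (f2 0) + d).
{ intros t ht; destruct (Req_dec t 0) as [->|n]; [lra|].
  assert (h := Hd t 0 ltac:(unfold inI; lra) ltac:(unfold inI; lra) n).
  rewrite Rminus_0_r in h.
  assert (Rpower (Rabs t) gam <= 1).
  { replace 1 with (Rpower 1 gam) by (unfold Rpower; now rewrite ln_1, Rmult_0_r, exp_0).
    apply Rle_Rpower_l; [lra|]; split; [now apply Rabs_pos_lt | apply Rabs_le; lra]. }
  assert (d * Rpower (Rabs t) gam <= d * 1) by now apply Rmult_le_compat_l.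
  replace (f2 t) with (f2 0 + (f2 t - f2 0)) by ring.
  eapply Rle_trans; [apply Rabs_triang|]; lra. }
assert (L1 := lip_interior f1 f2 (Rabs (f2 0) + d) H2 ltac:(generalize (Rabs_pos (f2 0)); intros; lra) B2).
assert (bound : forall g M, 0 <= M -> (forall x y, inI x -> inI y -> Rabs (g x - g y) <= M * Rabs (x - y)) ->
  forall t, -1 < t < 1 -> Rabs (g t) <= Rabs (g 0) + M).
{ intros g M M0 Hg t ht; specialize (Hg t 0 ltac:(unfold inI; lra) ltac:(unfold inI; lra)).
  rewrite Rminus_0_r in Hg.
  assert (M * Rabs t <= M * 1) by (apply Rmult_le_compat_l; [exact M0 | apply Rabs_le; lra]).
  replace (g t) with (g 0 + (g t - g 0)) by ring.
  eapply Rle_trans; [apply Rabs_triang|]; lra. }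
assert (P2 : 0 <= Rabs (f2 0) + d) by (generalize (Rabs_pos (f2 0)); intros; lra).
assert (B1 := bound f1 _ P2 L1).
assert (P1 : 0 <= Rabs (f1 0) + (Rabs (f2 0) + d)) by (generalize (Rabs_pos (f1 0)); intros; lra).
assert (L0 := lip_interior f f1 _ H1 P1 B1).
assert (B0 := bound f _ P1 L0).
split; [|exists (Rabs (f1 0) + (Rabs (f2 0) + d)); now split].
split; [exact D1|]; split; [exact D2|]; split; [|split]; (split; [|eexists; eassumption]).
- intros t ht; eapply continuous_is_derive; now apply D1.
- intros t ht; eapply continuous_is_derive; now apply D2.
- intros t ht; apply filterlim_locally; intros eps.
  destruct (Rpower_pos_small gam (eps / (d + 1))) as [r [Hr K]]; [exact hg | destruct eps; simpl; apply Rdiv_lt_0_compat; lra |].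
  assert (h0 : 0 < Rmin r (Rmin (t + 1) (1 - t))) by (repeat apply Rmin_case; lra).
  exists (mkposreal _ h0); intros y Hy; apply ball_R_inv in Hy; simpl in Hy; apply ball_R.
  generalize (Rmin_l r (Rmin (t + 1) (1 - t))) (Rmin_r r (Rmin (t + 1) (1 - t)))
    (Rmin_l (t + 1) (1 - t)) (Rmin_r (t + 1) (1 - t)); intros.
  destruct (Req_dec y t) as [->|n]; [rewrite Rminus_diag, Rabs_R0; apply cond_pos|].
  assert (hy := Hy); apply Rabs_def2 in hy.
  assert (h := Hd y t ltac:(unfold inI; lra) ltac:(unfold inI; lra) n).
  assert (K' := K (Rabs (y - t)) ltac:(split; [apply Rabs_pos_lt; lra | lra])).
  destruct eps as [eps he]; simpl in *.
  eapply Rle_lt_trans; [exact h|].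
  apply Rle_lt_trans with (d * (eps / (d + 1))); [apply Rmult_le_compat_l; lra|].
  apply Rmult_lt_reg_r with (d + 1); [lra|].
  replace (d * (eps / (d + 1)) * (d + 1)) with (d * eps) by (field; lra); lra.
Qed.

Lemma deriv_on_eq0 f f1 : deriv_on f f1 -> (forall t, -1 < t < 1 -> f t = 0) -> forall t, inI t -> f t = 0.
Proof.
intros H H0 t ht; destruct (Req_dec (f t) 0) as [E|E]; [exact E|exfalso].
destruct (deriv_on_cont f f1 t (Rabs (f t)) H ht ltac:(now apply Rabs_pos_lt)) as [y [hy [_ h]]].
rewrite (H0 y hy), Rminus_0_l, Rabs_Ropp in h; lra.
Qed.

Lemma deriv_on_lin c e f f1 g g1 : deriv_on f f1 -> deriv_on g g1 ->
  deriv_on (fun t => c * f t + e * g t) (fun t => c * f1 t + e * g1 t).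
Proof.
intros Hf Hg x hx eps he.
set (m := Rabs c + Rabs e + 1).
assert (m0 : 0 < m) by (unfold m; generalize (Rabs_pos c) (Rabs_pos e); intros; lra).
assert (k0 : 0 < eps / m) by now apply Rdiv_lt_0_compat.
destruct (Hf x hx _ k0) as [d1 [h1 H1]]; destruct (Hg x hx _ k0) as [d2 [h2 H2]].
exists (Rmin d1 d2); split; [apply Rmin_case; lra|]; intros y hy hxy.
generalize (Rmin_l d1 d2) (Rmin_r d1 d2); intros.
specialize (H1 y hy ltac:(lra)); specialize (H2 y hy ltac:(lra)).
assert (y - x <> 0) by (intros Z; rewrite Z, Rabs_R0 in hxy; lra).
replace ((c * f y + e * g y - (c * f x + e * g x)) / (y - x) - (c * f1 x + e * g1 x))
  with (c * ((f y - f x) / (y - x) - f1 x) + e * ((g y - g x) / (y - x) - g1 x)) by (field; assumption).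
eapply Rle_lt_trans; [apply Rabs_triang|]; rewrite !Rabs_mult.
replace eps with ((Rabs c + Rabs e + 1) * (eps / m)) by (unfold m; field; unfold m in m0; lra).
generalize (Rabs_pos c) (Rabs_pos e); intros; nra.
Qed.

Lemma C2g_with_lin gam c e f f1 f2 g g1 g2 : C2g_with gam f f1 f2 -> C2g_with gam g g1 g2 ->
  C2g_with gam (fun t => c * f t + e * g t) (fun t => c * f1 t + e * g1 t) (fun t => c * f2 t + e * g2 t).
Proof.
intros [A1 [A2 [a Ha]]] [B1 [B2 [b Hb]]].
split; [now apply deriv_on_lin|]; split; [now apply deriv_on_lin|].
exists (Rabs c * a + Rabs e * b); intros s t hs ht hst.
specialize (Ha s t hs ht hst); specialize (Hb s t hs ht hst).
replace (c * f2 s + e * g2 s - (c * f2 t + e * g2 t)) with (c * (f2 s - f2 t) + e * (g2 s - g2 t)) by ring.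
eapply Rle_trans; [apply Rabs_triang|]; rewrite !Rabs_mult.
generalize (Rabs_pos c) (Rabs_pos e); intros; nra.
Qed.

Lemma deriv_on_ext f f1 g g1 : (forall t, inI t -> f t = g t) -> (forall t, inI t -> f1 t = g1 t) ->
  deriv_on f f1 -> deriv_on g g1.
Proof.
intros E E1 H x hx eps he; destruct (H x hx eps he) as [d [d0 Hd]].
exists d; split; [exact d0|]; intros y hy hxy; rewrite <- !E, <- E1 by assumption; now apply Hd.
Qed.

Lemma deriv_on_const c : deriv_on (fun _ => c) (fun _ => 0).
Proof.
intros x hx eps he; exists 1; split; [lra|]; intros y hy hxy.
replace ((c - c) / (y - x) - 0) with 0; [rewrite Rabs_R0; exact he|].
unfold Rdiv; ring.
Qed.

Lemma C2g_with_const gam c : C2g_with gam (fun _ => c) (fun _ => 0) (fun _ => 0).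
Proof.
split; [apply deriv_on_const|]; split; [apply deriv_on_const|].
exists 0; intros s t _ _ _; rewrite Rminus_diag, Rabs_R0; lra.
Qed.

Lemma near_bound gam lam eps u mu : near gam lam eps u mu ->
  (forall t, inI t -> Rabs (u t - 1) < eps) /\ Rabs (mu - lam) < eps.
Proof.
intros [[f1 [f2 [_ [a [b [c [d [Hs [Ha [Hb [Hc Hd]]]]]]]]]]] Hm]; split; [|exact Hm].
intros t ht; specialize (Ha t ht).
specialize (Hb t ht); specialize (Hc t ht).
assert (0 <= d).
{ assert (h := Hd 0 1 ltac:(unfold inI; lra) ltac:(unfold inI; lra) ltac:(lra)).
  assert (0 < Rpower (Rabs (0 - 1)) gam) by apply exp_pos.
  generalize (Rabs_pos (f2 0 - f2 1)); intros.
  destruct (Rle_dec 0 d); [assumption|exfalso]; nra. }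
generalize (Rabs_pos (f1 t)) (Rabs_pos (f2 t)); intros; lra.
Qed.

(** With [u = 1 + v] the equation becomes [D v = - mu * nonlin q v]. *)
Definition nonlin (q v : R) : R := Rpower (1 + v) q - (1 + v).

Lemma nonlin_0 q : nonlin q 0 = 0.
Proof. unfold nonlin; rewrite Rplus_0_r; unfold Rpower; rewrite ln_1, Rmult_0_r, exp_0; ring. Qed.

(** [nonlin q] has derivative [q - 1] at 0 and this derivative is continuous, so by the mean value
    theorem [nonlin q] minus its linear part is [eps]-Lipschitz near 0. *)
Lemma nonlin_linearized q eps : 0 < eps -> exists del, 0 < del < 1 /\ forall v w,
  Rabs v <= del -> Rabs w <= del -> Rabs (nonlin q v - nonlin q w - (q - 1) * (v - w)) <= eps * Rabs (v - w).
Proof.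
intros he.
pose (g := fun v => q * Rpower (1 + v) (q - 1) - 1).
assert (Hg : continuous g 0).
{ apply (continuous_minus (fun v => q * Rpower (1 + v) (q - 1)) (fun _ => 1)); [|apply continuous_const].
  apply (continuous_scal_r q (fun v => Rpower (1 + v) (q - 1))).
  eapply continuous_is_derive; apply is_derive_Rpower_p; lra. }
assert (g0 : g 0 = q - 1).
{ unfold g; rewrite Rplus_0_r; unfold Rpower; rewrite ln_1, Rmult_0_r, exp_0; ring. }
destruct (proj1 (filterlim_locally g (g 0)) Hg (mkposreal _ he)) as [[d d0] Hd].
exists (Rmin (d / 2) (1 / 2)).
split; [unfold Rmin; destruct Rle_dec; lra|].
generalize (Rmin_l (d / 2) (1 / 2)) (Rmin_r (d / 2) (1 / 2)); intros m1 m2 v w hv hw.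
apply Rabs_le_between in hv; apply Rabs_le_between in hw.
assert (D : forall x, -1 < x -> is_derive (fun v => nonlin q v - (q - 1) * v) x (g x - (q - 1))).
{ intros x hx; unfold nonlin, g.
  apply (is_derive_minus (fun v => Rpower (1 + v) q - (1 + v)) (fun v => (q - 1) * v)).
  apply (is_derive_minus (fun v => Rpower (1 + v) q) (fun v => 1 + v)).
  now apply is_derive_Rpower_p.
  auto_derive; [trivial | ring].
  auto_derive; [trivial | ring]. }
destruct (MVT_gen (fun v => nonlin q v - (q - 1) * v) w v (fun x => g x - (q - 1))) as [c [Hc E]].
- intros t ht; apply D; unfold Rmin, Rmax in ht; destruct (Rle_dec w v); lra.
- intros t ht; apply continuity_pt_filterlim.
  apply (continuous_is_derive (fun v => nonlin q v - (q - 1) * v) t (g t - (q - 1))), D.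
  unfold Rmin, Rmax in ht; destruct (Rle_dec w v); lra.
- replace (nonlin q v - nonlin q w - (q - 1) * (v - w)) with ((g c - (q - 1)) * (v - w)) by lra.
  rewrite Rabs_mult; apply Rmult_le_compat_r; [apply Rabs_pos|].
  rewrite <- g0; apply Rlt_le.
  apply (ball_R_inv (g 0) (g c) (mkposreal _ he)); apply Hd; change (Rabs (c - 0) < d).
  apply Rabs_def1; unfold Rmin at 1, Rmax in Hc; destruct (Rle_dec w v); lra.
Qed.

Section Rigidity.
Variables alpha beta q gam : R.
Hypotheses (halpha : -1 < alpha) (hbeta : -1 < beta) (hq : 1 < q) (hgam : 0 < gam < 1).

Lemma solution_split u mu : is_solution alpha beta q gam u mu ->
  exists v1 v2, C2g_with gam (fun t => u t - 1) v1 v2 /\ 0 < mu /\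
    forall t, inI t -> DI alpha beta v1 v2 t = - mu * nonlin q (u t - 1).
Proof.
intros [hm [hu [u1 [u2 [HC HE]]]]].
exists (fun t => 1 * u1 t + -1 * 0), (fun t => 1 * u2 t + -1 * 0); split; [|split; [exact hm|]].
- replace (fun t => u t - 1) with (fun t => 1 * u t + -1 * 1) by (apply functional_extensionality; intros; ring).
  apply (C2g_with_lin gam 1 (-1) u u1 u2 (fun _ => 1)); [exact HC | apply C2g_with_const].
- intros t ht; specialize (HE t ht); unfold DI, nonlin.
  replace (1 + (u t - 1)) with (u t) by ring; lra.
Qed.

(** For [v = u - 1], the function [(D + lam (q - 1)) v] equals [(lam - mu) (q - 1) v - mu (nonlin q
    v - (q - 1) v)], pointwise at most [kap / 2] times [|v|]; the operator is bounded below by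
    [kap], so [v = 0]. *)
Theorem local_rigidity lam : 0 < lam ->
  (forall k : nat, (1 <= k)%nat -> lam <> lambda_k alpha beta q k) ->
  exists eps, 0 < eps /\
    forall u mu, is_solution alpha beta q gam u mu -> near gam lam eps u mu -> is_one u.
Proof.
intros hl Hk.
destruct (resolvent_bound alpha beta halpha hbeta (lam * (q - 1))) as [kap [k0 HR]].
(* [e2 * (lam + 1) = kap / 8] and [e1 * (q - 1) = kap / 4] add up to less than [kap / 2]; [lam + 1]
   bounds [mu] because the radius is at most 1. *)
set (e2 := kap / (8 * (lam + 1))).
assert (e20 : 0 < e2) by (unfold e2; apply Rdiv_lt_0_compat; lra).
destruct (nonlin_linearized q e2 e20) as [del [Hdel HF]].
set (e1 := kap / (4 * (q - 1))).
assert (e10 : 0 < e1) by (unfold e1; apply Rdiv_lt_0_compat; lra).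
exists (Rmin (Rmin del 1) e1); split; [repeat apply Rmin_case; lra|].
generalize (Rmin_l (Rmin del 1) e1) (Rmin_r (Rmin del 1) e1) (Rmin_l del 1) (Rmin_r del 1); intros m1 m2 m3 m4.
intros u mu Hs Hn; destruct (near_bound _ _ _ _ _ Hn) as [Hu Hm].
destruct (solution_split u mu Hs) as [v1 [v2 [HC [hm HE]]]].
destruct (C2g_regular gam _ v1 v2 (proj1 hgam) HC) as [HA HL].
set (v := fun t => u t - 1) in *.
(* [lam * (q - 1)] is not an eigenvalue: the one of index 0 is zero, and the others are excluded by
   the assumption on [lam]. The kernel is trivial and the orthogonality condition is void. *)
assert (Hno : forall i, eigval alpha beta i = lam * (q - 1) -> Jint alpha beta (fun t => v t * jacr_fun alpha beta i t) = 0).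
{ intros i Hi; exfalso; destruct i as [|i].
  - unfold eigval in Hi; simpl in Hi; nra.
  - apply (Hk (S i)); [lia|]; unfold lambda_k; apply Rmult_eq_reg_r with (q - 1); [|lra].
    rewrite <- Hi; unfold eigval; field; lra. }
specialize (HR v v1 v2 HA HL Hno).
assert (Av : adm v) by apply HA.
assert (bd : Jint alpha beta (fun t => (DI alpha beta v1 v2 t + lam * (q - 1) * v t) ^ 2) <=
  Jint alpha beta (fun t => (kap / 2) ^ 2 * v t ^ 2)).
{ apply (Jint_le _ _ halpha hbeta); [| |].
  - apply adm_sq; apply adm_plus; [apply adm_DI; apply HA | now apply adm_scal].
  - apply adm_scal; now apply adm_sq.
  - intros t ht; assert (hI : inI t) by (unfold inI; lra); rewrite (HE t hI); fold (v t).
    specialize (Hu t hI); fold (v t) in Hu.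
    assert (F1 := HF (v t) 0 ltac:(lra) ltac:(rewrite Rabs_R0; lra)).
    rewrite nonlin_0, !Rminus_0_r in F1.
    replace (- mu * nonlin q (v t) + lam * (q - 1) * v t) with
      ((lam - mu) * (q - 1) * v t + - mu * (nonlin q (v t) - (q - 1) * v t)) by ring.
    rewrite <- Rpow_mult_distr, <- (pow2_abs (kap / 2 * v t)), <- pow2_abs; apply pow_incr; split; [apply Rabs_pos|].
    eapply Rle_trans; [apply Rabs_triang|]; rewrite !Rabs_mult, Rabs_Ropp.
    rewrite (Rabs_pos_eq (q - 1)), (Rabs_pos_eq mu), (Rabs_pos_eq (kap / 2)) by lra.
    assert (G1 : Rabs (lam - mu) * (q - 1) <= kap / 4).
    { rewrite Rabs_minus_sym; replace (kap / 4) with (e1 * (q - 1)) by (unfold e1; field; lra).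
      apply Rmult_le_compat_r; lra. }
    assert (G2 : mu * e2 <= kap / 8).
    { replace (kap / 8) with ((lam + 1) * e2) by (unfold e2; field; lra).
      apply Rmult_le_compat_r; [lra|]; apply Rabs_def2 in Hm; lra. }
    generalize (Rabs_pos (v t)); intros.
    assert (mu * Rabs (nonlin q (v t) - (q - 1) * v t) <= mu * (e2 * Rabs (v t))) by (apply Rmult_le_compat_l; lra).
    nra. }
rewrite Jint_scal in bd by (try assumption; now apply adm_sq).
assert (Z : Jint alpha beta (fun t => v t ^ 2) = 0).
{ assert (0 <= Jint alpha beta (fun t => v t ^ 2)).
  { apply (Jint_ge0 _ _ halpha hbeta); [now apply adm_sq | intros; apply pow2_ge_0]. }
  assert (0 < kap ^ 2) by (apply pow_lt; lra). nra. }
assert (V0 := Jint_sq_eq0 _ _ halpha hbeta v Av Z).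
intros t ht; assert (v t = 0) by (destruct HC as [H1 _]; now apply (deriv_on_eq0 v v1)).
unfold v in H; lra.
Qed.
End Rigidity.

(** * The abstract recursion applied to the Jacobi operator *)

Section Instance.
Import all_boot all_order all_algebra Rstruct ring lra.
Import Order.TTheory GRing.Theory Num.Theory.
Local Open Scope ring_scope.
Variables a b q : R.
Hypotheses (ha : Rlt (IZR (-1)) a) (hb : Rlt (IZR (-1)) b) (hq : Rlt (IZR 1) q).
Variable k : nat.
Hypothesis hk : (1 <= k)%N.
Let ha' := ltr_m1 _ ha.
Let hb' := ltr_m1 _ hb.

Definition jpoly : {poly R} := ((Rinv (INR (Factorial.fact k)))%:P * jacr a b k).
Let lk := lambda_k a b q k.
Let J P := Jint a b (ev P).

Lemma lk_E : lk = Lam a b k / (q - 1).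
Proof. by rewrite /lk /lambda_k /Lam INRE !RealsE !addrA. Qed.

Lemma PS_multE (x y : nat -> R) n : PS_mult x y n = \sum_(i < n.+1) x i * y (n - i)%N.
Proof. by rewrite /PS_mult sum_f_R0E big_mkord. Qed.

Lemma ev_bigsum n (H : 'I_n -> {poly R}) t : ev (\sum_(i < n) H i) t = \sum_(i < n) ev (H i) t.
Proof. by rewrite /ev horner_sum. Qed.

Lemma nrm_mono (r s : R) P : 0 <= r -> r <= s -> nrm r P <= nrm s P.
Proof.
move=> r0 rs; apply: ler_sum => i _; rewrite ler_wpM2l //.
by apply: lerXn2r => //; rewrite nnegrE // (le_trans r0).
Qed.

(** Shift from coefficients of [s^(m+1)] to coefficients of [s^n]; the constant coefficient 1 is
    common to [u] and [u^q]. *)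
Definition coef_poly (V : nat -> {poly R}) (n : nat) : {poly R} := if n is m.+1 then V m else 1.

Lemma bifurcation_series : exists (G Z : nat -> {poly R}) (l : nat -> R) (A Rr : R),
  [/\ G 0%N = 1, Z 0%N = 1, G 1%N = jpoly & l 0%N = lk] /\
  [/\ forall n t, PS_mult l (fun m => Rminus (ev (G m) t) (ev (Z m) t)) n = ev (Dop a b (G n)) t,
   forall n t, PS_mult (fun m => ev (G m) t) (PS_derive (fun m => ev (Z m) t)) n =
      Rmult q (PS_mult (PS_derive (fun m => ev (G m) t)) (fun m => ev (Z m) t) n),
   forall n, J (G n.+2 * jpoly) = 0 &
   l 1%N = Rdiv (Rmult (Rmult (Ropp lk) q) (J (jpoly * jpoly * jpoly))) (Rmult (IZR 2) (J (jpoly * jpoly)))] /\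
  Rlt (IZR 0) Rr /\
  forall n, [/\ Rle (nrm 8 (G n)) (Rmult A (pow Rr n)), Rle (nrm 8 (Z n)) (Rmult A (pow Rr n)) &
    Rle (Rabs (l n)) (Rmult A (pow Rr n))].
Proof.
have q1 : 1 < q by apply/RltP.
have q0 : q - 1 != 0 by rewrite subr_eq0 gt_eqF.
have cn : Rinv (INR (Factorial.fact k)) != 0.
  rewrite RinvE invr_eq0 INRE pnatr_eq0; apply/eqP; exact: Factorial.fact_neq_0.
have LK0 : 0 < Lam a b k := Lam_gt0 ha' hb' hk.
have lk0 : 0 < lk by rewrite lk_E divr_gt0 // subr_gt0.
have KE : lk * (q - 1) = Lam a b k by rewrite lk_E divfK.
have JD := Jint_evD a b ha hb; have JZ := Jint_evZ a b ha hb; have Jpos := Jint_ev_sq_gt0 a b ha hb.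
have Jsym := Jint_ev_Dop a b ha hb.
have [R0 [R01 HR]] := redinv_bound ha' hb' hk Jpos (Jint_ev_bound a b ha hb) cn.
(* At least [R0], for the reduced inverse to be bounded, and at least 8, to dominate the norm of the
   conclusion. *)
pose r := R0 + 8.
have rR0 : R0 <= r by rewrite /r; lra.
have [C [C0 HC]] := HR r rR0.
have r0 : 0 <= r by rewrite /r; lra.
have r8 : 8 <= r by rewrite /r; lra.
have Dp := Dop_scaled_jacr a b k (Rinv (INR (Factorial.fact k))); rewrite -/jpoly -KE in Dp.
have GE := redinvE ha' hb' hk JD JZ Jpos Jsym cn; rewrite -KE in GE.
have prG := proj_redinv ha' hb' k JD JZ Jpos cn.
have prZ : forall c f, proj a b k J (Rinv (INR (Factorial.fact k))) (c%:P * f) =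
    c * proj a b k J (Rinv (INR (Factorial.fact k))) f.
  move=> c f; rewrite /proj -/jpoly -(mulrA c%:P) /J JZ; ring.
have [V [Z [l [A [Rr [[V0 Z0 l0] [[Hode Hpow Hproj Hl1] [Rr0 Hb]]]]]]]] :=
  formal_branch q1 lk0 r0 Dp GE prG (fun f => (HC f).2) (fun f => (HC f).1) prZ.
(* A ratio of at least 1 absorbs the index shift, and the summand 9 lifts the bound above 1 for the
   constant coefficients. *)
exists (coef_poly V), (coef_poly Z), l, ((`|A| + 9) * (Rr + 1)), (Rr + 1).
have J0 : J (jpoly * jpoly) != 0.
  have pn : jpoly != 0 by rewrite /jpoly; apply: scaled_jacr_neq0.
  by rewrite gt_eqF //; exact: (Jpos _ pn).
split; first by split.
split; [split | split].
- case=> [|m] t.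
    rewrite PS_multE big_ord_recl big_ord0 addr0 /= RminusE subrr mulr0.
    by rewrite /Dop /rho derivC derivC !mulr0 addr0 -polyC0 evC.
  rewrite PS_multE big_ord_recr /= subnn RminusE subrr mulr0 addr0 Hode ev_bigsum.
  apply: eq_bigr => i _; rewrite subSn; last by rewrite -ltnS.
  by rewrite evM evC evB.
- move=> n t; rewrite !PS_multE RmultE.
  have := congr1 (fun P => ev P t) (Hpow n).
  rewrite evD !evM !evC ev_bigsum !RealsE => e.
  have ne (i : nat) : (i < n)%N -> (n.-1 - i)%N = (n - i.+1)%N by move=> _; rewrite -subn1 -subnDA add1n.
  have cz (i : nat) : (i < n)%N -> coef_poly Z (n - i)%N = Z (n - i.+1)%N by move=> h; rewrite -subnSK.
  (* The product containing the constant coefficient 1 is isolated; the rest is the convolution of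
     [formal_branch]. *)
  have L1 : \sum_(i < n.+1) ev (coef_poly V i) t * PS_derive (fun m => ev (coef_poly Z m) t) (n - i)%N =
     n.+1%:R * ev (Z n) t + \sum_(i < n) (n - i)%:R * (ev (V i) t * ev (Z (n.-1 - i)%N) t).
    rewrite big_ord_recl; congr (_ + _).
      by rewrite [coef_poly V _]/= -polyC1 evC mul1r subn0 /PS_derive INRE RmultE.
    apply: eq_bigr => i _; have -> : nat_of_ord (lift ord0 i) = i.+1 by [].
    rewrite /PS_derive INRE subnSK // cz // ne // RmultE [coef_poly V _]/=; ring.
  have L2 : \sum_(i < n.+1) PS_derive (fun m => ev (coef_poly V m) t) i * ev (coef_poly Z (n - i)%N) t =
     n.+1%:R * ev (V n) t + \sum_(i < n) i.+1%:R * (ev (V i) t * ev (Z (n.-1 - i)%N) t).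
    rewrite big_ord_recr subnn [coef_poly Z 0%N]/= -polyC1 evC mulr1 [RHS]addrC.
    congr (_ + _); last by rewrite /PS_derive INRE RmultE.
    apply: eq_bigr => i _; have -> : nat_of_ord (widen_ord (leqnSn n) i) = i by [].
    by rewrite /PS_derive INRE cz // ne // RmultE [coef_poly V _]/= mulrA.
  rewrite L1 L2 mulrDr mulr_sumr.
  have -> : n.+1%:R * ev (Z n) t = q * n.+1%:R * ev (V n) t +
      \sum_(i < n) (q * i.+1%:R - (n - i)%:R) * (ev (V i) t * ev (Z (n.-1 - i)%N) t).
    by rewrite e; congr (_ + _); apply: eq_bigr => i _; rewrite evM evC evM.
  rewrite -addrA -big_split /= mulrA; congr (_ + _); apply: eq_bigr => i _; ring.
- move=> n; have := Hproj n; rewrite /proj => /eqP.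
  by rewrite mulf_eq0 invr_eq0 -/jpoly (negbTE J0) orbF => /eqP.
- rewrite Hl1 /proj -/jpoly -[IZR 2]/(2 : R) !RealsE -/(J (jpoly * jpoly)) -/(J (jpoly * jpoly * jpoly)).
  rewrite (_ : (nat_of_pos 2)%:R = 2 :> R) //.
  by move: (J (jpoly * jpoly)) (J (jpoly * jpoly * jpoly)) J0 => x y x0; field.
- by apply/RltP; exact: addr_gt0.
- have A0 : 0 <= `|A| by [].
  have R1 : 1 <= Rr + 1 by rewrite lerDr ltW.
  have R2 n : Rr ^+ n <= (Rr + 1) ^+ n by apply: lerXn2r; rewrite ?nnegrE ?addr_ge0 ?ltW // ltrDl.
  have pw n : 1 <= (Rr + 1) ^+ n by rewrite exprn_ege1.
  have R10 : 0 <= Rr + 1 by apply: le_trans R1.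
  have An n x : x <= A * Rr ^+ n -> x <= (`|A| + 9) * (Rr + 1) ^+ n.+1.
    move=> /le_trans; apply; apply: (@le_trans _ _ (`|A| * (Rr + 1) ^+ n)).
      apply: (@le_trans _ _ (`|A| * Rr ^+ n)); last by rewrite ler_wpM2l.
      by rewrite ler_wpM2r ?ler_norm // exprn_ge0 // ltW.
    rewrite mulrDl; apply: ler_wpDr; first by rewrite mulr_ge0 // exprn_ge0.
    by rewrite ler_wpM2l // exprS ler_peMl // exprn_ge0.
  have An1 n x : x <= A * Rr ^+ n -> x <= (`|A| + 9) * (Rr + 1) * (Rr + 1) ^+ n.+1.
    move=> /An h; apply: (le_trans h).
    by rewrite ler_wpM2r ?exprn_ge0 // ler_peMr // addr_ge0.
  have n1 : nrm 8 (1 : {poly R}) = 1 by rewrite -polyC1 nrmC normr1.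
  have A1 : (1 : R) <= (`|A| + 9) * (Rr + 1) * (Rr + 1) ^+ 0.
    by rewrite mulr1 mulr_ege1 // ler_wpDl // ler1n.
  have m8 P : nrm 8 P <= nrm r P by apply: nrm_mono.
  move=> n; rewrite ?RealsE; split; apply/RleP; rewrite ?RealsE.
  + case: n => [|n]; first by rewrite /= n1.
    by apply: An1; apply: le_trans (m8 _) _; case: (Hb n).
  + case: n => [|n]; first by rewrite /= n1.
    by apply: An1; apply: le_trans (m8 _) _; case: (Hb n) => _ [].
  + have [_ [_ h]] := Hb n; apply: le_trans (An _ _ h) _.
    by rewrite exprS mulrA.
Qed.
End Instance.

(** * Smooth paths given by power series *)

Lemma Rabs_mhalf : Rabs (- / 2) <= 1.
Proof. apply Rabs_le; lra. Qed.

Section PolyPath.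
Import all_boot all_order all_algebra Rstruct ring lra.
Import Order.TTheory GRing.Theory Num.Theory.
Local Open Scope ring_scope.

(** A name for the polynomial type in sections that do not open the algebraic library. *)
Definition rpoly : Type := {poly R}.
(** Each derivative costs a factor [2] in the radius ([nrm_deriv]), so radius [8]
    controls three derivatives, hence the Hoelder seminorm of the second one. *)
Definition pnorm (P : {poly R}) : R := nrm 8 P.
(** Coefficients of the derivative of the path with respect to [s]. *)
Definition shiftd (G : nat -> {poly R}) (n : nat) : {poly R} := (INR n.+1)%:P * G n.+1.

Lemma pnorm_ge0 P : Rle (IZR 0) (pnorm P).
Proof. by apply/RleP; apply: nrm_ge0. Qed.

Lemma pnorm_shiftd G n : pnorm (shiftd G n) = Rmult (INR n.+1) (pnorm (G n.+1)).
Proof. by rewrite /pnorm /shiftd nrmZ INRE ger0_norm // ler0n. Qed.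

Lemma ev_shiftd G n t : ev (shiftd G n) t = Rmult (INR n.+1) (ev (G n.+1) t).
Proof. by rewrite /shiftd evM evC. Qed.

Lemma nrm_evd r P : 1 <= r -> nrm r (evd P) <= nrm (2 * r) P.
Proof.
move=> r1; rewrite /evd nrmZ; apply: (le_trans _ (nrm_deriv P r1)).
rewrite ler_piMl ?nrm_ge0 ?(le_trans ler01) //.
by apply/RleP; rewrite -RabsE; exact: Rabs_mhalf.
Qed.

Lemma ev_pnorm P t : inI t -> [/\ Rle (Rabs (ev P t)) (pnorm P),
  Rle (Rabs (ev (evd P) t)) (pnorm P), Rle (Rabs (ev (evd (evd P)) t)) (pnorm P) &
  Rle (Rabs (ev (evd (evd (evd P))) t)) (pnorm P)].
Proof.
move=> ht.
have H f : nrm 1 f <= pnorm P -> Rle (Rabs (ev f t)) (pnorm P).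
  by move=> h; apply/RleP; apply: le_trans h; apply/RleP; exact: ev_bound.
have h4 : nrm 4 (evd P) <= pnorm P 
  by have e : 8 = 2 * 4 :> R; [rewrite -natrM | rewrite /pnorm e nrm_evd // ler1n].
have h2 : nrm 2 (evd (evd P)) <= pnorm P.
  apply: le_trans h4; have e : 4 = 2 * 2 :> R by rewrite -natrM.
  by rewrite e nrm_evd // ler1n.
have h1 : nrm 1 (evd (evd (evd P))) <= pnorm P.
  by apply: le_trans h2; have := @nrm_evd 1 (evd (evd P)) (lexx _); rewrite mulr1.
split; apply: H => //.
- by apply: nrm_mono; rewrite ?ler1n.
- by apply: le_trans h4; apply: nrm_mono; rewrite ?ler1n.
- by apply: le_trans h2; apply: nrm_mono; rewrite ?ler1n.
Qed.
End PolyPath.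

Lemma ex_series_dom (a b : nat -> R) : (forall n, Rabs (a n) <= b n) -> ex_series b -> ex_series a.
Proof.
intros H Hb; apply (ex_series_le a b); [|exact Hb]; intros n; apply H.
Qed.

Lemma Series_abs_le (a b : nat -> R) : (forall n, Rabs (a n) <= b n) -> ex_series b ->
  Rabs (Series a) <= Series b.
Proof.
intros H Hb.
assert (Ha : ex_series (fun n => Rabs (a n))).
{ apply (ex_series_dom _ b); [|exact Hb]; intros n; rewrite Rabs_Rabsolu; apply H. }
eapply Rle_trans; [now apply Series_Rabs|].
apply Series_le; [|exact Hb]; intros n; split; [apply Rabs_pos | apply H].
Qed.

Lemma Series_ge0 (a : nat -> R) : (forall n, 0 <= a n) -> ex_series a -> 0 <= Series a.
Proof.
intros H Ha; replace 0 with (0 * Series a) by ring; rewrite <- Series_scal_l.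
apply Series_le; [|exact Ha]; intros n; specialize (H n); lra.
Qed.

Lemma Series_lin (c e : R) (a b : nat -> R) : ex_series a -> ex_series b ->
  Series (fun n => c * a n + e * b n) = c * Series a + e * Series b.
Proof.
intros Ha Hb; rewrite Series_plus, !Series_scal_l; [reflexivity | |];
now apply (ex_series_scal_l (V := R_NormedModule)).
Qed.

Section SeriesDeriv.
Variables (c B : nat -> R) (e e1 : nat -> R -> R).
Hypothesis De : forall n t, is_derive (e n) t (e1 n t).
Hypothesis Be : forall n t, inI t -> Rabs (e n t) <= B n.
Hypothesis Be1 : forall n t, inI t -> Rabs (e1 n t) <= B n.
Hypothesis Le1 : forall n x y, inI x -> inI y -> Rabs (e1 n x - e1 n y) <= B n * Rabs (x - y).
Hypothesis Hc : ex_series (fun n => Rabs (c n) * B n).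

Lemma series_term (g : R) n : Rabs g <= B n -> Rabs (c n * g) <= Rabs (c n) * B n.
Proof. intros H; rewrite Rabs_mult; apply Rmult_le_compat_l; [apply Rabs_pos | exact H]. Qed.

(** The Lipschitz bound on [e1 n] makes the first-order Taylor remainder of each term at most
    [B n * |y - x| ^ 2], which is summable against [c]. *)
Lemma series_deriv_on : deriv_on (fun t => Series (fun n => c n * e n t)) (fun t => Series (fun n => c n * e1 n t)).
Proof.
intros x hx eps he.
set (S := Series (fun n => Rabs (c n) * B n)).
assert (B0 : forall n, 0 <= B n).
{ intros n; eapply Rle_trans; [apply Rabs_pos | apply (Be n x hx)]. }
assert (S0 : 0 <= S).
{ apply Series_ge0; [|exact Hc]; intros n; apply Rmult_le_pos; [apply Rabs_pos | apply B0]. }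
exists (eps / (S + 1)); split; [apply Rdiv_lt_0_compat; lra|]; intros y hy [hxy1 hxy2].
assert (hn : y - x <> 0) by (intros Z; rewrite Z, Rabs_R0 in hxy1; lra).
assert (E1 : ex_series (fun n => c n * e n y)).
{ apply (ex_series_dom _ _ (fun n => series_term _ n (Be n y hy))), Hc. }
assert (E2 : ex_series (fun n => c n * e n x)).
{ apply (ex_series_dom _ _ (fun n => series_term _ n (Be n x hx))), Hc. }
assert (E3 : ex_series (fun n => c n * e1 n x)).
{ apply (ex_series_dom _ _ (fun n => series_term _ n (Be1 n x hx))), Hc. }
assert (T : forall n, Rabs (c n * (e n y - e n x - e1 n x * (y - x))) <= (Rabs (y - x) * Rabs (y - x)) * (Rabs (c n) * B n)).
{ intros n; destruct (MVT_gen (e n) x y (e1 n)) as [z [Hz E]].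
  - intros; apply De.
  - intros t _; apply continuity_pt_filterlim; eapply continuous_is_derive; apply De.
  - rewrite E; replace (e1 n z * (y - x) - e1 n x * (y - x)) with ((e1 n z - e1 n x) * (y - x)) by ring.
    rewrite !Rabs_mult.
    assert (hz : inI z /\ Rabs (z - x) <= Rabs (y - x)).
    { unfold inI, Rmin, Rmax in *; destruct (Rle_dec x y); (split; [lra|]).
      - rewrite !Rabs_pos_eq; lra.
      - rewrite !Rabs_left1; lra. }
    destruct hz as [hz1 hz2]; specialize (Le1 n z x hz1 hx).
    assert (Rabs (e1 n z - e1 n x) <= B n * Rabs (y - x)).
    { eapply Rle_trans; [exact Le1|]; apply Rmult_le_compat_l; [apply B0 | exact hz2]. }
    replace (Rabs (y - x) * Rabs (y - x) * (Rabs (c n) * B n)) with (Rabs (c n) * ((B n * Rabs (y - x)) * Rabs (y - x))) by ring.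
    apply Rmult_le_compat_l; [apply Rabs_pos|]; apply Rmult_le_compat_r; [apply Rabs_pos | assumption]. }
replace ((Series (fun n => c n * e n y) - Series (fun n => c n * e n x)) / (y - x) - Series (fun n => c n * e1 n x))
  with ((1 * Series (fun n => c n * e n y) + -1 * (1 * Series (fun n => c n * e n x) + (y - x) * Series (fun n => c n * e1 n x))) / (y - x))
  by (field; exact hn).
rewrite <- (Series_lin 1 (y - x)) by assumption.
rewrite <- (Series_lin 1 (-1)); [|exact E1|].
2: { apply (ex_series_plus (V := R_NormedModule) (fun n => 1 * (c n * e n x)) (fun n => (y - x) * (c n * e1 n x)));
     now apply (ex_series_scal_l (V := R_NormedModule)). }
unfold Rdiv; rewrite Rabs_mult, Rabs_inv.
apply Rle_lt_trans with ((Rabs (y - x) * Rabs (y - x)) * S * / Rabs (y - x)).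
- apply Rmult_le_compat_r; [apply Rlt_le, Rinv_0_lt_compat, hxy1|].
  unfold S; rewrite <- Series_scal_l; apply Series_abs_le.
  + intros n; replace (1 * (c n * e n y) + -1 * (1 * (c n * e n x) + (y - x) * (c n * e1 n x)))
     with (c n * (e n y - e n x - e1 n x * (y - x))) by ring; apply T.
  + now apply (ex_series_scal_l (V := R_NormedModule)).
- replace (Rabs (y - x) * Rabs (y - x) * S * / Rabs (y - x)) with (Rabs (y - x) * S) by (field; lra).
  apply Rle_lt_trans with (Rabs (y - x) * (S + 1)); [apply Rmult_le_compat_l; lra|].
  replace eps with (eps / (S + 1) * (S + 1)) by (field; lra); apply Rmult_lt_compat_r; lra.
Qed.
End SeriesDeriv.


Section PSum.
Variable gam : R.
Hypothesis hgam : 0 < gam < 1.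

Definition psum (c : nat -> R) (G : nat -> rpoly) (t : R) : R :=
  Series (fun n => c n * ev (G n) t).

(** Distances are at most 2, so in [|x - y| = |x - y|^gam * |x - y|^(1 - gam)] the last factor is at
    most 2. *)
Lemma holder_lip (f : R -> R) S : 0 <= S ->
  (forall x y, inI x -> inI y -> Rabs (f x - f y) <= S * Rabs (x - y)) ->
  holder_bound gam f (2 * S).
Proof.
intros S0 H x y hx hy hxy; eapply Rle_trans; [now apply H|].
set (r := Rabs (x - y)).
assert (r0 : 0 < r) by (apply Rabs_pos_lt; lra).
assert (r2 : r <= 2) by (unfold r; unfold inI in *; apply Rabs_le; lra).
assert (E : r = Rpower r gam * Rpower r (1 - gam)).
{ rewrite <- Rpower_plus; replace (gam + (1 - gam)) with 1 by ring; now rewrite Rpower_1. }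
assert (H1 : Rpower r (1 - gam) <= 2).
{ apply Rle_trans with (Rpower 2 (1 - gam)); [apply Rle_Rpower_l; lra|].
  rewrite <- (Rpower_1 2) at 2 by lra; apply Rle_Rpower; lra. }
assert (0 < Rpower r gam) by apply exp_pos.
rewrite E at 1.
apply Rle_trans with (S * (Rpower r gam * 2)); [|lra].
apply Rmult_le_compat_l; [exact S0|]; apply Rmult_le_compat_l; lra.
Qed.

Lemma psum_C2g (c : nat -> R) (G : nat -> rpoly) S :
  ex_series (fun n => Rabs (c n) * pnorm (G n)) -> Series (fun n => Rabs (c n) * pnorm (G n)) <= S ->
  C2g_with gam (psum c G) (psum c (fun n => evd (G n))) (psum c (fun n => evd (evd (G n)))) /\
  (forall t, inI t -> Rabs (psum c G t) <= S) /\
  (forall t, inI t -> Rabs (psum c (fun n => evd (G n)) t) <= S) /\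
  (forall t, inI t -> Rabs (psum c (fun n => evd (evd (G n))) t) <= S) /\
  holder_bound gam (psum c (fun n => evd (evd (G n)))) (2 * S).
Proof.
intros Hc HS.
assert (K0 : forall n t, inI t -> Rabs (ev (G n) t) <= pnorm (G n)) by (intros n t ht; apply (ev_pnorm (G n) t ht)).
assert (K1 : forall n t, inI t -> Rabs (ev (evd (G n)) t) <= pnorm (G n)) by (intros n t ht; apply (ev_pnorm (G n) t ht)).
assert (K2 : forall n t, inI t -> Rabs (ev (evd (evd (G n))) t) <= pnorm (G n)) by (intros n t ht; apply (ev_pnorm (G n) t ht)).
assert (K3 : forall n t, inI t -> Rabs (ev (evd (evd (evd (G n)))) t) <= pnorm (G n)) by (intros n t ht; apply (ev_pnorm (G n) t ht)).
assert (Lip : forall (H : nat -> rpoly), (forall n t, inI t -> Rabs (ev (evd (H n)) t) <= pnorm (G n)) ->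
  forall n x y, inI x -> inI y -> Rabs (ev (H n) x - ev (H n) y) <= pnorm (G n) * Rabs (x - y)).
{ intros H HB n; apply (lip_interior (ev (H n)) (ev (evd (H n)))).
  - intros x hx eps he.
    assert (D := is_derive_ev (H n) x); apply is_derive_Reals in D.
    destruct (D eps he) as [d Hd]; exists d; split; [apply cond_pos|]; intros y hy [h1 h2].
    specialize (Hd (y - x)); replace (x + (y - x)) with y in Hd by ring; apply Hd; [|exact h2].
    intros Z; rewrite Z, Rabs_R0 in h1; lra.
  - apply pnorm_ge0.
  - intros t ht; apply HB; unfold inI; lra. }
assert (bd : forall (H : nat -> rpoly), (forall n t, inI t -> Rabs (ev (H n) t) <= pnorm (G n)) ->
  forall t, inI t -> Rabs (psum c H t) <= S).
{ intros H HB t ht; eapply Rle_trans; [|exact HS]; apply Series_abs_le; [|exact Hc].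
  intros n; apply (series_term c (fun n => pnorm (G n))); now apply HB. }
assert (S0 : 0 <= S) by (eapply Rle_trans; [apply Rabs_pos | apply (bd G K0 0); unfold inI; lra]).
assert (hold : holder_bound gam (psum c (fun n => evd (evd (G n)))) (2 * S)).
{ apply holder_lip; [exact S0|]; intros x y hx hy.
  assert (Ex : forall t, inI t -> ex_series (fun n => c n * ev (evd (evd (G n))) t)).
  { intros t ht; apply (ex_series_dom _ _ (fun n => series_term c (fun n => pnorm (G n)) _ n (K2 n t ht))), Hc. }
  replace (psum c (fun n => evd (evd (G n))) x - psum c (fun n => evd (evd (G n))) y)
   with (1 * psum c (fun n => evd (evd (G n))) x + -1 * psum c (fun n => evd (evd (G n))) y) by ring.
  unfold psum; rewrite <- Series_lin by auto.
  apply Rle_trans with (Series (fun n => Rabs (x - y) * (Rabs (c n) * pnorm (G n)))).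
  - apply Series_abs_le; [|now apply (ex_series_scal_l (V := R_NormedModule))].
    intros n; replace (1 * (c n * ev (evd (evd (G n))) x) + -1 * (c n * ev (evd (evd (G n))) y))
      with (c n * (ev (evd (evd (G n))) x - ev (evd (evd (G n))) y)) by ring.
    rewrite Rabs_mult; replace (Rabs (x - y) * (Rabs (c n) * pnorm (G n))) with (Rabs (c n) * (pnorm (G n) * Rabs (x - y))) by ring.
    apply Rmult_le_compat_l; [apply Rabs_pos|].
    now apply (Lip (fun n => evd (evd (G n)))).
  - rewrite Series_scal_l, Rmult_comm; apply Rmult_le_compat_r; [apply Rabs_pos | exact HS]. }
split; [|split; [|split; [|split]]].
- split; [|split; [|exists (2 * S); exact hold]].
  + apply (series_deriv_on c (fun n => pnorm (G n)) (fun n => ev (G n)) (fun n => ev (evd (G n)))); auto.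
    intros; apply is_derive_ev.
    exact (Lip (fun n => evd (G n)) K2).
  + apply (series_deriv_on c (fun n => pnorm (G n)) (fun n => ev (evd (G n))) (fun n => ev (evd (evd (G n))))); auto.
    intros; apply is_derive_ev.
    exact (Lip (fun n => evd (evd (G n))) K3).
- now apply bd.
- now apply bd.
- now apply bd.
- exact hold.
Qed.

Lemma c2g_norm_lt_ext f g eps : (forall t, inI t -> f t = g t) ->
  c2g_norm_lt gam f eps -> c2g_norm_lt gam g eps.
Proof.
intros E [f1 [f2 [[H1 [H2 H3]] [a [b [c [d [Hs [Ha [Hb [Hc Hd]]]]]]]]]]].
exists f1, f2; split.
- split; [|split; assumption].
  now apply (deriv_on_ext f f1 g f1).
- exists a, b, c, d; split; [exact Hs|]; split; [|auto].
  intros t ht; rewrite <- E; auto.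
Qed.

(** The factor 5 adds three sup norms and the Hoelder constant [2 * S]. *)
Lemma psum_norm_lt c G eps : 0 < eps -> ex_series (fun n => Rabs (c n) * pnorm (G n)) ->
  5 * Series (fun n => Rabs (c n) * pnorm (G n)) < eps -> c2g_norm_lt gam (psum c G) eps.
Proof.
intros he Hc HS; destruct (psum_C2g c G _ Hc (Rle_refl _)) as [H1 [H2 [H3 [H4 H5]]]].
set (S := Series (fun n => Rabs (c n) * pnorm (G n))) in *.
do 2 eexists; split; [exact H1|].
exists S, S, S, (2 * S); split; [lra | auto].
Qed.

(** The bound is asked at every radius below [del] rather than at [del]: this form is stable under
    differentiation in [s], which costs a factor [n]. *)
Definition geom_bounded (del : R) (G : nat -> rpoly) : Prop :=
  forall rho, 0 < rho < del -> exists A, forall n, pnorm (G n) * rho ^ n <= A.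

(** Shrinking the radius pays for a factor [n + 1]: with [x = rho / rho'], [(n + 1) x^n <= 1 + x +
    ... + x^n <= 1 / (1 - x)]. *)
Lemma geom_bump (a : nat -> R) A rho rho' : (forall n, 0 <= a n) -> 0 < rho -> rho < rho' ->
  (forall n, a n * rho' ^ n <= A) -> exists A', forall n, INR (S n) * (a n * rho ^ n) <= A'.
Proof.
intros a0 h0 h1 H; set (x := rho / rho').
assert (hx : 0 < x < 1).
{ unfold x; split; [apply Rdiv_lt_0_compat; lra|].
  apply Rmult_lt_reg_r with rho'; [lra|]; unfold Rdiv; rewrite Rmult_assoc, Rinv_l; lra. }
assert (B : forall n, INR (S n) * x ^ n <= / (1 - x)).
{ intros n; assert (K : (1 - x) * (INR (S n) * x ^ n) <= 1 - x ^ S n).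
  { induction n as [|n IH]; [simpl; lra|].
    assert (p : 0 < x ^ S n) by (apply pow_lt; lra).
    assert (p' : 0 < x ^ n) by (apply pow_lt; lra).
    assert (p1 : x ^ S n <= 1) by (rewrite <- (pow1 (S n)); apply pow_incr; lra).
    rewrite (S_INR (S n)).
    assert (IH' : x * ((1 - x) * (INR (S n) * x ^ n)) <= x * (1 - x ^ S n)) by (apply Rmult_le_compat_l; lra).
    assert (0 <= (1 - x) * (1 - x ^ S n)) by (apply Rmult_le_pos; lra).
    simpl pow in *; lra. }
  assert (0 < x ^ S n) by (apply pow_lt; lra).
  apply Rmult_le_reg_l with (1 - x); [lra|]; rewrite Rinv_r by lra; lra. }
exists (A * / (1 - x)); intros n.
assert (E : rho ^ n = rho' ^ n * x ^ n).
{ rewrite <- Rpow_mult_distr; f_equal; unfold x; field; lra. }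
rewrite E; replace (INR (S n) * (a n * (rho' ^ n * x ^ n))) with ((a n * rho' ^ n) * (INR (S n) * x ^ n)) by ring.
assert (0 < x ^ n) by (apply pow_lt; lra); assert (0 <= INR (S n)) by apply pos_INR.
assert (0 < rho' ^ n) by (apply pow_lt; lra).
apply Rmult_le_compat; [apply Rmult_le_pos; [apply a0 | lra] | apply Rmult_le_pos; lra | apply H | apply B].
Qed.

Lemma geom_bounded_shiftd del G : geom_bounded del G -> geom_bounded del (shiftd G).
Proof.
intros H rho hr; destruct (H ((rho + del) / 2)) as [A HA]; [lra|].
destruct (geom_bump (fun n => pnorm (G n)) A rho ((rho + del) / 2)) as [A' HA'];
  [intros; apply pnorm_ge0 | lra | lra | exact HA |].
exists (A' / rho); intros n; rewrite pnorm_shiftd.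
apply Rmult_le_reg_r with rho; [lra|].
replace (A' / rho * rho) with A' by (field; lra).
specialize (HA' (S n)); simpl pow in HA'.
eapply Rle_trans; [|exact HA'].
replace (INR (S n) * pnorm (G (S n)) * rho ^ n * rho) with (INR (S n) * (pnorm (G (S n)) * (rho * rho ^ n))) by ring.
apply Rmult_le_compat_r; [|rewrite (S_INR (S n)); lra].
apply Rmult_le_pos; [apply pnorm_ge0|]; apply Rmult_le_pos; [lra | apply pow_le; lra].
Qed.

Lemma ex_series_bounded (a : nat -> R) A rho rho' : (forall n, 0 <= a n) -> 0 <= rho -> rho < rho' ->
  (forall n, a n * rho' ^ n <= A) -> ex_series (fun n => a n * rho ^ n).
Proof.
intros a0 h0 h1 H; set (x := rho / rho').
assert (hx : 0 <= x < 1).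
{ unfold x; split; [apply Rdiv_le_0_compat; lra|].
  apply Rmult_lt_reg_r with rho'; [lra|]; unfold Rdiv; rewrite Rmult_assoc, Rinv_l; lra. }
apply (ex_series_dom _ (fun n => A * x ^ n)).
- intros n; assert (E : rho ^ n = rho' ^ n * x ^ n).
  { rewrite <- Rpow_mult_distr; f_equal; unfold x; field; lra. }
  rewrite Rabs_pos_eq by (apply Rmult_le_pos; [apply a0 | apply pow_le; lra]).
  rewrite E, <- Rmult_assoc; apply Rmult_le_compat_r; [apply pow_le; lra | apply H].
- apply (ex_series_scal_l (V := R_NormedModule) A); apply ex_series_geom; rewrite Rabs_pos_eq; lra.
Qed.

Lemma geom_bounded_ex_series del G s : geom_bounded del G -> Rabs s < del -> ex_series (fun n => Rabs (s ^ n) * pnorm (G n)).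
Proof.
intros H hs; assert (0 <= Rabs s) by apply Rabs_pos.
destruct (H ((Rabs s + del) / 2)) as [A HA]; [lra|].
apply (ex_series_ext (fun n => pnorm (G n) * Rabs s ^ n)).
intros n; rewrite RPow_abs; apply Rmult_comm.
apply (ex_series_bounded _ A (Rabs s) ((Rabs s + del) / 2)); [intros; apply pnorm_ge0 | lra | lra | exact HA].
Qed.

Definition ppath (G : nat -> rpoly) (s t : R) : R := psum (fun n => s ^ n) G t.

(** The second-order remainder of [s^n], by induction through multiplication by [s + h]. The factor
    [r ^ 2] on the left avoids the exponent [n - 2]. *)
Lemma diffquot_bound s h r n : 0 <= r -> Rabs s <= r -> Rabs (s + h) <= r ->
  r ^ 2 * Rabs ((s + h) ^ n - s ^ n - h * (INR n * s ^ pred n)) <= h ^ 2 * INR n ^ 2 * r ^ n.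
Proof.
intros r0 hs hsh; induction n as [|n IH].
- simpl; rewrite Rmult_0_l, Rmult_0_r, !Rminus_diag, Rabs_R0; lra.
- assert (E : (s + h) ^ S n - s ^ S n - h * (INR (S n) * s ^ pred (S n)) =
    (s + h) * ((s + h) ^ n - s ^ n - h * (INR n * s ^ pred n)) + INR n * h ^ 2 * s ^ pred n).
  { rewrite S_INR; destruct n as [|n]; simpl; ring. }
  rewrite E.
  apply Rle_trans with (r * (h ^ 2 * INR n ^ 2 * r ^ n) + INR n * h ^ 2 * r ^ S n).
  + eapply Rle_trans; [apply Rmult_le_compat_l; [apply pow2_ge_0 | apply Rabs_triang]|].
    rewrite Rmult_plus_distr_l; apply Rplus_le_compat.
    * rewrite Rabs_mult.
      replace (r ^ 2 * (Rabs (s + h) * Rabs ((s + h) ^ n - s ^ n - h * (INR n * s ^ pred n))))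
        with (Rabs (s + h) * (r ^ 2 * Rabs ((s + h) ^ n - s ^ n - h * (INR n * s ^ pred n)))) by ring.
      apply Rmult_le_compat; [apply Rabs_pos | | exact hsh | exact IH].
      apply Rmult_le_pos; [apply pow2_ge_0 | apply Rabs_pos].
    * rewrite !Rabs_mult, (Rabs_pos_eq (INR n)), (Rabs_pos_eq (h ^ 2)) by (apply pos_INR || apply pow2_ge_0).
      rewrite <- RPow_abs.
      destruct n as [|n]; [simpl; lra|]; simpl pred.
      assert (Rabs s ^ n <= r ^ n) by (apply pow_incr; split; [apply Rabs_pos | exact hs]).
      replace (INR (S n) * h ^ 2 * r ^ S (S n)) with (r ^ 2 * (INR (S n) * h ^ 2 * r ^ n)) by (simpl; ring).
      apply Rmult_le_compat_l; [apply pow2_ge_0|]; apply Rmult_le_compat_l; [|assumption].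
      apply Rmult_le_pos; [apply pos_INR | apply pow2_ge_0].
  + rewrite S_INR; assert (0 <= INR n) by apply pos_INR; assert (0 <= r ^ S n) by now apply pow_le.
    assert (0 <= h ^ 2) by apply pow2_ge_0.
    replace (r * (h ^ 2 * INR n ^ 2 * r ^ n)) with (h ^ 2 * INR n ^ 2 * r ^ S n) by (simpl; ring).
    assert (0 <= h ^ 2 * r ^ S n * (INR n + 1)) by (apply Rmult_le_pos; [now apply Rmult_le_pos | lra]).
    lra.
Qed.

Lemma ppath_summable del G s t : geom_bounded del G -> Rabs s < del -> inI t -> ex_series (fun n => s ^ n * ev (G n) t).
Proof.
intros HG hs ht; apply (ex_series_dom _ (fun n => Rabs (s ^ n) * pnorm (G n))).
- intros n; rewrite Rabs_mult; apply Rmult_le_compat_l; [apply Rabs_pos | apply (ev_pnorm (G n) t ht)].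
- now apply geom_bounded_ex_series with del.
Qed.

Lemma ppath_deriv del G : geom_bounded del G -> path_deriv gam del (ppath G) (ppath (shiftd G)).
Proof.
intros HG s hs eps he.
assert (hs' : Rabs s < del) by (apply Rabs_def1; lra).
assert (s0 : 0 <= Rabs s) by apply Rabs_pos.
(* [r] leaves room for [s + h]; the passages from [r3] to [r2] and to [r1] each pay for one factor
   [n], and the one to [r] gives summability. *)
set (r := (Rabs s + del) / 2); set (r1 := (r + del) / 2); set (r2 := (r1 + del) / 2); set (r3 := (r2 + del) / 2).
assert (hr : Rabs s < r /\ r < r1 /\ r1 < r2 /\ r2 < r3 /\ r3 < del /\ 0 < r).
{ unfold r3, r2, r1, r; repeat split; lra. }
destruct (HG r3 ltac:(lra)) as [A HA].
destruct (geom_bump (fun n => pnorm (G n)) A r2 r3) as [A2 HA2];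
  [intros; apply pnorm_ge0 | lra | lra | exact HA |].
destruct (geom_bump (fun n => INR (S n) * pnorm (G n)) A2 r1 r2) as [A1 HA1];
  [intros; apply Rmult_le_pos; [apply pos_INR | apply pnorm_ge0] | lra | lra | intros n; rewrite Rmult_assoc; apply HA2 |].
assert (X : ex_series (fun n => (INR n ^ 2 * pnorm (G n)) * r ^ n)).
{ apply (ex_series_bounded _ A1 r r1); [intros; apply Rmult_le_pos; [apply pow2_ge_0 | apply pnorm_ge0] | lra | lra |].
  intros n; eapply Rle_trans; [|apply HA1]; rewrite <- !Rmult_assoc.
  apply Rmult_le_compat_r; [apply pow_le; lra|]; apply Rmult_le_compat_r; [apply pnorm_ge0|].
  rewrite S_INR; assert (0 <= INR n) by apply pos_INR; nra. }
set (T := Series (fun n => (INR n ^ 2 * pnorm (G n)) * r ^ n)).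
assert (T0 : 0 <= T).
{ apply Series_ge0; [|exact X]; intros n; apply Rmult_le_pos; [apply Rmult_le_pos; [apply pow2_ge_0 | apply pnorm_ge0] | apply pow_le; lra]. }
assert (r20 : 0 < r ^ 2) by (apply pow_lt; lra).
exists (Rmin (r - Rabs s) (eps * r ^ 2 / (5 * T + 1))); split.
{ apply Rmin_case; [lra|]; apply Rdiv_lt_0_compat; [apply Rmult_lt_0_compat; lra | lra]. }
intros h [hh1 hh2] hsh.
generalize (Rmin_l (r - Rabs s) (eps * r ^ 2 / (5 * T + 1))) (Rmin_r (r - Rabs s) (eps * r ^ 2 / (5 * T + 1))); intros m1 m2.
assert (hn : h <> 0) by (intros Z; rewrite Z, Rabs_R0 in hh1; lra).
assert (hsh' : Rabs (s + h) <= r) by (eapply Rle_trans; [apply Rabs_triang | lra]).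
set (c := fun n => ((s + h) ^ n - s ^ n - h * (INR n * s ^ pred n)) / h).
assert (cb : forall n, Rabs (c n) * pnorm (G n) <= (Rabs h / r ^ 2) * ((INR n ^ 2 * pnorm (G n)) * r ^ n)).
{ intros n; assert (D := diffquot_bound s h r n ltac:(lra) ltac:(lra) hsh').
  unfold c, Rdiv; rewrite Rabs_mult, Rabs_inv.
  replace (Rabs h * / r ^ 2 * (INR n ^ 2 * pnorm (G n) * r ^ n)) with ((Rabs h * / r ^ 2 * INR n ^ 2 * r ^ n) * pnorm (G n)) by ring.
  apply Rmult_le_compat_r; [apply pnorm_ge0|].
  apply Rmult_le_reg_r with (Rabs h); [lra|]; rewrite Rmult_assoc, Rinv_l, Rmult_1_r by lra.
  apply Rmult_le_reg_l with (r ^ 2); [exact r20|].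
  replace (r ^ 2 * (Rabs h * / r ^ 2 * INR n ^ 2 * r ^ n * Rabs h)) with (Rabs h ^ 2 * INR n ^ 2 * r ^ n) by (field; lra).
  rewrite pow2_abs; exact D. }
assert (cs : ex_series (fun n => Rabs (c n) * pnorm (G n))).
{ apply (ex_series_dom _ (fun n => (Rabs h / r ^ 2) * ((INR n ^ 2 * pnorm (G n)) * r ^ n))).
  - intros n; rewrite Rabs_pos_eq; [apply cb | apply Rmult_le_pos; [apply Rabs_pos | apply pnorm_ge0]].
  - now apply (ex_series_scal_l (V := R_NormedModule)). }
apply (c2g_norm_lt_ext (psum c G)).
- intros t ht; unfold ppath, psum.
  assert (E1 := ppath_summable del G s t HG hs' ht).
  assert (E2 := ppath_summable del G (s + h) t HG ltac:(apply Rabs_def1; lra) ht).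
  assert (E3 := ppath_summable del (shiftd G) s t (geom_bounded_shiftd del G HG) hs' ht).
  assert (E4 : Series (fun n => INR n * s ^ pred n * ev (G n) t) = Series (fun n => s ^ n * ev (shiftd G n) t)).
  { rewrite Series_incr_1_aux by (simpl; ring); apply Series_ext; intros n; rewrite ev_shiftd; simpl pred; ring. }
  assert (E5 : ex_series (fun n => INR n * s ^ pred n * ev (G n) t)).
  { assert (EE : forall n, s ^ n * ev (shiftd G n) t = INR (S n) * s ^ pred (S n) * ev (G (S n)) t).
    { intros n; rewrite ev_shiftd; simpl pred; ring. }
    apply ex_series_incr_1; exact (ex_series_ext _ _ EE E3). }
  rewrite <- E4.
  replace ((Series (fun n => (s + h) ^ n * ev (G n) t) - Series (fun n => s ^ n * ev (G n) t)) / h - Series (fun n => INR n * s ^ pred n * ev (G n) t))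
   with (/ h * (1 * Series (fun n => (s + h) ^ n * ev (G n) t) + -1 * Series (fun n => s ^ n * ev (G n) t)) + -1 * Series (fun n => INR n * s ^ pred n * ev (G n) t))
   by (field; exact hn).
  rewrite <- (Series_lin 1 (-1)) by assumption.
  rewrite <- Series_lin; [|apply (ex_series_plus (V := R_NormedModule) (fun n => 1 * ((s + h) ^ n * ev (G n) t)) (fun n => -1 * (s ^ n * ev (G n) t)));
     now apply (ex_series_scal_l (V := R_NormedModule)) | exact E5].
  apply Series_ext; intros n; unfold c; field; exact hn.
- apply psum_norm_lt; [exact he | exact cs |].
  apply Rle_lt_trans with (5 * (Rabs h / r ^ 2 * T)).
  + apply Rmult_le_compat_l; [lra|]; unfold T; rewrite <- Series_scal_l; apply Series_le.
    * intros n; split; [apply Rmult_le_pos; [apply Rabs_pos | apply pnorm_ge0] | apply cb].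
    * now apply (ex_series_scal_l (V := R_NormedModule)).
  + apply Rmult_lt_reg_r with (r ^ 2); [exact r20|].
    replace (5 * (Rabs h / r ^ 2 * T) * r ^ 2) with (Rabs h * (5 * T)) by (field; lra).
    apply Rle_lt_trans with (Rabs h * (5 * T + 1)); [apply Rmult_le_compat_l; lra|].
    apply Rmult_lt_reg_r with (/ (5 * T + 1)); [apply Rinv_0_lt_compat; lra|].
    rewrite Rmult_assoc, Rinv_r, Rmult_1_r by lra; unfold Rdiv in m2; lra.
Qed.

Lemma ppath_Cn del G n : geom_bounded del G -> path_Cn gam del n (ppath G).
Proof.
revert G; induction n as [|n IH]; intros G HG; split.
1, 3: intros s hs; do 2 eexists; eapply psum_C2g; [|apply Rle_refl];
  apply geom_bounded_ex_series with del; [exact HG | apply Rabs_def1; lra].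
- trivial.
- exists (ppath (shiftd G)); split; [now apply ppath_deriv | now apply IH, geom_bounded_shiftd].
Qed.
End PSum.

(** * Uniqueness of the branch *)

Section Unique.
Variables alpha beta q gam : R.
Hypotheses (halpha : -1 < alpha) (hbeta : -1 < beta) (hq : 1 < q) (hgam : 0 < gam < 1).
Let J := Jint alpha beta.
Variables (K kap lk : R) (p p1 p2 : R -> R).
Hypothesis kap0 : 0 < kap.
Hypothesis lk0 : 0 < lk.
Hypothesis lambda_k_eigval : lk * (q - 1) = K.
Hypothesis Cp : C2adm p p1 p2.
Hypothesis lip_p : lip p.
Hypothesis Ep : forall t, -1 < t < 1 -> DI alpha beta p1 p2 t = - K * p t.
Let h := J (fun t => p t ^ 2).
Hypothesis h0 : 0 < h.
Hypothesis resolvent : forall d d1 d2, C2adm d d1 d2 -> lip d -> J (fun t => d t * p t) = 0 ->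
  kap ^ 2 * J (fun t => d t ^ 2) <= J (fun t => (DI alpha beta d1 d2 t + K * d t) ^ 2).

(** [e2] measures the deviation of [nonlin q] from its linear part, [eta] that of [mu] from [lk].
    With the constant 18 each contributes [kap / 18], together the [kap / 9] of [nonlin_est]. The
    bound [e2 <= (q - 1) / 4] keeps the component of the nonlinearity along [p] comparable with that
    of its linear part. *)
Variables (e2 eta del : R).
Hypothesis he2 : 0 < e2 /\ e2 <= (q - 1) / 4 /\ e2 * (18 * (lk + 1)) <= kap.
Hypothesis heta : 0 < eta /\ eta <= 1 /\ eta * (18 * (q - 1)) <= kap.
Hypothesis hF : forall v w, Rabs v <= del -> Rabs w <= del ->
  Rabs (nonlin q v - nonlin q w - (q - 1) * (v - w)) <= e2 * Rabs (v - w).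
Hypothesis del0 : 0 <= del < 1.

Definition branch_data (v v1 v2 : R -> R) (mu s : R) : Prop :=
  C2adm v v1 v2 /\ lip v /\ (forall t, -1 < t < 1 -> DI alpha beta v1 v2 t = - mu * nonlin q (v t)) /\
  (forall t, -1 < t < 1 -> Rabs (v t) <= del) /\ Rabs (mu - lk) <= eta /\
  J (fun t => v t * p t) = s * h.

Lemma lip_lin c d f g : lip f -> lip g -> lip (fun t => c * f t + d * g t).
Proof.
intros [M [M0 HM]] [N [N0 HN]]; exists (Rabs c * M + Rabs d * N); split.
- generalize (Rabs_pos c) (Rabs_pos d); intros; nra.
- intros x y hx hy; specialize (HM x y hx hy); specialize (HN x y hx hy).
  replace (c * f x + d * g x - (c * f y + d * g y)) with (c * (f x - f y) + d * (g x - g y)) by ring.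
  eapply Rle_trans; [apply Rabs_triang|]; rewrite !Rabs_mult.
  generalize (Rabs_pos c) (Rabs_pos d); intros; nra.
Qed.

Lemma C2adm_lin c d f f1 f2 g g1 g2 : C2adm f f1 f2 -> C2adm g g1 g2 ->
  C2adm (fun t => c * f t + d * g t) (fun t => c * f1 t + d * g1 t) (fun t => c * f2 t + d * g2 t).
Proof.
intros [A1 [A2 [A3 [A4 A5]]]] [B1 [B2 [B3 [B4 B5]]]].
assert (D : forall f f' g g' t, is_derive f t f' -> is_derive g t g' ->
  is_derive (fun t => c * f t + d * g t) t (c * f' + d * g')).
{ intros u u' w w' t Hu Hw; apply (is_derive_plus (fun t => c * u t) (fun t => d * w t));
  now apply is_derive_scal. }
split; [intros; apply D; auto|]; split; [intros; apply D; auto|].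
auto 10 using adm_plus, adm_scal.
Qed.

Lemma DI_lin c d f1 f2 g1 g2 t :
  DI alpha beta (fun t => c * f1 t + d * g1 t) (fun t => c * f2 t + d * g2 t) t =
  c * DI alpha beta f1 f2 t + d * DI alpha beta g1 g2 t.
Proof. unfold DI; ring. Qed.

Lemma nonlin_est v w mu : Rabs v <= del -> Rabs w <= del -> Rabs (mu - lk) <= eta ->
  Rabs (mu * (nonlin q v - nonlin q w) - K * (v - w)) <= kap / 9 * Rabs (v - w).
Proof.
intros hv hw hm; specialize (hF v w hv hw).
replace (mu * (nonlin q v - nonlin q w) - K * (v - w)) with
  ((mu - lk) * (q - 1) * (v - w) + mu * (nonlin q v - nonlin q w - (q - 1) * (v - w))) by (rewrite <- lambda_k_eigval; ring).
eapply Rle_trans; [apply Rabs_triang|]; rewrite !Rabs_mult, (Rabs_pos_eq (q - 1)) by lra.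
assert (M : Rabs mu <= lk + 1).
{ replace mu with (lk + (mu - lk)) by ring; eapply Rle_trans; [apply Rabs_triang|].
  rewrite (Rabs_pos_eq lk); lra. }
set (z := Rabs (v - w)) in *; assert (0 <= z) by apply Rabs_pos.
assert (Rabs (mu - lk) * (q - 1) * z <= eta * (q - 1) * z).
{ apply Rmult_le_compat_r; [assumption|]; apply Rmult_le_compat_r; lra. }
assert (Rabs mu * Rabs (nonlin q v - nonlin q w - (q - 1) * (v - w)) <= (lk + 1) * (e2 * z)).
{ apply Rmult_le_compat; auto using Rabs_pos. }
assert (0 <= (kap - eta * (18 * (q - 1))) * z) by (apply Rmult_le_pos; lra).
assert (0 <= (kap - e2 * (18 * (lk + 1))) * z) by (apply Rmult_le_pos; lra).
lra.
Qed.

Lemma Jsq_ge0 f : adm f -> 0 <= J (fun t => f t ^ 2).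
Proof.
intros Hf; apply (Jint_ge0 _ _ halpha hbeta); [now apply adm_sq | intros; apply pow2_ge_0].
Qed.

Lemma Jsq_le f g c : adm f -> adm g -> 0 <= c -> (forall t, -1 < t < 1 -> Rabs (f t) <= c * Rabs (g t)) ->
  J (fun t => f t ^ 2) <= c ^ 2 * J (fun t => g t ^ 2).
Proof.
intros Hf Hg Hc H; unfold J; rewrite <- (Jint_scal _ _ halpha hbeta) by now apply adm_sq.
apply (Jint_le _ _ halpha hbeta); [now apply adm_sq | apply adm_scal; now apply adm_sq |].
intros t ht; rewrite <- (pow2_abs (f t)), <- (pow2_abs (g t)), <- Rpow_mult_distr.
apply pow_incr; split; [apply Rabs_pos | now apply H].
Qed.

(** For [d = v - s p], orthogonal to [p], [(D + K) d = - (mu nonlin q v - K v)] is at most [kap / 9]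
    times [|v|]; in squared norms [81 |d|^2 <= |v|^2 = |d|^2 + s^2 h]. For [s = 0] this forces
    [v = 0]. *)
Lemma branch_norm v v1 v2 mu s : branch_data v v1 v2 mu s ->
  J (fun t => v t ^ 2) <= 2 * (s ^ 2 * h).
Proof.
intros [HC [HL [HE [Hd [Hm Hs]]]]].
assert (Av : adm v) by apply HC; assert (Ap : adm p) by apply Cp.
set (d := fun t => 1 * v t + - s * p t).
assert (Cd := C2adm_lin 1 (- s) _ _ _ _ _ _ HC Cp); fold d in Cd.
assert (Ad : adm d) by apply Cd.
assert (Od : J (fun t => d t * p t) = 0).
{ transitivity (J (fun t => 1 * (v t * p t) + - s * (p t ^ 2))).
  - apply (Jint_ext _ _ halpha hbeta); [now apply adm_mult | intros; unfold d; ring].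
  - unfold J; rewrite Jint_lin by (assumption || (now apply adm_mult) || (now apply adm_sq)).
    fold J; fold h; rewrite Hs; ring. }
assert (R := resolvent d _ _ Cd (lip_lin 1 (- s) v p HL lip_p) Od).
assert (B : J (fun t => (DI alpha beta (fun t => 1 * v1 t + - s * p1 t) (fun t => 1 * v2 t + - s * p2 t) t + K * d t) ^ 2)
   <= (kap / 9) ^ 2 * J (fun t => v t ^ 2)).
{ apply (Jsq_le (fun t => DI alpha beta (fun t => 1 * v1 t + - s * p1 t) (fun t => 1 * v2 t + - s * p2 t) t + K * d t)).
  - apply adm_plus; [apply adm_DI; apply Cd | now apply adm_scal].
  - exact Av.
  - lra.
  - intros t ht; rewrite DI_lin, (HE t ht), (Ep t ht); unfold d.
    assert (N := nonlin_est (v t) 0 mu (Hd t ht) ltac:(rewrite Rabs_R0; lra) Hm).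
    rewrite nonlin_0, !Rminus_0_r in N.
    replace (1 * (- mu * nonlin q (v t)) + - s * (- K * p t) + K * (1 * v t + - s * p t))
      with (- (mu * nonlin q (v t) - K * v t)) by ring.
    rewrite Rabs_Ropp; exact N. }
assert (P : J (fun t => v t ^ 2) = J (fun t => d t ^ 2) + s ^ 2 * h).
{ transitivity (J (fun t => 1 * (1 * d t ^ 2 + (2 * s) * (d t * p t)) + s ^ 2 * (p t ^ 2))).
  - apply (Jint_ext _ _ halpha hbeta); [now apply adm_sq | intros; unfold d; ring].
  - unfold J; rewrite !Jint_lin; fold J; try assumption; try (now apply adm_sq); try (now apply adm_mult).
    rewrite Od; fold h; ring.
    apply adm_plus; apply adm_scal; [now apply adm_sq | now apply adm_mult]. }
assert (D0 := Jsq_ge0 d Ad); assert (V0 := Jsq_ge0 v Av).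
set (D := J (fun t => d t ^ 2)) in *; set (W := J (fun t => v t ^ 2)) in *.
assert (k2 : 0 < kap ^ 2) by (apply pow_lt; exact kap0).
assert (81 * D <= W).
{ apply Rmult_le_reg_l with (kap ^ 2 / 81); [lra|].
  replace (kap ^ 2 / 81 * (81 * D)) with (kap ^ 2 * D) by field.
  replace (kap ^ 2 / 81 * W) with ((kap / 9) ^ 2 * W) by field.
  lra. }
assert (0 <= s ^ 2 * h) by (apply Rmult_le_pos; [apply pow2_ge_0 | lra]).
lra.
Qed.

(** For a given component [s] along [p], the difference [d = v - w] is orthogonal to [p]
    and so is controlled by the resolvent; the component along [p] of the equation then
    controls [s (mu - nu)]. *)
Lemma branch_unique v v1 v2 w w1 w2 mu nu s :
  branch_data v v1 v2 mu s -> branch_data w w1 w2 nu s ->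
  (forall t, -1 < t < 1 -> v t = w t) /\ (s = 0 \/ mu = nu).
Proof.
intros Hv Hw.
assert (Nv := branch_norm _ _ _ _ _ Hv).
destruct Hv as [HC [HL [HE [Hd [Hm Hs]]]]]; destruct Hw as [HC' [HL' [HE' [Hd' [Hm' Hs']]]]].
assert (Av : adm v) by apply HC; assert (Aw : adm w) by apply HC'; assert (Ap : adm p) by apply Cp.
set (d := fun t => 1 * v t + -1 * w t).
set (d1 := fun t => 1 * v1 t + -1 * w1 t); set (d2 := fun t => 1 * v2 t + -1 * w2 t).
assert (Cd : C2adm d d1 d2) by now apply C2adm_lin.
assert (Ad : adm d) by apply Cd.
assert (ADI : adm (DI alpha beta d1 d2)) by (apply adm_DI; apply Cd).
assert (Od : J (fun t => d t * p t) = 0).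
{ transitivity (J (fun t => 1 * (v t * p t) + -1 * (w t * p t))).
  - apply (Jint_ext _ _ halpha hbeta); [now apply adm_mult | intros; unfold d; ring].
  - unfold J; rewrite Jint_lin by (assumption || now apply adm_mult).
    fold J; rewrite Hs, Hs'; ring. }
set (f := fun t => nonlin q (v t)).
assert (Rd := resolvent d _ _ Cd (lip_lin 1 (-1) v w HL HL') Od).
(* [r] is what remains of [- (D + K) d] once the effect of [mu <> nu] is split off. It is at most
   [kap / 9] times [|d|], and its component along [p] is [- (mu - nu) * X], because [(D + K) d] is
   orthogonal to [p]. *)
set (r := fun t => - (DI alpha beta d1 d2 t + K * d t) + - (mu - nu) * f t).
assert (Er : forall t, -1 < t < 1 -> r t = nu * (nonlin q (v t) - nonlin q (w t)) - K * (v t - w t)).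
{ intros t ht; unfold r, d1, d2; rewrite DI_lin, (HE t ht), (HE' t ht); unfold f, d; ring. }
assert (F0 : forall t, -1 < t < 1 -> Rabs (f t - (q - 1) * v t) <= e2 * Rabs (v t)).
{ intros t ht; assert (N := hF (v t) 0 (Hd t ht) ltac:(rewrite Rabs_R0; lra)).
  rewrite nonlin_0, !Rminus_0_r in N; exact N. }
assert (Fb : forall t, -1 < t < 1 -> Rabs (f t) <= (2 * (q - 1)) * Rabs (v t)).
{ intros t ht; replace (f t) with ((q - 1) * v t + (f t - (q - 1) * v t)) by ring.
  eapply Rle_trans; [apply Rabs_triang|]; specialize (F0 t ht).
  rewrite Rabs_mult, (Rabs_pos_eq (q - 1)) by lra; generalize (Rabs_pos (v t)); intros; nra. }
assert (Af : adm f).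
{ split.
  - intros t ht; unfold f, nonlin.
    apply (continuous_comp v (fun y => Rpower (1 + y) q - (1 + y))); [now apply Av|].
    apply (continuous_minus (fun y => Rpower (1 + y) q) (fun y => 1 + y)).
    + eapply continuous_is_derive; apply is_derive_Rpower_p.
      specialize (Hd t ht); apply Rabs_le_between in Hd; lra.
    + apply (continuous_plus (fun _ => 1) (fun y => y)); [apply continuous_const | apply continuous_id].
  - destruct Av as [_ [M HM]]; exists (2 * (q - 1) * M); intros t ht.
    eapply Rle_trans; [now apply Fb|]; apply Rmult_le_compat_l; [lra | now apply HM]. }
assert (Ar : adm r).
{ apply (adm_ext (fun t => -1 * (DI alpha beta d1 d2 t + K * d t) + - (mu - nu) * f t)); [intros; unfold r; ring|].
  apply adm_plus; apply adm_scal; [apply adm_plus; [exact ADI | now apply adm_scal] | exact Af]. }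
set (D := J (fun t => d t ^ 2)) in *.
assert (D0 : 0 <= D) by now apply Jsq_ge0.
assert (Rr : J (fun t => r t ^ 2) <= (kap / 9) ^ 2 * D).
{ apply Jsq_le; [exact Ar | exact Ad | lra |].
  intros t ht; rewrite (Er t ht).
  replace (d t) with (v t - w t) by (unfold d; ring); apply nonlin_est; auto. }
assert (Ff : J (fun t => f t ^ 2) <= (2 * (q - 1)) ^ 2 * (2 * (s ^ 2 * h))).
{ eapply Rle_trans; [apply (Jsq_le f v (2 * (q - 1))); [exact Af | exact Av | lra | exact Fb]|].
  apply Rmult_le_compat_l; [apply pow2_ge_0 | exact Nv]. }
assert (R3 : kap ^ 2 * D <= 2 * J (fun t => r t ^ 2) + (2 * (mu - nu) ^ 2) * J (fun t => f t ^ 2)).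
{ eapply Rle_trans; [exact Rd|].
  unfold J; rewrite <- (Jint_lin _ _ halpha hbeta) by now apply adm_sq.
  apply (Jint_le _ _ halpha hbeta); [| apply adm_plus; apply adm_scal; now apply adm_sq |].
  - apply adm_sq; apply adm_plus; [exact ADI | now apply adm_scal].
  - intros t ht.
    replace (DI alpha beta d1 d2 t + K * d t) with (- r t + - (mu - nu) * f t) by (unfold r; ring).
    assert (0 <= (r t - (mu - nu) * f t) ^ 2) by apply pow2_ge_0; lra. }
set (X := J (fun t => f t * p t)).
assert (PX : J (fun t => r t * p t) = - (mu - nu) * X).
{ transitivity (J (fun t => -1 * (1 * (DI alpha beta d1 d2 t * p t) + K * (d t * p t)) + - (mu - nu) * (f t * p t))).
  - apply (Jint_ext _ _ halpha hbeta); [now apply adm_mult | intros; unfold r; ring].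
  - assert (A1 : adm (fun t => DI alpha beta d1 d2 t * p t)) by now apply adm_mult.
    assert (A2 : adm (fun t => d t * p t)) by now apply adm_mult.
    assert (A3 : adm (fun t => f t * p t)) by now apply adm_mult.
    unfold J; rewrite !Jint_lin; try assumption; [|apply adm_plus; now apply adm_scal].
    rewrite (Jint_sym _ _ halpha hbeta d d1 d2 p p1 p2 Cd Cp).
    rewrite (Jint_ext _ _ halpha hbeta _ (fun t => - K * (d t * p t))).
    + rewrite Jint_scal by assumption; fold J; rewrite Od; fold X; ring.
    + apply adm_mult; [exact Ad | apply adm_DI; apply Cp].
    + intros t ht; rewrite (Ep t ht); ring. }
assert (CS1 : (- (mu - nu) * X) ^ 2 <= J (fun t => r t ^ 2) * h).
{ rewrite <- PX; apply Jint_CS; assumption. }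
set (g := fun t => f t - (q - 1) * v t).
assert (Ag : adm g) by (apply adm_minus; [exact Af | now apply adm_scal]).
set (z := J (fun t => g t * p t)).
assert (EX : X = (q - 1) * (s * h) + z).
{ unfold X; transitivity (J (fun t => (q - 1) * (v t * p t) + 1 * (g t * p t))).
  - apply (Jint_ext _ _ halpha hbeta); [now apply adm_mult | intros; unfold g; ring].
  - unfold J; rewrite Jint_lin by (assumption || now apply adm_mult); fold J; rewrite Hs; unfold z; ring. }
assert (CS2 : z ^ 2 <= J (fun t => g t ^ 2) * h) by (apply Jint_CS; assumption).
assert (G2 : J (fun t => g t ^ 2) <= e2 ^ 2 * (2 * (s ^ 2 * h))).
{ eapply Rle_trans; [apply (Jsq_le g v e2); [exact Ag | exact Av | lra | exact F0]|].
  apply Rmult_le_compat_l; [apply pow2_ge_0 | exact Nv]. }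
(* [X = y + z] with [|z| <= |y| / 2], hence [|y| <= 2 |X|]: the component of the nonlinearity along
   [p] is of the order of [s]. *)
set (y := (q - 1) * (s * h)) in *.
assert (s2 : 0 <= s ^ 2 * h ^ 2) by (apply Rmult_le_pos; apply pow2_ge_0).
assert (Z4 : 4 * z ^ 2 <= y ^ 2).
{ assert (e2 ^ 2 <= ((q - 1) / 4) ^ 2) by (apply pow_incr; lra).
  assert (z ^ 2 <= e2 ^ 2 * (2 * (s ^ 2 * h)) * h).
  { eapply Rle_trans; [exact CS2|]; apply Rmult_le_compat_r; lra. }
  assert (e2 ^ 2 * (2 * (s ^ 2 * h)) * h <= ((q - 1) / 4) ^ 2 * (2 * (s ^ 2 * h ^ 2))).
  { replace (e2 ^ 2 * (2 * (s ^ 2 * h)) * h) with (e2 ^ 2 * (2 * (s ^ 2 * h ^ 2))) by ring.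
    apply Rmult_le_compat_r; lra. }
  assert (y ^ 2 = (q - 1) ^ 2 * (s ^ 2 * h ^ 2)) by (unfold y; ring).
  assert (0 <= (q - 1) ^ 2 * (s ^ 2 * h ^ 2)) by (apply Rmult_le_pos; [apply pow2_ge_0 | lra]).
  lra. }
assert (X4 : y ^ 2 <= 4 * X ^ 2).
{ rewrite EX; assert (0 <= (y + 4 * z) ^ 2) by apply pow2_ge_0.
  assert (0 <= (y + 2 * z) ^ 2) by apply pow2_ge_0; nra. }
assert (m2 : 0 <= (mu - nu) ^ 2) by apply pow2_ge_0.
assert (B1 : (mu - nu) ^ 2 * y ^ 2 <= 4 * ((kap / 9) ^ 2 * D * h)).
{ apply Rle_trans with ((mu - nu) ^ 2 * (4 * X ^ 2)); [now apply Rmult_le_compat_l|].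
  replace ((mu - nu) ^ 2 * (4 * X ^ 2)) with (4 * (- (mu - nu) * X) ^ 2) by ring.
  apply Rmult_le_compat_l; [lra|]; eapply Rle_trans; [exact CS1|]; apply Rmult_le_compat_r; lra. }
(* The factor [s ^ 2] stays inside [Q] instead of being divided out, so the case [s = 0] is covered
   by the same estimates. *)
set (Q := (mu - nu) ^ 2 * ((q - 1) ^ 2 * (s ^ 2 * h))).
assert (B2 : Q <= 4 * ((kap / 9) ^ 2 * D)).
{ apply Rmult_le_reg_r with h; [exact h0|].
  replace (Q * h) with ((mu - nu) ^ 2 * y ^ 2) by (unfold Q, y; ring); lra. }
assert (B3 : (2 * (mu - nu) ^ 2) * J (fun t => f t ^ 2) <= 16 * Q).
{ replace (16 * Q) with (2 * (mu - nu) ^ 2 * ((2 * (q - 1)) ^ 2 * (2 * (s ^ 2 * h)))) by (unfold Q; ring).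
  apply Rmult_le_compat_l; lra. }
assert (k2 : 0 < kap ^ 2) by (apply pow_lt; exact kap0).
(* The contributions add up to [2 + 64 = 66] times [(kap / 9) ^ 2 * D], and 66 is less than 81. *)
assert (DZ : D = 0).
{ assert (kap ^ 2 * D <= 2 * ((kap / 9) ^ 2 * D) + 64 * ((kap / 9) ^ 2 * D)) by lra.
  assert (kap ^ 2 * (15 * D) <= 0) by lra.
  assert (0 <= kap ^ 2 * D) by (apply Rmult_le_pos; lra).
  assert (kap ^ 2 * D = 0) by lra.
  apply Rmult_integral in H2; destruct H2; lra. }
split.
- intros t ht; assert (d t = 0) by (apply (Jint_sq_eq0 _ _ halpha hbeta d Ad DZ t ht)).
  unfold d in H; lra.
- destruct (Req_dec s 0) as [Z|Z]; [now left | right].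
  assert (Q <= 0) by (rewrite DZ in B2; lra).
  assert (0 < (q - 1) ^ 2 * (s ^ 2 * h)).
  { apply Rmult_lt_0_compat; [apply pow_lt; lra|]; apply Rmult_lt_0_compat; [now apply pow2_gt_0 | exact h0]. }
  unfold Q in H; assert ((mu - nu) ^ 2 = 0) by nra.
  apply Rminus_diag_uniq; apply Rsqr_0_uniq; rewrite Rsqr_pow2; exact H1.
Qed.
End Unique.

(** * Rodrigues' formula and the integral of the cube *)

Lemma rho_xvar a b f f1 t :
  (1 - t ^ 2) * (- / 2 * f1) + (b - a - (a + b + 2) * t) * f =
  -2 * ((xvar t - xvar t * xvar t) * f1 + (a + 1 - (a + b + 2) * xvar t) * f).
Proof. unfold xvar; field. Qed.

Section JacobiFacts.
Import all_boot all_order all_algebra Rstruct ring lra.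
Import Order.TTheory GRing.Theory Num.Theory.
Local Open Scope ring_scope.

Definition rhoR (a b : R) (P : rpoly) : rpoly := rho a b P.
Definition jacrR (a b : R) k : rpoly := jacr a b k.

Lemma ev_rho (a b : R) (P : {poly R}) t :
  Rplus (Rmult (Rminus (IZR 1) (pow t 2)) (ev (evd P) t))
    (Rmult (Rminus (Rminus b a) (Rmult (Rplus (Rplus a b) (IZR 2)) t)) (ev P t)) =
  Rmult (IZR (-2)) (ev (rhoR a b P) t).
Proof.
have -> : rhoR a b P = ('X - 'X * 'X) * P^`() + ((a + 1)%:P - (a + b + 2)%:P * 'X) * P.
  by rewrite /rhoR /rho expr2.
rewrite evD !evM !evB !evM !evC !evX -[2]/(IZR 2) /evd ?(evM, evC); exact: rho_xvar.
Qed.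

Lemma jacr_fun_S (a b : R) j : jacr_fun a b j.+1 = ev (rhoR a b (jacrR (Rplus a (IZR 1)) (Rplus b (IZR 1)) j)).
Proof. by []. Qed.

Lemma jacr_fun_0 (a b : R) t : jacr_fun a b 0 t = IZR 1.
Proof. by rewrite /jacr_fun /= -polyC1 evC. Qed.

Lemma jacr_fun_jacrR a b j : jacr_fun a b j = ev (jacrR a b j).
Proof. by []. Qed.

Lemma ev_jpoly a b k t : ev (jpoly a b k) t = Rmult (Rinv (INR (Factorial.fact k))) (jacr_fun a b k t).
Proof. by rewrite /jpoly evM evC. Qed.

Lemma ev_one t : ev (1 : {poly R}) t = IZR 1.
Proof. by rewrite -polyC1 evC. Qed.

Lemma Nat_evenE n : Nat.even n = ~~ odd n.
Proof.
suff H : Nat.even n = ~~ odd n /\ Nat.even n.+1 = odd n by case: H.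
by elim: n => [//|n [IH1 IH2]]; split; rewrite ?IH2 /= ?negbK.
Qed.

Lemma Nat_oddE n : Nat.odd n = odd n.
Proof. by rewrite /Nat.odd Nat_evenE negbK. Qed.

Lemma leq_of_le (k : nat) : le 1 k -> (1 <= k)%N.
Proof. by move=> /ssrnat.leP. Qed.

Section Cube.
Variables (a b : R) (k : nat).
Hypotheses (ha : Rlt (IZR (-1)) a) (hb : Rlt (IZR (-1)) b) (hk : le 1 k).
Hypothesis hs : Rlt (IZR 0) (Rplus (Rplus a b) (IZR 1)).

Let J P := Jint a b (ev P).

Lemma Jint_jpoly_cube : J (jpoly a b k * jpoly a b k * jpoly a b k) =
  Rmult (pow (Rinv (INR (Factorial.fact k))) 3) (J (jacr a b k * jacr a b k * jacr a b k)).
Proof.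
have e : jpoly a b k * jpoly a b k * jpoly a b k =
    ((Rinv (INR (Factorial.fact k))) ^+ 3)%:P * (jacr a b k * jacr a b k * jacr a b k).
  by rewrite /jpoly rmorphXn /=; ring.
by rewrite e /J (Jint_evZ a b ha hb) RpowE.
Qed.

Lemma invfact_pos : Rlt (IZR 0) (pow (Rinv (INR (Factorial.fact k))) 3).
Proof. apply: pow_lt; apply: Rinv_0_lt_compat; exact: INR_fact_lt_0. Qed.

Lemma jcube_gt0 : (Rgt a b \/ (a = b /\ Nat.even k = true)) ->
  Rlt (IZR 0) (J (jpoly a b k * jpoly a b k * jpoly a b k)).
Proof.
move=> H; rewrite Jint_jpoly_cube; apply: Rmult_lt_0_compat; first exact: invfact_pos.
have s0 : 0 < a + b + 1 by apply/RltP.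
apply/RltP; case: H => [/RltP ab | [ab ek]].
- have d0 : 0 < a - b by rewrite subr_gt0.
  exact: (moment_gt0 (ltr_m1 _ ha) (ltr_m1 _ hb) (Jint_evD a b ha hb) (Jint_evZ a b ha hb)
    (Jint_ev_sq_gt0 a b ha hb) (Jint_ev_Dop a b ha hb) (leq_of_le _ hk) s0 d0 (leqnn k)).
- have d0 : a - b = 0 by rewrite ab subrr.
  have := moment_parity (ltr_m1 _ ha) (ltr_m1 _ hb) (Jint_evD a b ha hb) (Jint_evZ a b ha hb)
    (Jint_ev_sq_gt0 a b ha hb) (Jint_ev_Dop a b ha hb) (leq_of_le _ hk) s0 d0 (leqnn k).
  by move: ek; rewrite Nat_evenE => /negbTE -> /RltP /RltP.
Qed.

Lemma jcube_eq0 : a = b -> Nat.odd k = true -> J (jpoly a b k * jpoly a b k * jpoly a b k) = IZR 0.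
Proof.
move=> ab; rewrite Nat_oddE => ok; rewrite Jint_jpoly_cube.
have s0 : 0 < a + b + 1 by apply/RltP.
have d0 : a - b = 0 by rewrite ab subrr.
have := moment_parity (ltr_m1 _ ha) (ltr_m1 _ hb) (Jint_evD a b ha hb) (Jint_evZ a b ha hb)
    (Jint_ev_sq_gt0 a b ha hb) (Jint_ev_Dop a b ha hb) (leq_of_le _ hk) s0 d0 (leqnn k).
by rewrite ok /J => ->; rewrite Rmult_0_r.
Qed.
End Cube.
End JacobiFacts.

(** In the variable [x], [1 - t^2 = 4 x (1 - x)] and [d/dt = - 1/2 d/dx], so the constant is
    [4 * (- 1/2) = -2]. *)
Lemma Derive_weight a b (P : rpoly) t : -1 < t < 1 ->
  is_derive (fun x => Rpower (1 - x) (a + 1) * Rpower (1 + x) (b + 1) * ev P x) t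
   (-2 * (Rpower (1 - t) a * Rpower (1 + t) b * ev (rhoR a b P) t)).
Proof.
intros ht.
assert (D1 := is_derive_Rpower_m (a + 1) t (proj2 ht)).
assert (D2 := is_derive_Rpower_p (b + 1) t (proj1 ht)).
replace (a + 1 - 1) with a in D1 by ring.
replace (b + 1 - 1) with b in D2 by ring.
assert (E1 : Rpower (1 - t) (a + 1) = Rpower (1 - t) a * (1 - t)) by (rewrite Rpower_plus, Rpower_1; lra).
assert (E2 : Rpower (1 + t) (b + 1) = Rpower (1 + t) b * (1 + t)) by (rewrite Rpower_plus, Rpower_1; lra).
evar_last.
apply (is_derive_mult (fun t => Rpower (1 - t) (a + 1) * Rpower (1 + t) (b + 1)) (ev P));
  [apply (is_derive_mult (fun t => Rpower (1 - t) (a + 1)) (fun t => Rpower (1 + t) (b + 1)));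
    [exact D1 | exact D2 | apply Rmult_comm] | apply is_derive_ev | apply Rmult_comm].
replace (-2 * (Rpower (1 - t) a * Rpower (1 + t) b * ev (rhoR a b P) t)) with
  (Rpower (1 - t) a * Rpower (1 + t) b * (-2 * ev (rhoR a b P) t)) by ring.
rewrite <- ev_rho.
unfold mult, plus; simpl; unfold mult, plus; simpl.
rewrite E1, E2; ring.
Qed.

(** The exponents [j + 1 + a] and [j + 1 + b] are read as [j + (a + 1)] and [j + (b + 1)], so the
    inner [j] derivatives are the case of raised parameters and the outermost one is
    [Derive_weight]. *)
Lemma rodrigues j a b t : -1 < t < 1 ->
  Derive_n (fun x => Rpower (1 - x) (INR j + a) * Rpower (1 + x) (INR j + b)) j t =
  (-2) ^ j * (Rpower (1 - t) a * Rpower (1 + t) b * jacr_fun a b j t).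
Proof.
revert a b t; induction j as [|j IH]; intros a b t ht.
- rewrite jacr_fun_0; simpl; rewrite !Rplus_0_l; ring.
- cbn [Derive_n].
  rewrite (Derive_ext_loc _ (fun x => (-2) ^ j * (Rpower (1 - x) (a + 1) * Rpower (1 + x) (b + 1) * jacr_fun (a + 1) (b + 1) j x))).
  + apply is_derive_unique; rewrite jacr_fun_S, jacr_fun_jacrR.
    replace ((-2) ^ S j * (Rpower (1 - t) a * Rpower (1 + t) b * ev (rhoR a b (jacrR (a + 1) (b + 1) j)) t)) with
      ((-2) ^ j * (-2 * (Rpower (1 - t) a * Rpower (1 + t) b * ev (rhoR a b (jacrR (a + 1) (b + 1) j)) t))) by (simpl; ring).
    apply is_derive_scal; now apply Derive_weight.
  + apply locally_interior; [exact ht|]; intros y hy.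
    rewrite <- (IH (a + 1) (b + 1) y hy); apply Derive_n_ext; intros x.
    f_equal; f_equal; rewrite S_INR; ring.
Qed.

Lemma jacobiP_ev a b k t : -1 < t < 1 -> jacobiP a b k t = ev (jpoly a b k) t.
Proof.
intros ht; unfold jacobiP; rewrite rodrigues, ev_jpoly by exact ht.
assert (F : INR (Factorial.fact k) <> 0) by apply INR_fact_neq_0.
assert (P1 : Rpower (1 - t) (- a) * Rpower (1 - t) a = 1).
{ rewrite <- Rpower_plus, Rplus_opp_l; unfold Rpower; rewrite Rmult_0_l; apply exp_0. }
assert (P2 : Rpower (1 + t) (- b) * Rpower (1 + t) b = 1).
{ rewrite <- Rpower_plus, Rplus_opp_l; unfold Rpower; rewrite Rmult_0_l; apply exp_0. }
assert (P3 : (-1) ^ k * (-2) ^ k = 2 ^ k) by (rewrite <- Rpow_mult_distr; f_equal; ring).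
assert (P4 : 2 ^ k <> 0) by (apply pow_nonzero; lra).
replace (Rpower (1 - t) (- a) * Rpower (1 + t) (- b) * ((-1) ^ k / (2 ^ k * INR (Factorial.fact k))) *
  ((-2) ^ k * (Rpower (1 - t) a * Rpower (1 + t) b * jacr_fun a b k t)))
 with ((Rpower (1 - t) (- a) * Rpower (1 - t) a) * (Rpower (1 + t) (- b) * Rpower (1 + t) b) *
   ((-1) ^ k * (-2) ^ k) / 2 ^ k * / INR (Factorial.fact k) * jacr_fun a b k t) by (field; split; assumption).
rewrite P1, P2, P3; field; split; assumption.
Qed.

Lemma CV_radius_gt (a : nat -> R) del s :
  (forall rho, 0 < rho < del -> exists A, forall n, Rabs (a n) * rho ^ n <= A) ->
  Rabs s < del -> Rbar_lt (Rabs s) (CV_radius a).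
Proof.
intros H hs; assert (0 <= Rabs s) by apply Rabs_pos.
destruct (H ((Rabs s + del) / 2)) as [A HA]; [lra|].
apply Rbar_lt_le_trans with ((Rabs s + del) / 2); [simpl; lra|].
apply CV_radius_bounded; exists A; intros n.
rewrite Rabs_mult, <- RPow_abs, (Rabs_pos_eq ((Rabs s + del) / 2)) by lra; apply HA.
Qed.

Section PowerOde.
Variables (q del : R) (a z : nat -> R).
Hypothesis Ha : forall rho, 0 < rho < del -> exists A, forall n, Rabs (a n) * rho ^ n <= A.
Hypothesis Hz : forall rho, 0 < rho < del -> exists A, forall n, Rabs (z n) * rho ^ n <= A.
Hypothesis a0 : a O = 1.
Hypothesis z0 : z O = 1.
Hypothesis E : forall n, PS_mult a (PS_derive z) n = q * PS_mult (PS_derive a) z n.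

(** [z a^(- q)] has zero derivative. *)
Lemma power_ode del' s : 0 < del' <= del -> (forall s, Rabs s < del' -> 0 < PSeries a s) -> Rabs s < del' ->
  PSeries z s = Rpower (PSeries a s) q.
Proof.
intros hd Hpos hs.
assert (Ra : forall s, Rabs s < del' -> Rbar_lt (Rabs s) (CV_radius a)) by (intros; apply CV_radius_gt with del; [exact Ha | lra]).
assert (Rz : forall s, Rabs s < del' -> Rbar_lt (Rabs s) (CV_radius z)) by (intros; apply CV_radius_gt with del; [exact Hz | lra]).
assert (ODE : forall s, Rabs s < del' -> PSeries a s * PSeries (PS_derive z) s = q * (PSeries (PS_derive a) s * PSeries z s)).
{ intros x hx; rewrite <- !PSeries_mult; try (rewrite ?CV_radius_derive; auto).
  rewrite <- PSeries_scal; apply PSeries_ext; intros n; rewrite E; reflexivity. }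
set (g := fun s => PSeries z s * Rpower (PSeries a s) (- q)).
assert (Dg : forall x, Rabs x < del' -> is_derive g x 0).
{ intros x hx; unfold g; evar_last.
  apply (is_derive_mult (PSeries z) (fun s => Rpower (PSeries a s) (- q)));
   [apply is_derive_PSeries; now apply Rz | | apply Rmult_comm].
  apply (is_derive_comp (fun y => Rpower y (- q)) (PSeries a)); [|apply is_derive_PSeries; now apply Ra].
  apply is_derive_Reals; apply derivable_pt_lim_power; now apply Hpos.
  specialize (ODE x hx); specialize (Hpos x hx).
  unfold plus, mult, scal; simpl; unfold mult; simpl.
  replace (Rpower (PSeries a x) (- q)) with (Rpower (PSeries a x) (- q - 1) * PSeries a x).
  2: { rewrite <- (Rpower_1 (PSeries a x)) at 2 by exact Hpos; rewrite <- Rpower_plus; f_equal; ring. }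
  transitivity (Rpower (PSeries a x) (- q - 1) * (PSeries a x * PSeries (PS_derive z) x - q * (PSeries (PS_derive a) x * PSeries z x))); [ring|].
  rewrite ODE; ring. }
assert (gs : g s = 1).
{ assert (g00 : g 0 = 1).
  { unfold g; rewrite !PSeries_0, a0, z0; unfold Rpower; rewrite ln_1, Rmult_0_r, exp_0; ring. }
  destruct (MVT_gen g 0 s (fun _ => 0)) as [c [_ Ec]].
  - intros x hx; apply Dg; apply Rabs_def2 in hs.
    unfold Rmin, Rmax in hx; destruct (Rle_dec 0 s); apply Rabs_def1; lra.
  - intros x hx; apply continuity_pt_filterlim; eapply continuous_is_derive; apply Dg; apply Rabs_def2 in hs.
    unfold Rmin, Rmax in hx; destruct (Rle_dec 0 s); apply Rabs_def1; lra.
  - lra. }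
unfold g in gs; specialize (Hpos s hs).
rewrite Rpower_Ropp in gs; assert (0 < Rpower (PSeries a s) q) by apply exp_pos.
apply Rmult_eq_reg_r with (/ Rpower (PSeries a s) q); [|apply Rinv_neq_0_compat; lra].
rewrite gs; field; lra.
Qed.
End PowerOde.

(** * The bifurcating branch *)

Section Restate.
Import all_boot all_order all_algebra Rstruct ring lra.
Import Order.TTheory GRing.Theory Num.Theory.
Local Open Scope ring_scope.

Definition jp (a b : R) (k : nat) : rpoly := jpoly a b k.

Lemma Jint_jp_sq a b k : Jint a b (ev (jpoly a b k * jpoly a b k)) = Jint a b (fun t => pow (ev (jp a b k) t) 2).
Proof.
by congr Jint; apply: functional_extensionality => t; rewrite evM /= Rmult_1_r.
Qed.

Lemma Jint_jp_cube a b k : Jint a b (ev (jpoly a b k * jpoly a b k * jpoly a b k)) =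
  Jint a b (fun t => pow (ev (jp a b k) t) 3).
Proof.
by congr Jint; apply: functional_extensionality => t; rewrite !evM /= Rmult_1_r Rmult_assoc.
Qed.

Lemma jp_eigen a b k t : DI a b (ev (evd (jp a b k))) (ev (evd (evd (jp a b k)))) t =
  Rmult (Ropp (eigval a b k)) (ev (jp a b k) t).
Proof. by rewrite -ev_Dop /jp /jpoly Dop_scaled_jacr !evM !evC Lam_eigval. Qed.

Lemma branch_series a b q k : Rlt (IZR (-1)) a -> Rlt (IZR (-1)) b -> Rlt (IZR 1) q -> le 1 k ->
  exists (G Z : nat -> rpoly) (l : nat -> R) (A Rr : R),
  ((forall t, ev (G 0%N) t = IZR 1) /\ (forall t, ev (Z 0%N) t = IZR 1) /\ (forall t, ev (G 1%N) t = ev (jp a b k) t) /\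
    l 0%N = lambda_k a b q k) /\
  (forall n t, PS_mult l (fun m => Rminus (ev (G m) t) (ev (Z m) t)) n = DI a b (ev (evd (G n))) (ev (evd (evd (G n)))) t) /\
  (forall n t, PS_mult (fun m => ev (G m) t) (PS_derive (fun m => ev (Z m) t)) n =
      Rmult q (PS_mult (PS_derive (fun m => ev (G m) t)) (fun m => ev (Z m) t) n)) /\
  (forall n, Jint a b (fun t => Rmult (ev (G n.+2) t) (ev (jp a b k) t)) = IZR 0) /\
  l 1%N = Rdiv (Rmult (Rmult (Ropp (lambda_k a b q k)) q) (Jint a b (fun t => pow (ev (jp a b k) t) 3)))
    (Rmult (IZR 2) (Jint a b (fun t => pow (ev (jp a b k) t) 2))) /\
  Rlt (IZR 0) Rr /\ forall n, Rle (pnorm (G n)) (Rmult A (pow Rr n)) /\ Rle (pnorm (Z n)) (Rmult A (pow Rr n)) /\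
    Rle (Rabs (l n)) (Rmult A (pow Rr n)).
Proof.
move=> ha hb hq hk.
have [G [Z [l [A [Rr [[G0 Z0 G1 l0] [[H1 H2 H3 H4] [R0 H5]]]]]]]] := bifurcation_series a b q ha hb hq k (leq_of_le _ hk).
exists G, Z, l, A, Rr; split.
  by rewrite G0 Z0 G1 l0; do !split => //; move=> t; exact: ev_one.
split; first by move=> n t; rewrite H1 ev_Dop.
split; first exact: H2.
split.
  move=> n; have := H3 n; rewrite -[RHS]/(IZR 0) => <-.
  by congr Jint; apply: functional_extensionality => t; rewrite evM.
split; first by rewrite H4 Jint_jp_sq Jint_jp_cube.
by split=> // n; case: (H5 n).
Qed.
End Restate.

Lemma jp_jacr_fun a b k t : ev (jp a b k) t = / INR (Factorial.fact k) * jacr_fun a b k t.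
Proof. apply ev_jpoly. Qed.

Lemma jcube_pos a b k : -1 < a -> -1 < b -> (1 <= k)%nat -> 0 < a + b + 1 ->
  (a > b \/ (a = b /\ Nat.even k = true)) -> 0 < Jint a b (fun t => ev (jp a b k) t ^ 3).
Proof. intros; rewrite <- Jint_jp_cube; now apply jcube_gt0. Qed.

Lemma jcube_zero a b k : -1 < a -> -1 < b -> (1 <= k)%nat -> 0 < a + b + 1 ->
  a = b -> Nat.odd k = true -> Jint a b (fun t => ev (jp a b k) t ^ 3) = 0.
Proof. intros; rewrite <- Jint_jp_cube; now apply jcube_eq0. Qed.

Lemma psum_C2adm_lip gam c G : 0 < gam < 1 -> ex_series (fun n => Rabs (c n) * pnorm (G n)) ->
  C2adm (psum c G) (psum c (fun n => evd (G n))) (psum c (fun n => evd (evd (G n)))) /\ lip (psum c G).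
Proof.
intros hg Hc; destruct (psum_C2g gam hg c G _ Hc (Rle_refl _)) as [H _].
apply (C2g_regular gam); [lra | exact H].
Qed.

Lemma tail_small (b : nat -> R) eps : ex_series b -> 0 < eps ->
  exists N, Rabs (Series (fun k => b (S N + k)%nat)) < eps.
Proof.
intros Hb he.
assert (H := Series_correct b Hb).
destruct (proj1 (filterlim_locally (sum_n b) (Series b)) H (mkposreal eps he)) as [N HN].
exists N; specialize (HN N (le_n N)); apply ball_R_inv in HN; simpl in HN.
rewrite (Series_incr_n b (S N)) in HN by (lia || exact Hb); simpl pred in HN.
rewrite sum_n_Reals in HN.
replace (sum_f_R0 b N - (sum_f_R0 b N + Series (fun k => b (S N + k)%nat))) with (- Series (fun k => b (S N + k)%nat)) in HN by ring.
now rewrite Rabs_Ropp in HN.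
Qed.

Lemma ev_deriv_on (Q : rpoly) : deriv_on (ev Q) (ev (evd Q)).
Proof.
intros x hx eps he; assert (D := is_derive_ev Q x); apply is_derive_Reals in D.
destruct (D eps he) as [d Hd]; exists d; split; [apply cond_pos|]; intros y hy [h1 h2].
specialize (Hd (y - x)); replace (x + (y - x)) with y in Hd by ring; apply Hd; [|exact h2].
intros Z; rewrite Z, Rabs_R0 in h1; lra.
Qed.

Lemma lip_ev (Q : rpoly) : lip (ev Q).
Proof.
exists (pnorm Q); split; [apply pnorm_ge0|].
apply (lip_interior (ev Q) (ev (evd Q))); [apply ev_deriv_on | apply pnorm_ge0 |].
intros t ht; apply (ev_pnorm Q t); unfold inI; lra.
Qed.

Section JSum.
Variables alpha beta gam : R.
Hypotheses (halpha : -1 < alpha) (hbeta : -1 < beta) (hgam : 0 < gam < 1).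

(** Partial sums are orthogonal to [p] by linearity, and the tail is uniformly small. *)
Lemma Jint_psum_eq0 c (G : nat -> rpoly) (p : rpoly) :
  ex_series (fun n => Rabs (c n) * pnorm (G n)) ->
  (forall n, Jint alpha beta (fun t => ev (G n) t * ev p t) = 0) ->
  Jint alpha beta (fun t => psum c G t * ev p t) = 0.
Proof.
intros Hc H0.
assert (Ap : adm (ev p)) by apply adm_ev.
assert (I1 : 0 <= Jint alpha beta (fun _ => 1)).
{ apply (Jint_ge0 _ _ halpha hbeta); [apply adm_const | intros; lra]. }
set (part := fix part (N : nat) (t : R) := match N with O => 0 | S n => part n t + c n * ev (G n) t end).
assert (Apart : forall N, adm (part N)).
{ induction N as [|n IH]; [apply adm_const|].
  apply (adm_plus (part n) (fun t => c n * ev (G n) t)); [exact IH | apply adm_scal, adm_ev]. }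
assert (Jpart : forall N, Jint alpha beta (fun t => part N t * ev p t) = 0).
{ induction N as [|n IH].
  - transitivity (Jint alpha beta (fun t => 0 * ev p t)).
    + apply (Jint_ext _ _ halpha hbeta); [now apply adm_mult | intros; reflexivity].
    + rewrite Jint_scal by assumption; ring.
  - transitivity (Jint alpha beta (fun t => 1 * (part n t * ev p t) + c n * (ev (G n) t * ev p t))).
    + apply (Jint_ext _ _ halpha hbeta); [apply adm_mult; [apply (Apart (S n)) | exact Ap] | intros; simpl; ring].
    + rewrite Jint_lin by (assumption || apply adm_mult; auto using adm_ev).
      rewrite IH, H0; ring. }
assert (partE : forall N t, part (S N) t = sum_f_R0 (fun n => c n * ev (G n) t) N).
{ induction N as [|n IH]; intros t; [simpl; ring|].
  change (part (S n) t + c (S n) * ev (G (S n)) t = sum_f_R0 (fun n => c n * ev (G n) t) n + c (S n) * ev (G (S n)) t).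
  now rewrite IH. }
destruct (psum_C2adm_lip gam c G hgam Hc) as [[_ [_ [Aps _]]] _].
apply Rabs_eq_0; apply Rle_antisym; [|apply Rabs_pos]; apply le_epsilon; intros eps he.
set (m := pnorm p * Jint alpha beta (fun _ => 1) + 1).
assert (m0 : 0 < m) by (unfold m; generalize (pnorm_ge0 p); intros; assert (0 <= pnorm p * Jint alpha beta (fun _ => 1)) by (apply Rmult_le_pos; assumption); lra).
destruct (tail_small _ (eps / m) Hc ltac:(now apply Rdiv_lt_0_compat)) as [N HN].
assert (E : Jint alpha beta (fun t => psum c G t * ev p t) =
  Jint alpha beta (fun t => (psum c G t - part (S N) t) * ev p t)).
{ transitivity (Jint alpha beta (fun t => psum c G t * ev p t) - Jint alpha beta (fun t => part (S N) t * ev p t)).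
  - rewrite Jpart; ring.
  - rewrite <- Jint_minus by (assumption || now apply adm_mult).
    apply (Jint_ext _ _ halpha hbeta); [apply adm_minus; now apply adm_mult | intros; ring]. }
rewrite E.
apply Rle_trans with ((eps / m * pnorm p) * Jint alpha beta (fun _ => 1)).
- apply (Jint_abs _ _ halpha hbeta); [apply adm_mult; [now apply adm_minus | exact Ap] |].
  intros t ht; assert (hI : inI t) by (unfold inI; lra).
  rewrite Rabs_mult; apply Rmult_le_compat; [apply Rabs_pos | apply Rabs_pos | | apply (ev_pnorm p t hI)].
  apply Rle_trans with (2 := Rlt_le _ _ HN).
  assert (Et : ex_series (fun n => c n * ev (G n) t)).
  { apply (ex_series_dom _ (fun n => Rabs (c n) * pnorm (G n))); [|exact Hc].
    intros n; rewrite Rabs_mult; apply Rmult_le_compat_l; [apply Rabs_pos | apply (ev_pnorm (G n) t hI)]. }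
  rewrite partE; unfold psum; rewrite (Series_incr_n _ (S N)) by (lia || exact Et); simpl pred.
  replace (sum_f_R0 (fun n => c n * ev (G n) t) N + Series (fun k => c (S N + k)%nat * ev (G (S N + k)%nat) t) -
    sum_f_R0 (fun n => c n * ev (G n) t) N) with (Series (fun k => c (S N + k)%nat * ev (G (S N + k)%nat) t)) by ring.
  eapply Rle_trans; [|apply Rle_abs]; apply Series_abs_le.
  + intros n; rewrite Rabs_mult; apply Rmult_le_compat_l; [apply Rabs_pos | apply (ev_pnorm _ t hI)].
  + now apply (ex_series_incr_n (fun n => Rabs (c n) * pnorm (G n))).
- apply Rle_trans with (eps / m * m); [|right; field; lra].
  rewrite Rmult_assoc; apply Rmult_le_compat_l; [apply Rlt_le; now apply Rdiv_lt_0_compat | unfold m; lra].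
Qed.
End JSum.

Section Branch.
Variables alpha beta q gam : R.
Hypotheses (halpha : -1 < alpha) (hbeta : -1 < beta) (hq : 1 < q) (hgam : 0 < gam < 1).
Variable k : nat.
Hypothesis hk : (1 <= k)%nat.
Let lk := lambda_k alpha beta q k.
Let K := eigval alpha beta k.
Let J := Jint alpha beta.
Let P := jp alpha beta k.
Let h := J (fun t => ev P t ^ 2).

Lemma lambda_k_eigval : lk * (q - 1) = K.
Proof. unfold lk, lambda_k, K, eigval; field; lra. Qed.

Lemma eigval_pos : 0 < K.
Proof.
unfold K, eigval; apply le_INR in hk; simpl in hk.
apply Rmult_lt_0_compat; lra.
Qed.

Lemma lambda_k_pos : 0 < lk.
Proof.
assert (H := eigval_pos); assert (E := lambda_k_eigval).
unfold lk, lambda_k in *; apply Rdiv_lt_0_compat; [|lra].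
unfold K, eigval in H; lra.
Qed.

Lemma jacobi_norm_pos : 0 < h.
Proof.
unfold h.
assert (E : J (fun t => ev P t ^ 2) = (/ INR (Factorial.fact k)) ^ 2 * J (fun t => jacr_fun alpha beta k t ^ 2)).
{ unfold J; rewrite <- (Jint_scal _ _ halpha hbeta) by (apply adm_sq, adm_ev).
  apply (Jint_ext _ _ halpha hbeta); [apply adm_sq, adm_ev |].
  intros t ht; unfold P; rewrite jp_jacr_fun; ring. }
rewrite E; apply Rmult_lt_0_compat; [apply pow_lt, Rinv_0_lt_compat, INR_fact_lt_0 | now apply jacr_fun_norm].
Qed.

Lemma eigval_inj i : eigval alpha beta i = K -> i = k.
Proof.
unfold K, eigval; intros E.
assert (F : (INR i - INR k) * (INR i + INR k + (alpha + beta + 1)) = 0) by lra.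
apply le_INR in hk; simpl in hk; assert (0 <= INR i) by apply pos_INR.
apply Rmult_integral in F; destruct F as [F|F]; [apply INR_eq; lra | exfalso].
lra.
Qed.

Lemma resolvent_k : exists kap, 0 < kap /\ forall d d1 d2, C2adm d d1 d2 -> lip d ->
  J (fun t => d t * ev P t) = 0 ->
  kap ^ 2 * J (fun t => d t ^ 2) <= J (fun t => (DI alpha beta d1 d2 t + K * d t) ^ 2).
Proof.
destruct (resolvent_bound alpha beta halpha hbeta K) as [kap [k0 H]]; exists kap; split; [exact k0|].
intros d d1 d2 HC HL HP; apply H; [exact HC | exact HL |].
intros i Hi; rewrite (eigval_inj i Hi).
assert (Ad : adm d) by apply HC.
transitivity (J (fun t => INR (Factorial.fact k) * (d t * ev P t))).
- apply (Jint_ext _ _ halpha hbeta); [apply adm_mult; [exact Ad | apply adm_ev] |].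
  intros t ht; unfold P; rewrite jp_jacr_fun; field; apply INR_fact_neq_0.
- unfold J; rewrite Jint_scal by (assumption || (apply adm_mult; [exact Ad | apply adm_ev])).
  fold J; rewrite HP; ring.
Qed.

Theorem branch_theorem :
  bifurcation_point alpha beta q gam lk /\
  exists eps delta (U : R -> R -> R) (L : R -> R),
       0 < eps /\ 0 < delta /\
       path_smooth gam delta U /\ real_smooth delta L /\
       is_one (U 0) /\ L 0 = lk /\
       (forall s, -delta < s < delta -> is_solution alpha beta q gam (U s) (L s)) /\
       (forall s, -delta < s < delta -> s <> 0 -> ~ is_one (U s)) /\
       (forall u mu, is_solution alpha beta q gam u mu -> near gam lk eps u mu ->
          ~ is_one u ->
          exists s, -delta < s < delta /\ s <> 0 /\
            (forall t, inI t -> u t = U s t) /\ mu = L s) /\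
       (exists V, path_deriv gam delta U V /\ forall t, V 0 t = ev P t) /\
       Derive L 0 = - q * lk / (2 * h) * J (fun t => ev P t ^ 3).
Proof.
destruct (branch_series alpha beta q k halpha hbeta hq hk)
  as [G [Z [l [A [Rr [[G0 [Z0 [G1 l0]]] [HD [HP [HO [Hl1 [R0 HB]]]]]]]]]]].
fold P in G1, HO, Hl1; fold lk in l0, Hl1; fold J in Hl1; fold h in Hl1.
set (d0 := / Rr).
assert (d00 : 0 < d0) by now apply Rinv_0_lt_compat.
assert (A0 : 0 <= A).
{ destruct (HB 0%nat) as [H _]; simpl in H; generalize (pnorm_ge0 (G 0%nat)); intros; lra. }
assert (geo : forall (x : nat -> R), (forall n, 0 <= x n) -> (forall n, x n <= A * Rr ^ n) ->
  forall rho, 0 < rho < d0 -> exists B, forall n, x n * rho ^ n <= B).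
{ intros x x0 Hx rho hr; exists A; intros n.
  assert (p0 : 0 < rho ^ n) by (apply pow_lt; lra).
  apply Rle_trans with (A * Rr ^ n * rho ^ n); [apply Rmult_le_compat_r; [lra | apply Hx]|].
  rewrite Rmult_assoc, <- Rpow_mult_distr.
  rewrite <- (Rmult_1_r A) at 2; apply Rmult_le_compat_l; [exact A0|].
  rewrite <- (pow1 n); apply pow_incr.
  assert (Rr * d0 = 1) by (unfold d0; field; lra). nra. }
assert (gG : geom_bounded d0 G) by (intros rho hr; apply geo; [intros; apply pnorm_ge0 | apply HB | exact hr]).
assert (gZ : geom_bounded d0 Z) by (intros rho hr; apply geo; [intros; apply pnorm_ge0 | apply HB | exact hr]).
assert (gl : forall rho, 0 < rho < d0 -> exists B, forall n, Rabs (l n) * rho ^ n <= B).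
{ intros rho hr; apply geo; [intros; apply Rabs_pos | apply HB | exact hr]. }
assert (gtail : forall H, geom_bounded d0 H -> geom_bounded d0 (fun n => H (S n))).
{ intros H gH rho hr; destruct (gH rho hr) as [B HBB]; exists (B / rho); intros n.
  apply Rmult_le_reg_r with rho; [lra|]; replace (B / rho * rho) with B by (field; lra).
  specialize (HBB (S n)); simpl in HBB; lra. }
(* [U - 1] is [s] times the series of [G1s], and also [s P] plus [s ^ 2] times the series of [G2s]:
   the first form measures the distance to 1, the second shows the component along [P]. *)
set (G1s := fun n => G (S n)); set (G2s := fun n => G (S (S n))).
assert (gG1 : geom_bounded d0 G1s) by now apply gtail.
assert (gG2 : geom_bounded d0 G2s) by now apply (gtail (fun n => G (S n))).
set (U := ppath G).
set (L := PSeries l).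
assert (CVl : forall s, Rabs s < d0 -> Rbar_lt (Rabs s) (CV_radius l)) by (intros; now apply CV_radius_gt with d0).
set (C1 := Series (fun n => Rabs ((d0 / 2) ^ n) * pnorm (G1s n))).
assert (XC1 : ex_series (fun n => Rabs ((d0 / 2) ^ n) * pnorm (G1s n))).
{ apply geom_bounded_ex_series with d0; [exact gG1 | rewrite Rabs_pos_eq; lra]. }
assert (C10 : 0 <= C1).
{ apply Series_ge0; [|exact XC1]; intros n; apply Rmult_le_pos; [apply Rabs_pos | apply pnorm_ge0]. }
assert (Udec : forall s t, Rabs s < d0 -> inI t -> U s t - 1 = psum (fun n => s * s ^ n) G1s t).
{ intros s t hs ht; unfold U, ppath, psum.
  rewrite (Series_incr_1 (fun n => s ^ n * ev (G n) t)) by now apply ppath_summable with d0.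
  rewrite G0; simpl pow; rewrite Rmult_1_l.
  replace (1 + Series (fun n => s * s ^ n * ev (G (S n)) t) - 1) with (Series (fun n => s * s ^ n * ev (G (S n)) t)) by ring.
  reflexivity. }
assert (Xs : forall s, Rabs s <= d0 / 2 -> ex_series (fun n => Rabs (s * s ^ n) * pnorm (G1s n)) /\
   Series (fun n => Rabs (s * s ^ n) * pnorm (G1s n)) <= Rabs s * C1).
{ intros s hs.
  assert (T : forall n, Rabs (s * s ^ n) * pnorm (G1s n) <= Rabs s * (Rabs ((d0 / 2) ^ n) * pnorm (G1s n))).
  { intros n; rewrite Rabs_mult, Rmult_assoc; apply Rmult_le_compat_l; [apply Rabs_pos|].
    apply Rmult_le_compat_r; [apply pnorm_ge0|]; rewrite <- !RPow_abs; apply pow_incr.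
    split; [apply Rabs_pos | rewrite (Rabs_pos_eq (d0 / 2)); lra]. }
  assert (X : ex_series (fun n => Rabs s * (Rabs ((d0 / 2) ^ n) * pnorm (G1s n)))) by now apply (ex_series_scal_l (V := R_NormedModule)).
  assert (N : forall n, 0 <= Rabs (s * s ^ n) * pnorm (G1s n)) by (intros; apply Rmult_le_pos; [apply Rabs_pos | apply pnorm_ge0]).
  split.
  - apply (ex_series_dom _ _ ltac:(intros n; rewrite Rabs_pos_eq by apply N; apply T) X).
  - unfold C1; rewrite <- Series_scal_l; apply Series_le; [|exact X]; intros n; split; [apply N | apply T]. }
assert (Ubd : forall s t, Rabs s <= d0 / 2 -> inI t -> Rabs (U s t - 1) <= Rabs s * C1).
{ intros s t hs ht; rewrite Udec by (lra || exact ht).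
  destruct (Xs s hs) as [X1 X2]; exact (proj1 (proj2 (psum_C2g gam hgam _ _ _ X1 X2)) t ht). }
assert (CP := C2adm_ev P).
assert (lipP := lip_ev P).
(* For fixed [t] all series are scalar power series in [s]. [power_ode] identifies the one of [Z]
   with [u^q], which requires [u > 0] along the whole way from 0 to [s]; the Cauchy product of [l]
   with [G - Z] then yields the equation. *)
assert (sol : forall s r, Rabs s < r <= d0 -> 0 < L s ->
  (forall s' t, Rabs s' < r -> inI t -> 0 < U s' t) ->
  is_solution alpha beta q gam (U s) (L s)).
{ intros s r hs hL hU.
  assert (s0 : 0 <= Rabs s) by apply Rabs_pos.
  split; [exact hL|]; split; [intros t ht; apply hU; [lra | exact ht]|].
  assert (XG : ex_series (fun n => Rabs (s ^ n) * pnorm (G n))) by (apply geom_bounded_ex_series with d0; [exact gG | lra]).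
  destruct (psum_C2g gam hgam _ _ _ XG (Rle_refl _)) as [HC _].
  do 2 eexists; split; [exact HC|]; intros t ht.
  set (a := fun n => ev (G n) t); set (z := fun n => ev (Z n) t).
  assert (Ba : forall rho, 0 < rho < d0 -> exists B, forall n, Rabs (a n) * rho ^ n <= B).
  { intros rho hr; destruct (gG rho hr) as [B HBB]; exists B; intros n; eapply Rle_trans; [|apply HBB].
    apply Rmult_le_compat_r; [apply pow_le; lra | apply (ev_pnorm (G n) t ht)]. }
  assert (Bz : forall rho, 0 < rho < d0 -> exists B, forall n, Rabs (z n) * rho ^ n <= B).
  { intros rho hr; destruct (gZ rho hr) as [B HBB]; exists B; intros n; eapply Rle_trans; [|apply HBB].
    apply Rmult_le_compat_r; [apply pow_le; lra | apply (ev_pnorm (Z n) t ht)]. }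
  assert (Baz : forall rho, 0 < rho < d0 -> exists B, forall n, Rabs (a n - z n) * rho ^ n <= B).
  { intros rho hr; destruct (Ba rho hr) as [B1 H1]; destruct (Bz rho hr) as [B2 H2].
    exists (B1 + B2); intros n; specialize (H1 n); specialize (H2 n).
    assert (0 <= rho ^ n) by (apply pow_le; lra).
    apply Rle_trans with ((Rabs (a n) + Rabs (z n)) * rho ^ n); [|lra].
    apply Rmult_le_compat_r; [assumption|]; unfold Rminus; eapply Rle_trans; [apply Rabs_triang|]; rewrite Rabs_Ropp; lra. }
  assert (Ua : forall s', U s' t = PSeries a s').
  { intros s'; unfold U, ppath, psum, PSeries; apply Series_ext; intros n; apply Rmult_comm. }
  assert (Pz : PSeries z s = Rpower (U s t) q).
  { rewrite Ua; apply (power_ode q d0 a z Ba Bz (G0 t) (Z0 t) (fun n => HP n t) r); [lra | | lra].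
    intros s' hs'; rewrite <- Ua; apply hU; assumption. }
  assert (Ed : (1 - t ^ 2) * psum (fun n => s ^ n) (fun n => evd (evd (G n))) t +
     (beta - alpha - (alpha + beta + 2) * t) * psum (fun n => s ^ n) (fun n => evd (G n)) t = L s * (U s t - Rpower (U s t) q)).
  { assert (X1 : ex_series (fun n => s ^ n * ev (evd (G n)) t)).
    { apply (ex_series_dom _ (fun n => Rabs (s ^ n) * pnorm (G n))); [|exact XG]; intros n; rewrite Rabs_mult.
      apply Rmult_le_compat_l; [apply Rabs_pos | apply (ev_pnorm (G n) t ht)]. }
    assert (X2 : ex_series (fun n => s ^ n * ev (evd (evd (G n))) t)).
    { apply (ex_series_dom _ (fun n => Rabs (s ^ n) * pnorm (G n))); [|exact XG]; intros n; rewrite Rabs_mult.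
      apply Rmult_le_compat_l; [apply Rabs_pos | apply (ev_pnorm (G n) t ht)]. }
    unfold psum; rewrite <- Series_lin by assumption.
    transitivity (PSeries (PS_mult l (fun n => a n - z n)) s).
    - unfold PSeries; apply Series_ext; intros n; unfold a, z; rewrite HD; unfold DI; ring.
    - rewrite PSeries_mult; [|apply CVl; lra | apply CV_radius_gt with d0; [exact Baz | lra]].
      unfold L; f_equal; rewrite <- Pz, Ua.
      transitivity (PSeries (PS_minus a z) s).
      + apply PSeries_ext; intros n; reflexivity.
      + apply PSeries_minus; apply CV_radius_inside; (apply CV_radius_gt with d0; [assumption | lra]). }
  apply Rminus_diag_eq; exact Ed. }
assert (K0 := eigval_pos); assert (lk0 := lambda_k_pos); assert (h0 := jacobi_norm_pos).
destruct resolvent_k as [kap [kap0 Hres]].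
set (e2 := Rmin ((q - 1) / 4) (kap / (18 * (lk + 1)))).
assert (he2 : 0 < e2 /\ e2 <= (q - 1) / 4 /\ e2 * (18 * (lk + 1)) <= kap).
{ assert (0 < kap / (18 * (lk + 1))) by (apply Rdiv_lt_0_compat; lra).
  split; [unfold e2; apply Rmin_case; lra|]; split; [apply Rmin_l|].
  apply Rle_trans with (kap / (18 * (lk + 1)) * (18 * (lk + 1))); [|right; field; lra].
  apply Rmult_le_compat_r; [lra | apply Rmin_r]. }
set (eta := Rmin 1 (kap / (18 * (q - 1)))).
assert (heta : 0 < eta /\ eta <= 1 /\ eta * (18 * (q - 1)) <= kap).
{ assert (0 < kap / (18 * (q - 1))) by (apply Rdiv_lt_0_compat; lra).
  split; [unfold eta; apply Rmin_case; lra|]; split; [apply Rmin_l|].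
  apply Rle_trans with (kap / (18 * (q - 1)) * (18 * (q - 1))); [|right; field; lra].
  apply Rmult_le_compat_r; [lra | apply Rmin_r]. }
destruct (nonlin_linearized q e2 (proj1 he2)) as [del [Hdel HF]].
assert (Lcont : forall e, 0 < e -> exists d, 0 < d /\ forall s, Rabs s < d -> Rabs (L s - lk) < e).
{ intros e he.
  assert (Hc : continuous L 0).
  { eapply continuous_is_derive; apply is_derive_PSeries; apply CVl; rewrite Rabs_R0; exact d00. }
  destruct (proj1 (filterlim_locally L (L 0)) Hc (mkposreal e he)) as [[d dp] Hd].
  exists d; split; [exact dp|]; intros s hs.
  replace lk with (L 0) by (unfold L; rewrite PSeries_0; exact l0).
  apply (ball_R_inv (L 0) (L s) (mkposreal e he)); apply Hd; change (Rabs (s - 0) < d); now rewrite Rminus_0_r. }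
destruct (Lcont (Rmin eta (lk / 2)) ltac:(apply Rmin_case; lra)) as [dL [dL0 HL]].
(* [d0 / 4] keeps the series convergent, [del / (C1 + 1)] keeps [|U - 1| <= del < 1] and so [U]
   positive, and [dL] keeps [L] positive and within [eta] of [lk]. *)
set (delta := Rmin (Rmin (d0 / 4) (del / (C1 + 1))) dL).
assert (hdelta : 0 < delta /\ delta <= d0 / 4 /\ delta <= del / (C1 + 1) /\ delta <= dL).
{ assert (0 < del / (C1 + 1)) by (apply Rdiv_lt_0_compat; lra).
  unfold delta; generalize (Rmin_l (Rmin (d0 / 4) (del / (C1 + 1))) dL) (Rmin_r (Rmin (d0 / 4) (del / (C1 + 1))) dL)
    (Rmin_l (d0 / 4) (del / (C1 + 1))) (Rmin_r (d0 / 4) (del / (C1 + 1))); intros.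
  repeat split; try lra; repeat apply Rmin_case; lra. }
assert (Usm : forall s t, Rabs s <= delta -> inI t -> Rabs (U s t - 1) <= del).
{ intros s t hs ht; eapply Rle_trans; [apply Ubd; [lra | exact ht]|].
  apply Rle_trans with (del / (C1 + 1) * (C1 + 1)); [|right; field; lra].
  apply Rmult_le_compat; [apply Rabs_pos | lra | lra | lra]. }
assert (Lsm : forall s, Rabs s < delta -> Rabs (L s - lk) < eta /\ Rabs (L s - lk) < lk / 2).
{ intros s hs; specialize (HL s ltac:(lra)).
  generalize (Rmin_l eta (lk / 2)) (Rmin_r eta (lk / 2)); intros; lra. }
assert (hC1 : delta * (C1 + 1) <= del).
{ apply Rle_trans with (del / (C1 + 1) * (C1 + 1)); [apply Rmult_le_compat_r; lra | right; field; lra]. }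
assert (solU : forall s, - delta < s < delta -> is_solution alpha beta q gam (U s) (L s)).
{ intros s hs; assert (hs' : Rabs s < delta) by (apply Rabs_def1; lra).
  apply (sol s delta); [lra | |].
  - destruct (Lsm s hs') as [_ H]; apply Rabs_def2 in H; lra.
  - intros s' t h' ht; assert (H := Usm s' t ltac:(lra) ht); apply Rabs_le_between in H; lra. }
(* All coefficients from [s ^ 2] on are orthogonal to [P], so the path parameter is the coordinate
   along [P]. *)
assert (orth : forall s, Rabs s < delta -> J (fun t => (U s t - 1) * ev P t) = s * h).
{ intros s hs.
  assert (XG2 : ex_series (fun n => Rabs (s ^ n) * pnorm (G2s n))) by (apply geom_bounded_ex_series with d0; [exact gG2 | lra]).
  assert (Aw : adm (psum (fun n => s ^ n) G2s)) by apply (psum_C2adm_lip gam _ G2s hgam XG2).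
  assert (W0 : J (fun t => psum (fun n => s ^ n) G2s t * ev P t) = 0) by (apply (Jint_psum_eq0 alpha beta gam halpha hbeta hgam); [exact XG2 | exact HO]).
  assert (EU : forall t, inI t -> U s t - 1 = s * ev P t + s ^ 2 * psum (fun n => s ^ n) G2s t).
  { intros t ht; rewrite Udec by (lra || exact ht); unfold psum.
    assert (XX : ex_series (fun n => s * s ^ n * ev (G1s n) t)).
    { apply (ex_series_dom _ (fun n => Rabs (s * s ^ n) * pnorm (G1s n))); [|apply Xs; lra].
      intros n; rewrite Rabs_mult; apply Rmult_le_compat_l; [apply Rabs_pos | apply (ev_pnorm _ t ht)]. }
    rewrite Series_incr_1 by exact XX; rewrite <- Series_scal_l; unfold G1s at 1; rewrite G1.
    f_equal; [simpl; ring|]; apply Series_ext; intros n; unfold G1s, G2s; simpl; ring. }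
  transitivity (J (fun t => s * (ev P t ^ 2) + s ^ 2 * (psum (fun n => s ^ n) G2s t * ev P t))).
  - symmetry; apply (Jint_ext _ _ halpha hbeta); [|].
    + apply adm_plus; apply adm_scal; [apply adm_sq, adm_ev | apply adm_mult; [exact Aw | apply adm_ev]].
    + intros t ht; rewrite EU by (unfold inI; lra); ring.
  - unfold J; rewrite Jint_lin by (assumption || apply adm_sq, adm_ev || (apply adm_mult; [exact Aw | apply adm_ev])).
    fold J; rewrite W0; fold h; ring. }
assert (data : forall u mu s, is_solution alpha beta q gam u mu -> (forall t, inI t -> Rabs (u t - 1) <= del) ->
  Rabs (mu - lk) <= eta -> J (fun t => (u t - 1) * ev P t) = s * h ->
  exists v1 v2, deriv_on (fun t => u t - 1) v1 /\ branch_data alpha beta q lk (ev P) eta del (fun t => u t - 1) v1 v2 mu s).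
{ intros u mu s Hs Hu Hm Hj; destruct (solution_split alpha beta q gam u mu Hs) as [v1 [v2 [HC [_ HE]]]].
  destruct (C2g_regular gam _ v1 v2 (proj1 hgam) HC) as [HA HLp].
  exists v1, v2; split; [apply HC|].
  split; [exact HA|]; split; [exact HLp|]; split; [intros t ht; apply HE; unfold inI; lra|].
  split; [intros t ht; apply Hu; unfold inI; lra|]; split; [exact Hm | exact Hj]. }
assert (Ep : forall t, -1 < t < 1 -> DI alpha beta (ev (evd P)) (ev (evd (evd P))) t = - K * ev P t).
{ intros t _; apply jp_eigen. }
set (I1 := J (fun _ => 1)).
assert (I10 : 0 <= I1).
{ apply (Jint_ge0 _ _ halpha hbeta); [apply adm_const | intros; lra]. }
set (m := pnorm P * I1 + 1).
assert (m0 : 0 < m).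
{ assert (0 <= pnorm P * I1) by (apply Rmult_le_pos; [apply pnorm_ge0 | exact I10]); unfold m; lra. }
assert (nontriv : forall s, - delta < s < delta -> s <> 0 -> ~ is_one (U s)).
{ intros s hs sn H1; assert (O1 := orth s ltac:(apply Rabs_def1; lra)).
  assert (O2 : J (fun t => (U s t - 1) * ev P t) = 0).
  { transitivity (J (fun t => 0 * ev P t)).
    - symmetry; apply (Jint_ext _ _ halpha hbeta); [apply adm_scal, adm_ev |].
      intros t ht; rewrite H1 by (unfold inI; lra); ring.
    - unfold J; rewrite Jint_scal by (assumption || apply adm_ev); ring. }
  rewrite O2 in O1; symmetry in O1; apply Rmult_integral in O1; destruct O1; lra. }
split.
{ intros eps he; destruct (Lcont eps he) as [d [dp Hd]].
  set (s := Rmin (Rmin delta d) (eps / (5 * C1 + 1)) / 2).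
  assert (k0 : 0 < eps / (5 * C1 + 1)) by (apply Rdiv_lt_0_compat; lra).
  assert (hs : 0 < s /\ s < delta /\ s < d /\ s < eps / (5 * C1 + 1)).
  { generalize (Rmin_l (Rmin delta d) (eps / (5 * C1 + 1))) (Rmin_r (Rmin delta d) (eps / (5 * C1 + 1)))
      (Rmin_l delta d) (Rmin_r delta d); intros.
    assert (0 < Rmin (Rmin delta d) (eps / (5 * C1 + 1))) by (repeat apply Rmin_case; lra).
    unfold s; lra. }
  exists (U s), (L s); split; [apply solU; lra|]; split; [|apply nontriv; lra].
  assert (rs : Rabs s = s) by (apply Rabs_pos_eq; lra).
  split; [|apply Hd; lra].
  destruct (Xs s ltac:(lra)) as [X1 X2].
  apply (c2g_norm_lt_ext gam (psum (fun n => s * s ^ n) G1s)).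
  - intros t ht; symmetry; apply Udec; [lra | exact ht].
  - apply (psum_norm_lt gam hgam); [exact he | exact X1 |].
    apply Rle_lt_trans with (5 * (Rabs s * C1)); [lra|]; rewrite rs.
    apply Rle_lt_trans with (s * (5 * C1 + 1)); [lra|].
    replace eps with (eps / (5 * C1 + 1) * (5 * C1 + 1)) by (field; lra).
    apply Rmult_lt_compat_r; lra. }
(* A solution in the neighborhood has coordinate at most [eps * m / h] along [P]; the last bound
   keeps it inside the parameter interval. *)
set (eps := Rmin (Rmin del eta) (delta * h / (2 * m))).
assert (heps : 0 < eps /\ eps <= del /\ eps <= eta /\ eps <= delta * h / (2 * m)).
{ assert (0 < delta * h / (2 * m)) by (apply Rdiv_lt_0_compat; [apply Rmult_lt_0_compat; lra | lra]).
  unfold eps; generalize (Rmin_l (Rmin del eta) (delta * h / (2 * m))) (Rmin_r (Rmin del eta) (delta * h / (2 * m)))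
    (Rmin_l del eta) (Rmin_r del eta); intros.
  split; [apply Rmin_case; [apply Rmin_case|]; lra | repeat split; lra]. }
exists eps, delta, U, L.
split; [lra|]; split; [lra|].
assert (gGd : geom_bounded delta G) by (intros rho hr; apply gG; lra).
split; [intros n; now apply ppath_Cn|].
split; [intros n s hs; apply ex_derive_n_PSeries, CVl; apply Rabs_def1; lra|].
split.
{ intros t ht; assert (H := Ubd 0 t ltac:(rewrite Rabs_R0; lra) ht).
  rewrite Rabs_R0, Rmult_0_l in H; generalize (Rabs_pos (U 0 t - 1)); intros.
  assert (Rabs (U 0 t - 1) = 0) by lra; apply Rabs_eq_0 in H1; lra. }
split; [unfold L; rewrite PSeries_0; exact l0|].
split; [exact solU|]; split; [exact nontriv|]; split; [|split].
- intros u mu Hs Hn Hone.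
  destruct (near_bound gam lk eps u mu Hn) as [Hu Hm].
  set (s := J (fun t => (u t - 1) * ev P t) / h).
  assert (sE : J (fun t => (u t - 1) * ev P t) = s * h) by (unfold s; field; lra).
  destruct (data u mu s Hs ltac:(intros t ht; specialize (Hu t ht); lra) ltac:(lra) sE) as [v1 [v2 [Dv Hv]]].
  assert (Av : adm (fun t => u t - 1)) by apply Hv.
  assert (hs : Rabs s < delta).
  { assert (Bj : Rabs (J (fun t => (u t - 1) * ev P t)) <= eps * pnorm P * I1).
    { apply (Jint_abs _ _ halpha hbeta); [apply adm_mult; [exact Av | apply adm_ev] |].
      intros t ht; assert (hI : inI t) by (unfold inI; lra); rewrite Rabs_mult.
      apply Rmult_le_compat; [apply Rabs_pos | apply Rabs_pos | apply Rlt_le, Hu, hI | apply (ev_pnorm P t hI)]. }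
    unfold s, Rdiv; rewrite Rabs_mult, Rabs_inv, (Rabs_pos_eq h) by lra.
    apply Rmult_lt_reg_r with h; [exact h0|]; rewrite Rmult_assoc, Rinv_l, Rmult_1_r by lra.
    apply Rle_lt_trans with (eps * m); [unfold m; lra|].
    apply Rle_lt_trans with (delta * h / (2 * m) * m); [apply Rmult_le_compat_r; lra|].
    replace (delta * h / (2 * m) * m) with (delta * h / 2) by (field; lra).
    assert (0 < delta * h) by (apply Rmult_lt_0_compat; lra); lra. }
  assert (hs2 : - delta < s < delta) by (apply Rabs_def2 in hs; lra).
  destruct (data (U s) (L s) s (solU s hs2) ltac:(intros t ht; apply Usm; [lra | exact ht])
    ltac:(destruct (Lsm s hs); lra) (orth s hs)) as [w1 [w2 [Dw Hw]]].
  assert (hdel : 0 <= del < 1) by lra.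
  destruct (branch_unique alpha beta q halpha hbeta hq K kap lk (ev P) _ _ kap0 lk0 lambda_k_eigval CP lipP Ep h0 Hres
    e2 eta del he2 heta HF hdel _ _ _ _ _ _ _ _ _ Hv Hw) as [E Hor].
  (* By [branch_norm] a solution with coordinate 0 is the constant 1. *)
  assert (sn : s <> 0).
  { intros s00; apply Hone.
    assert (N := branch_norm alpha beta q halpha hbeta hq K kap lk (ev P) _ _ kap0 lk0 lambda_k_eigval CP lipP Ep h0 Hres
      e2 eta del he2 heta HF hdel _ _ _ _ _ Hv).
    rewrite s00 in N; replace (2 * (0 ^ 2 * Jint alpha beta (fun t => ev P t ^ 2))) with 0 in N by ring.
    assert (N0 : Jint alpha beta (fun t => (u t - 1) ^ 2) = 0).
    { apply Rle_antisym; [exact N|].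
      apply (Jint_ge0 _ _ halpha hbeta); [now apply adm_sq | intros; apply pow2_ge_0]. }
    assert (V0 := Jint_sq_eq0 _ _ halpha hbeta _ Av N0).
    intros t ht; assert (H := deriv_on_eq0 _ v1 Dv V0 t ht); simpl in H; lra. }
  exists s; split; [exact hs2|]; split; [exact sn|]; split; [|destruct Hor; [contradiction | assumption]].
  intros t ht.
  assert (Dd := deriv_on_lin 1 (-1) _ _ _ _ Dv Dw).
  assert (H := deriv_on_eq0 _ _ Dd ltac:(intros t' ht'; specialize (E t' ht'); simpl in E; lra) t ht); simpl in H; lra.
- exists (ppath (shiftd G)); split; [now apply ppath_deriv|].
  intros t; unfold ppath, psum.
  transitivity (PSeries (fun n => ev (shiftd G n) t) 0).
  + unfold PSeries; apply Series_ext; intros n; apply Rmult_comm.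
  + rewrite PSeries_0, ev_shiftd, G1; simpl; ring.
(* The derivative at 0 is the coefficient [l 1], whose value comes from [series_lam1]. *)
- unfold L; rewrite Derive_PSeries by (apply CVl; rewrite Rabs_R0; exact d00).
  rewrite PSeries_0; unfold PS_derive; rewrite Hl1; simpl INR; field; lra.
Qed.
End Branch.

Lemma int_m11_jacobi_sq a b k : -1 < a -> -1 < b ->
  int_m11 (fun t => jacobiP a b k t ^ 2 * jweight a b t) = Jint a b (fun t => ev (jp a b k) t ^ 2).
Proof.
intros ha hb; apply Jint_int_m11; [exact ha | exact hb | apply adm_sq, adm_ev |].
intros t ht; now rewrite jacobiP_ev.
Qed.

Lemma int_m11_jacobi_cube a b k : -1 < a -> -1 < b ->
  int_m11 (fun t => jacobiP a b k t ^ 3 * jweight a b t) = Jint a b (fun t => ev (jp a b k) t ^ 3).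
Proof.
intros ha hb; apply Jint_int_m11; [exact ha | exact hb | |].
- apply (adm_mult (ev (jp a b k)) (fun t => ev (jp a b k) t ^ 2)); [apply adm_ev | apply adm_sq, adm_ev].
- intros t ht; now rewrite jacobiP_ev.
Qed.

Theorem theorem3p2 (alpha beta q gam : R)
  (halpha : -1 < alpha) (hbeta : -1 < beta) (hq : 1 < q) (hgam : 0 < gam < 1) :
  (* local rigidity away from the lambda_k *)
  (forall lam, 0 < lam -> (forall k : nat, (1 <= k)%nat -> lam <> lambda_k alpha beta q k) ->
     exists eps, 0 < eps /\
       forall u mu, is_solution alpha beta q gam u mu -> near gam lam eps u mu -> is_one u)
  /\
  (* bifurcation at each lambda_k *)
  (forall k : nat, (1 <= k)%nat ->
     let lk := lambda_k alpha beta q k in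
     bifurcation_point alpha beta q gam lk /\
     exists eps delta (U : R -> R -> R) (L : R -> R),
       0 < eps /\ 0 < delta /\
       path_smooth gam delta U /\ real_smooth delta L /\
       is_one (U 0) /\ L 0 = lk /\
       (forall s, -delta < s < delta -> is_solution alpha beta q gam (U s) (L s)) /\
       (forall s, -delta < s < delta -> s <> 0 -> ~ is_one (U s)) /\
       (forall u mu, is_solution alpha beta q gam u mu -> near gam lk eps u mu ->
          ~ is_one u ->
          exists s, -delta < s < delta /\ s <> 0 /\
            (forall t, inI t -> u t = U s t) /\ mu = L s) /\
       (exists V, path_deriv gam delta U V /\
          forall t, -1 < t < 1 -> V 0 t = jacobiP alpha beta k t) /\
       (let I2 := int_m11 (fun t => jacobiP alpha beta k t ^ 2 * jweight alpha beta t) in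
        let I3 := int_m11 (fun t => jacobiP alpha beta k t ^ 3 * jweight alpha beta t) in
        let C := - q * lk / (2 * I2) in
        Derive L 0 = C * I3 /\ C < 0 /\
        (0 < alpha + beta + 1 ->
           ((alpha > beta \/ (alpha = beta /\ Nat.even k = true)) -> Derive L 0 < 0) /\
           (alpha = beta /\ Nat.odd k = true -> Derive L 0 = 0)))).
Proof.
split; [now apply local_rigidity|].
intros k hk lk.
destruct (branch_theorem alpha beta q gam halpha hbeta hq hgam k hk)
  as [Hbif [eps [delta [U [L [h1 [h2 [h3 [h4 [h5 [h6 [h7 [h8 [h9 [[V [hV1 hV2]] hL]]]]]]]]]]]]]]].
split; [exact Hbif|]; exists eps, delta, U, L.
do 9 (split; [assumption|]); split.
(* On the open interval Rodrigues' formula with [Rpower] is meaningful and agrees with the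
   polynomial. *)
- exists V; split; [exact hV1|]; intros t ht; now rewrite hV2, jacobiP_ev.
- intros I2 I3 C.
  assert (E2 : I2 = Jint alpha beta (fun t => ev (jp alpha beta k) t ^ 2)) by now apply int_m11_jacobi_sq.
  assert (E3 : I3 = Jint alpha beta (fun t => ev (jp alpha beta k) t ^ 3)) by now apply int_m11_jacobi_cube.
  assert (P2 := jacobi_norm_pos alpha beta halpha hbeta k).
  assert (Plk := lambda_k_pos alpha beta q halpha hbeta hq k hk).
  assert (HC : C < 0).
  { unfold C; rewrite E2; unfold Rdiv; rewrite Ropp_mult_distr_l_reverse, Ropp_mult_distr_l_reverse.
    apply Ropp_lt_gt_0_contravar, Rmult_lt_0_compat; [apply Rmult_lt_0_compat; unfold lk; lra|].
    apply Rinv_0_lt_compat; lra. }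
  assert (HD : Derive L 0 = C * I3) by (rewrite hL; unfold C; rewrite E2, E3; reflexivity).
  split; [exact HD|]; split; [exact HC|]; intros hs; rewrite HD, E3; split.
  + intros H; assert (H3 := jcube_pos alpha beta k halpha hbeta hk hs H); nra.
  + intros [H1 H2]; rewrite (jcube_zero alpha beta k halpha hbeta hk hs H1 H2); ring.
Qed.
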